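(* Suppose (A1)--(A3) (see context) hold and that additionally $m\xi_m^2\log n=o(n)$. Then, for any sequence of functions $\boldsymbol\gamma_n(\cdot):\mathcal T\to\mathbb R^m$ satisfying $g_n=o(\xi_m^{-1})$ and $c_n=o(1)$, where $$g_n:=\sup_{\tau\in\mathcal T}\big\|\mathbb E[\mathbf Z\{F_{Y|X}(\mathbf Z^\top\boldsymbol\gamma_n(\tau)|X)-\tau\}]\big\|,\qquad c_n:=\sup_{x\in\mathcal X,\tau\in\mathcal T}|Q(x;\tau)-\mathbf Z(x)^\top\boldsymbol\gamma_n(\tau)|,$$ we have $$\widehat{\boldsymbol\gamma}(\tau)-\boldsymbol\gamma_n(\tau)=-\frac1nJ_m(\tau)^{-1}\sum_{i=1}^n\psi(Y_i,\mathbf Z_i;\boldsymbol\gamma_n(\tau),\tau)+r_{n,1}(\tau)+r_{n,2}(\tau)+r_{n,3}(\tau)+r_{n,4}(\tau),$$ with remainder terms $r_{n,j}$ bounded as follows: $$\sup_{\tau\in\mathcal T}\|r_{n,1}(\tau)\|\le\frac1{\inf_{\tau\in\mathcal T}\lambda_{\min}(J_m(\tau))}\frac{m\xi_m}n\quad a.s.$$ Moreover, for any $\kappa_n\ll n/\xi_m^2$, sufficiently large $n$, and a constant $C$ independent of $n$, $$P\Big(\sup_{\tau\in\mathcal T}\|r_{n,j}(\tau)\|\le C\Re_j(\kappa_n)\Big)\ge1-2e^{-\kappa_n},\quad j=2,3,4,$$ where $$\Re_2(\kappa_n):=\xi_m\Big(\Big(\frac mn\log n\Big)^{1/2}+\Big(\frac{\kappa_n}n\Big)^{1/2}+g_n\Big)^2,$$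 $$\Re_3(\kappa_n):=\Big(\Big(\frac{m\log n}n\Big)^{1/2}+\Big(\frac{\kappa_n}n\Big)^{1/2}+g_n\Big)^{1/2}\Big(\Big(\frac{m\xi_m\log n}n\Big)^{1/2}+\Big(\frac{\xi_m\kappa_n}n\Big)^{1/2}\Big),$$ $$\Re_4(\kappa_n):=c_n\Big(\Big(\frac mn\log n\Big)^{1/2}+\Big(\frac{\kappa_n}n\Big)^{1/2}\Big)+g_n.$$
   Context: For each $n$, $(X_1,Y_1),\dots,(X_n,Y_n)$ are i.i.d. copies of $(X,Y)\in\mathcal X\times\mathbb R$, $\mathcal X\subset\mathbb R^d$; $d$ and the law of $(X,Y)$ may depend on $n$ (triangular array). $\mathcal T\subset(0,1)$ is a fixed compact interval of quantile levels. $F_{Y|X}(y|x)$ is the conditional distribution function of $Y$ given $X=x$ and $Q(x;\tau)$ its $\tau$-quantile. $\mathbf Z:\mathcal X\to\mathbb R^m$ is a transformation, $m=m_n$ may grow; $\mathbf Z=\mathbf Z(X)$, $\mathbf Z_i=\mathbf Z(X_i)$. $\rho_\tau(u)=(\tau-\mathbf 1(u\le0))u$; $\|\cdot\|$ is the Euclidean norm. $\widehat{\boldsymbol\gamma}(\tau)\in\operatorname{argmin}_{\boldsymbol\gamma\in\mathbb R^m}\sum_{i=1}^n\rho_\tau(Y_i-\boldsymbol\gamma^\top\mathbf Z_i)$. $\psi(Y_i,\mathbf Z_i;\mathbf b,\tau):=\mathbf Z_i(\mathbf 1\{Y_i\le\mathbf Z_i^\top\mathbf b\}-\tau)$. $J_m(\tau):=\mathbb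 E[\mathbf Z\mathbf Z^\top f_{Y|X}(Q(X;\tau)|X)]$. (A1) $\|\mathbf Z_i\|\le\xi_m=O(n^b)$ almost surely for some $b>0$, and $1/M\le\lambda_{\min}(\mathbb E[\mathbf Z\mathbf Z^\top])\le\lambda_{\max}(\mathbb E[\mathbf Z\mathbf Z^\top])\le M$ uniformly in $n$ for some fixed $M>0$. (A2) $F_{Y|X}(y|x)$ is twice differentiable w.r.t. $y$, with derivatives $f_{Y|X}(y|x)$, $f'_{Y|X}(y|x)$, and $\sup_{y,x}|f_{Y|X}(y|x)|<\infty$, $\sup_{y,x}|f'_{Y|X}(y|x)|<\infty$ uniformly in $n$. (A3) Uniformly in $n$, there is a constant $f_{\min}>0$ with $\inf_{\tau\in\mathcal T}\inf_x f_{Y|X}(Q(x;\tau)|x)\ge f_{\min}$. $\kappa_n\ll n/\xi_m^2$ means $\kappa_n>0$ and $\kappa_n\xi_m^2/n\to0$. *)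

(* Defs.v *)
From HB Require Import structures.
From mathcomp Require Import all_boot all_order all_algebra.
From mathcomp Require Import all_classical all_reals all_analysis.

Set Implicit Arguments.
Unset Strict Implicit.
Unset Printing Implicit Defensive.

Import Order.TTheory GRing.Theory Num.Theory.
Import numFieldNormedType.Exports.

Local Open Scope classical_set_scope.
Local Open Scope ring_scope.

Section vectors.
Context {R : realType}.

Definition dotv m (u v : 'cV[R]_m) : R := (u^T *m v) 0 0.

(* The Euclidean norm; the library norm `|v| on matrices is the max norm. *)
Definition enorm m (v : 'cV[R]_m) : R := Num.sqrt (\sum_(j < m) v j 0 ^+ 2).

(* Extreme eigenvalues, only used for symmetric matrices (m > 0), whose
   spectrum is finite and nonempty. For m = 0 both are 0. *)
Definition lambda_min m (A : 'M[R]_m) : R := inf [set a | eigenvalue A a].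
Definition lambda_max m (A : 'M[R]_m) : R := sup [set a | eigenvalue A a].

Definition check_loss (tau u : R) : R := (tau - (u <= 0)%R%:R) * u.

End vectors.

Section probability.
Context {d : measure_display} {T : measurableType d} {R : realType}.
Variable P : probability T R.

(* Inner probability, which is P A whenever A is measurable. It gives a meaning
   to lower bounds on the probability of events defined by uncountable suprema
   or by arbitrary (possibly non-measurable) selections of minimisers. *)
Definition inner_pr (A : set T) : \bar R :=
  ereal_sup [set P B | B in [set B | measurable B /\ B `<=` A]].

(* Mutual independence of a finite family of random elements; taking some of the
   B i equal to setT gives the product rule for subfamilies. *)
Definition mutually_independent d' (S : measurableType d') n
    (V : 'I_n -> T -> S) :=
  forall B : 'I_n -> set S, (forall i, measurable (B i)) ->
    P (\bigcap_(i in [set: 'I_n]) (V i @^-1` B i))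
      = (\prod_(i < n) P (V i @^-1` B i))%E.

Definition same_law d' (S : measurableType d') (V W : T -> S) :=
  forall B : set S, measurable B -> P (V @^-1` B) = P (W @^-1` B).

(* Entrywise expectations. *)
Definition expect_cv m (V : T -> 'cV[R]_m) : 'cV[R]_m :=
  \col_j fine 'E_P[fun w => V w j 0].

Definition expect_mx m (A : T -> 'M[R]_m) : 'M[R]_m :=
  \matrix_(i, j) fine 'E_P[fun w => A w i j].

End probability.

(* R^d with its product (= Borel) sigma-algebra *)
Notation Rd R d := (d.-tuple (measurableTypeR R)).

(* The n-th row of the triangular array: the dimensions, the probability space,
   the support and the law of (X, Y) may all depend on n.
   [condY x] is the conditional law of Y given X = x (a regular version); only
   its values at points x of [calX] matter, and likewise for [Z]. *)
Record qr_row (R : realType) (n : nat) := QrRow {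
  dimX : nat ;
  dimZ : nat ;
  disp : measure_display ;
  Omega : measurableType disp ;
  Pr : probability Omega R ;
  calX : set (Rd R dimX) ;
  X : {RV Pr >-> Rd R dimX} ;
  Y : {RV Pr >-> measurableTypeR R} ;
  Xs : 'I_n -> {RV Pr >-> Rd R dimX} ;
  Ys : 'I_n -> {RV Pr >-> measurableTypeR R} ;
  Z : Rd R dimX -> 'cV[R]_dimZ ;
  condY : R.-pker (Rd R dimX) ~> (measurableTypeR R) ;
  X_in : forall w, calX (X w) ;
  Xs_in : forall i w, calX (Xs i w) ;
  XYs_law : forall i,
    same_law Pr (fun w => (Xs i w, Ys i w)) (fun w => (X w, Y w)) ;
  XYs_indep : mutually_independent Pr (fun i w => (Xs i w, Ys i w)) ;
  Z_meas : forall j, measurable_fun setT (fun x => Z x j 0 : measurableTypeR R) ;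
  condYP : forall (A : set (Rd R dimX)) (B : set (measurableTypeR R)),
    measurable A -> measurable B ->
    Pr (X @^-1` A `&` Y @^-1` B) = (\int[Pr]_(w in X @^-1` A) condY (X w) B)%E
}.

Arguments calX {R n} q.
Arguments X {R n} q.
Arguments Y {R n} q.
Arguments Xs {R n} q i.
Arguments Ys {R n} q i.
Arguments Z {R n} q x.
Arguments condY {R n} q.

Section row.
Context {R : realType} {n : nat}.
Variable D : qr_row R n.
Let m := dimZ D.

Definition condF (x : Rd R (dimX D)) (y : R) : R := fine (condY D x `]-oo, y]%classic).

Definition condf (x : Rd R (dimX D)) : R -> R := derive1 (condF x).

Definition condQ (x : Rd R (dimX D)) (tau : R) : R :=
  inf [set y | tau <= condF x y].

Definition ZX (w : Omega D) : 'cV[R]_m := Z D (X D w).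

Definition Zs (i : 'I_n) (w : Omega D) : 'cV[R]_m := Z D (Xs D i w).

Definition gram : 'M[R]_m := expect_mx (Pr D) (fun w => ZX w *m (ZX w)^T).

Definition Jm (tau : R) : 'M[R]_m :=
  expect_mx (Pr D)
    (fun w => condf (X D w) (condQ (X D w) tau) *: (ZX w *m (ZX w)^T)).

Definition psi (y : R) (z b : 'cV[R]_m) (tau : R) : 'cV[R]_m :=
  ((y <= dotv z b)%R%:R - tau) *: z.

Definition is_qr_estimator (w : Omega D) (tau : R) (b : 'cV[R]_m) :=
  forall b' : 'cV[R]_m,
    \sum_(i < n) check_loss tau (Ys D i w - dotv b (Zs i w))
      <= \sum_(i < n) check_loss tau (Ys D i w - dotv b' (Zs i w)).

Definition g_err (T : set R) (gam : R -> 'cV[R]_m) : \bar R :=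
  ereal_sup [set (enorm (expect_cv (Pr D)
    (fun w => (condF (X D w) (dotv (ZX w) (gam tau)) - tau) *: ZX w)))%:E
    | tau in T].

Definition c_err (T : set R) (gam : R -> 'cV[R]_m) : \bar R :=
  ereal_sup [set `|condQ x tau - dotv (Z D x) (gam tau)|%:E
    | x in calX D & tau in T].

End row.

Arguments Jm {R n} D tau.

Section assumptions.
Context {R : realType}.
Variable D : forall n, qr_row R n.

Definition A1 (xi : nat -> R) :=
  [/\ forall n (i : 'I_n), {ae Pr (D n), forall w, enorm (Zs i w) <= xi n},
      exists2 b : R, 0 < b & xi =O_\oo (fun n => n%:R `^ b) &
      exists2 M : R, 0 < M & forall n, (0 < n)%N ->
        1 / M <= lambda_min (gram (D n)) /\ lambda_max (gram (D n)) <= M].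

Definition A2 :=
  (forall n x, (0 < n)%N -> calX (D n) x -> forall y : R,
     derivable (condF x) y 1 /\ derivable (condf x) y 1) /\
  exists K : R, forall n x, (0 < n)%N -> calX (D n) x -> forall y : R,
     `|condf x y| <= K /\ `|derive1 (condf x) y| <= K.

Definition A3 (T : set R) :=
  exists2 fmin : R, 0 < fmin & forall n, (0 < n)%N -> forall tau, T tau ->
    forall x, calX (D n) x -> fmin <= condf x (condQ x tau).

End assumptions.

(* Uniform norm over T of a vector-valued function *)
Definition unorm (R : realType) m (T : set R) (r : R -> 'cV[R]_m) : \bar R :=
  ereal_sup [set (enorm (r tau))%:E | tau in T].

(* The rates as functions of the sample size n, the dimension m, and the values
   xi_m, g_n, c_n and kappa_n. The errors g_n and c_n are extended reals (g_err,
   c_err) that are finite for large n under the assumptions g_n = o(1/xi_m) and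
   c_n = o(1), so the rates take their [fine] parts. *)
Section rates.
Context {R : realType}.
Implicit Types (n m : nat) (xi g c kappa : R).

Definition rate2 n m xi g kappa : R :=
  xi * (Num.sqrt (m%:R / n%:R * ln n%:R) + Num.sqrt (kappa / n%:R) + g) ^+ 2.

Definition rate3 n m xi g kappa : R :=
  Num.sqrt (Num.sqrt (m%:R * ln n%:R / n%:R) + Num.sqrt (kappa / n%:R) + g) *
  (Num.sqrt (m%:R * xi * ln n%:R / n%:R) + Num.sqrt (xi * kappa / n%:R)).

Definition rate4 n m g c kappa : R :=
  c * (Num.sqrt (m%:R / n%:R * ln n%:R) + Num.sqrt (kappa / n%:R)) + g.

End rates.

(* Main.v *)
Require Import Defs.
From HB Require Import structures.
From mathcomp Require Import all_boot all_order all_algebra.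
From mathcomp Require Import all_classical all_reals all_analysis.
From mathcomp Require Import measurable_realfun.
From mathcomp Require Import ring lra.

Set Implicit Arguments.
Unset Strict Implicit.
Unset Printing Implicit Defensive.

Import Order.TTheory GRing.Theory Num.Theory.
Import numFieldNormedType.Exports.

Local Open Scope classical_set_scope.
Local Open Scope ring_scope.

(** Write [J] for the matrix [Jm], [Delta] for the estimator minus its target
    [gamma_n(tau)], and split the empirical score into its mean and a centred
    process. Then [J *m Delta] is a sum of five vectors and applying the inverse
    of [J] gives the expansion ([solve_expansion]):
    - the score at the target, which is the leading term;
    - [rem1], the score at the minimiser;
    - [rem2], the second-order error of the mean score between target and
      estimator;
    - [rem3], the increment of the centred process between target and estimator;
    - [rem4], the error of evaluating the density at [Z^T gamma_n] instead of the
      conditional quantile.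

    [rem1] is a property of minimisers alone: by the first-order condition
    ([score_at_minimiser]) the score there is carried by the observations that
    are fitted exactly, and almost surely no coefficient vector fits more than
    [m] of them ([ae_exact_fit]).

    The other three follow from one fact: on an event of probability at least
    [1 - 2 exp (- kappa)], the estimator is within
    [t = speed * (sqrt (m log n / n) + sqrt (kappa / n) + g)] of the target for
    all quantile levels at once ([minimiser_close]). The score is nondecreasing
    along rays ([score_mono]), so if the estimator were further away, the score
    in its direction at distance [t] from the target would be at most the score
    at the minimiser, which is of order [m xi / n]. But there its mean is of
    order [t * fmin / M], while the fluctuations are of smaller order
    ([score_ray]). Given the distance [t], the mean score is twice
    differentiable, so [rem2] is of order [xi * t ^+ 2]; the process moves by
    [sqrt (xi * t)] times [sqrt (m log n / n) + sqrt (kappa / n)] over a distance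
    [t], which is [rem3]; and [rem4] is of order [c * t].

    The fluctuations are controlled uniformly by Bernstein's inequality and a
    union bound over grids ([uniform_deviation]). All targets lie in a fixed ball,
    because conditional quantiles are Lipschitz in the level ([gam_spread]), and
    a grid with [n ^ 3] points per half-axis costs only [m log n] in the exponent.
    Between a coefficient vector and its nearest grid point the score changes only
    for observations in a thin band about the grid point, and the proportion of
    those is a mean of bounded variables as well. Since the event is built from
    finitely many measurable ones, it bounds inner probabilities of suprema over
    uncountably many levels. *)

(** * Euclidean vectors *)

Section euclid.
Context {R : realType} {m : nat}.
Implicit Types u v w : 'cV[R]_m.

Lemma dotvE u v : dotv u v = \sum_j u j 0 * v j 0.
Proof. by rewrite /dotv mxE; apply: eq_bigr => j _; rewrite mxE. Qed.

Lemma dotvC u v : dotv u v = dotv v u.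
Proof. by rewrite !dotvE; apply: eq_bigr => j _; rewrite mulrC. Qed.

Lemma dotvDr u v w : dotv u (v + w) = dotv u v + dotv u w.
Proof. by rewrite /dotv mulmxDr mxE. Qed.

Lemma dotvDl u v w : dotv (v + w) u = dotv v u + dotv w u.
Proof. by rewrite !(dotvC _ u) dotvDr. Qed.

Lemma dotvZr a u v : dotv u (a *: v) = a * dotv u v.
Proof. by rewrite /dotv -scalemxAr mxE. Qed.

Lemma dotvZl a u v : dotv (a *: v) u = a * dotv v u.
Proof. by rewrite !(dotvC _ u) dotvZr. Qed.

Lemma dotvNr u v : dotv u (- v) = - dotv u v.
Proof. by rewrite -scaleN1r dotvZr mulN1r. Qed.

Lemma dotvBr u v w : dotv u (v - w) = dotv u v - dotv u w.
Proof. by rewrite dotvDr dotvNr. Qed.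

Lemma dotvBl u v w : dotv (v - w) u = dotv v u - dotv w u.
Proof. by rewrite !(dotvC _ u) dotvBr. Qed.

Lemma dotv0r u : dotv u 0 = 0.
Proof. by rewrite -(scale0r 0) dotvZr mul0r. Qed.

Lemma dotv_sumr (I : Type) (r : seq I) (P : pred I) (F : I -> 'cV[R]_m) u :
  dotv u (\sum_(i <- r | P i) F i) = \sum_(i <- r | P i) dotv u (F i).
Proof.
by elim/big_rec2 : _ => [|i x y _ <-]; rewrite ?dotv0r ?dotvDr.
Qed.

Lemma enorm_ge0 v : 0 <= enorm v. Proof. exact: sqrtr_ge0. Qed.

Lemma enorm_sqr v : enorm v ^+ 2 = dotv v v.
Proof.
rewrite dotvE sqr_sqrtr; last by apply: sumr_ge0 => j _; exact: sqr_ge0.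
by apply: eq_bigr => j _; rewrite expr2.
Qed.

Lemma enorm0 : enorm (0 : 'cV[R]_m) = 0.
Proof. by apply/eqP; rewrite -sqrf_eq0 enorm_sqr dotv0r. Qed.

Lemma enorm_eq0 v : enorm v = 0 -> v = 0.
Proof.
move=> v0; have : dotv v v = 0 by rewrite -enorm_sqr v0 expr0n.
rewrite dotvE => /eqP; rewrite psumr_eq0; last by move=> j _; rewrite -expr2 sqr_ge0.
move=> /allP H; apply/colP => j; rewrite mxE; apply/eqP.
by have := H j; rewrite mem_index_enum mulf_eq0 orbb; apply.
Qed.

Lemma enormZ a v : enorm (a *: v) = `|a| * enorm v.
Proof.
rewrite /enorm -sqrtr_sqr -sqrtrM ?sqr_ge0// mulr_sumr; congr Num.sqrt.
by apply: eq_bigr => j _; rewrite mxE exprMn.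
Qed.

Lemma enormN v : enorm (- v) = enorm v.
Proof. by rewrite -scaleN1r enormZ normrN1 mul1r. Qed.

Lemma normalize_unit v : v != 0 -> enorm ((enorm v)^-1 *: v) = 1.
Proof.
move=> v0; rewrite enormZ ger0_norm ?invr_ge0 ?enorm_ge0// mulVf//.
by apply: contra v0 => /eqP/enorm_eq0/eqP.
Qed.

(** Cauchy--Schwarz, from the square of the difference of the unit vectors. *)
Lemma dotv_le u v : dotv u v <= enorm u * enorm v.
Proof.
have [->|u0] := eqVneq u 0; first by rewrite dotvC dotv0r enorm0 mul0r.
have [->|v0] := eqVneq v 0; first by rewrite dotv0r enorm0 mulr0.
set x := (enorm u)^-1 *: u; set y := (enorm v)^-1 *: v.
have eu : enorm u != 0 by apply: contra u0 => /eqP/enorm_eq0/eqP.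
have ev : enorm v != 0 by apply: contra v0 => /eqP/enorm_eq0/eqP.
have ex : enorm x = 1 := normalize_unit u0.
have ey : enorm y = 1 := normalize_unit v0.
have xx : dotv x x = 1 by rewrite -enorm_sqr ex expr1n.
have yy : dotv y y = 1 by rewrite -enorm_sqr ey expr1n.
have -> : u = enorm u *: x by rewrite scalerA divff// scale1r.
have -> : v = enorm v *: y by rewrite scalerA divff// scale1r.
rewrite dotvZl dotvZr (enormZ (enorm u)) (enormZ (enorm v)) ex ey.
rewrite !ger0_norm ?enorm_ge0//.
have : 0 <= dotv (x - y) (x - y) by rewrite -enorm_sqr sqr_ge0.
rewrite dotvBl !dotvBr xx yy (dotvC y x) => h.
have {}h : dotv x y <= 1 by lra.
by rewrite !mulr1 mulrA ler_piMr// mulr_ge0// enorm_ge0.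
Qed.

Lemma normr_dotv_le u v : `|dotv u v| <= enorm u * enorm v.
Proof.
by rewrite ler_norml dotv_le andbT lerNl -dotvNr (le_trans (dotv_le _ _))// enormN.
Qed.

Lemma enormD u v : enorm (u + v) <= enorm u + enorm v.
Proof.
rewrite -(@ler_pXn2r _ 2)// ?nnegrE ?addr_ge0 ?enorm_ge0//.
rewrite enorm_sqr sqrrD !enorm_sqr dotvDl !dotvDr (dotvC v u).
have := dotv_le u v; lra.
Qed.

Lemma enorm_subC u v : enorm (u - v) = enorm (v - u).
Proof. by rewrite -opprB enormN. Qed.

Lemma enorm_sub3 (a b c d : 'cV[R]_m) :
  enorm (a - d) <= enorm (a - b) + enorm (b - c) + enorm (c - d).
Proof.
have := enormD (a - c) (c - d); have := enormD (a - b) (b - c).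
by rewrite !addrA !subrK; lra.
Qed.

Lemma enorm_sub3_le (a b c d : 'cV[R]_m) A B C : enorm (a - b) <= A ->
  enorm (b - c) <= B -> enorm (c - d) <= C -> enorm (a - d) <= A + B + C.
Proof.
by move=> ab bc cd; apply: (le_trans (enorm_sub3 a b c d)); rewrite !lerD.
Qed.

Lemma ler_enorm_sum (I : Type) (r : seq I) (P : pred I) (F : I -> 'cV[R]_m) :
  enorm (\sum_(i <- r | P i) F i) <= \sum_(i <- r | P i) enorm (F i).
Proof.
elim/big_rec2 : _ => [|i x y _ h]; first by rewrite enorm0.
by rewrite (le_trans (enormD _ _))// lerD2l.
Qed.

Lemma normr_entry_le v j : `|v j 0| <= enorm v.
Proof.
rewrite -sqrtr_sqr /enorm ler_wsqrtr// (bigD1 j)//= lerDl.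
by apply: sumr_ge0 => i _; exact: sqr_ge0.
Qed.

Lemma enorm_le_entry v a : 0 <= a -> (forall j, `|v j 0| <= a) ->
  enorm v <= m%:R * a.
Proof.
move=> a0 va; rewrite -(@ler_pXn2r _ 2)// ?nnegrE ?mulr_ge0 ?enorm_ge0//.
rewrite enorm_sqr dotvE exprMn.
apply: (@le_trans _ _ (\sum_(j < m) a ^+ 2)).
  apply: ler_sum => j _; rewrite -expr2 -real_normK ?num_real//.
  by rewrite ler_pXn2r ?nnegrE.
rewrite sumr_const card_ord -[leLHS]mulr_natl ler_wpM2r ?sqr_ge0//.
by rewrite -natrX ler_nat; case: (m) => // k; rewrite leq_pmulr.
Qed.

(** By duality a norm is bounded through unit directions, and linear functionals
    commute with expectations. *)
Lemma enorm_le_dir v b : 0 <= b -> (forall u, enorm u = 1 -> dotv u v <= b) ->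
  enorm v <= b.
Proof.
move=> b0 H; have [->|v0] := eqVneq v 0; first by rewrite enorm0.
have ev : enorm v != 0 by apply: contra v0 => /eqP/enorm_eq0/eqP.
have := H _ (normalize_unit v0).
by rewrite dotvZl -enorm_sqr expr2 mulrA mulVf// mul1r.
Qed.

(** The direction of [v] itself differs from a net direction by at most [1 / 2],
    which loses at most half of the norm. *)
Lemma enorm_le_net v b : 0 <= b -> (forall u, enorm u = 1 -> exists2 u',
    enorm (u' - u) <= 1 / 2 & dotv u' v <= b) -> enorm v <= 2 * b.
Proof.
move=> b0 H; have [->|v0] := eqVneq v 0; first by rewrite enorm0; lra.
have ev : enorm v != 0 by apply: contra v0 => /eqP/enorm_eq0/eqP.
have [u' u'u u'v] := H _ (normalize_unit v0).
set u := (enorm v)^-1 *: v in u'u.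
have uv : dotv u v = enorm v by rewrite dotvZl -enorm_sqr expr2 mulrA mulVf// mul1r.
have := dotv_le (u - u') v; rewrite dotvBl uv enorm_subC.
have : enorm (u' - u) * enorm v <= 1 / 2 * enorm v by rewrite ler_wpM2r ?enorm_ge0.
lra.
Qed.

Lemma dotv_mx u v (A : 'M[R]_m) : dotv u (A *m v) = dotv (A^T *m u) v.
Proof. by rewrite /dotv trmx_mul trmxK mulmxA. Qed.

Lemma dotv_ext u v : (forall w, dotv w u = dotv w v) -> u = v.
Proof.
move=> H; apply/eqP; rewrite -subr_eq0; apply/eqP/enorm_eq0/eqP.
by rewrite -sqrf_eq0 enorm_sqr dotvBr H subrr.
Qed.

End euclid.

(** * Extreme eigenvalues *)

Section rayleigh.
Context {R : realType}.

Lemma continuous_quad m (A : 'M[R]_m) :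
  continuous (fun x : 'rV[R]_m => dotv x^T (A *m x^T)).
Proof.
have -> : (fun x : 'rV[R]_m => dotv x^T (A *m x^T)) =
  (fun x => \sum_j x 0 j * (\sum_k A j k * x 0 k)).
  apply/funext => x; rewrite dotvE; apply: eq_bigr => j _; rewrite !mxE.
  by congr (_ * _); apply: eq_bigr => k _; rewrite !mxE.
have sumC (G : 'I_m -> 'rV[R]_m -> R) :
    (forall j, continuous (G j)) -> continuous (fun x => \sum_j G j x).
  by move=> cG; apply: continuous_big => [|j _]; [exact: add_continuous|exact: cG].
apply: (sumC) => j x; apply: (@cvgM _ _ (nbhs x) _ (fun y : 'rV[R]_m => y 0 j)).
  exact: (@coord_continuous _ 1 m 0 j).
apply: (sumC (fun k y => A j k * y 0 k)) => {x} k x.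
apply: (@cvgM _ _ (nbhs x) _ (fun=> A j k)); first exact: cvg_cst.
exact: (@coord_continuous _ 1 m 0 k).
Qed.

(** On the unit sphere the quadratic form of a symmetric matrix attains its
    minimum, and the minimiser is an eigenvector because the form has no
    first-order variation there. *)
Lemma rayleigh_min m (A : 'M[R]_m) : (0 < m)%N -> A^T = A ->
  exists2 a, eigenvalue A a & forall v, a * enorm v ^+ 2 <= dotv v (A *m v).
Proof.
move=> m0 Asym.
pose S := [set x : 'rV[R]_m | dotv x^T x^T = 1].
have S0 : S !=set0.
  case: m m0 A Asym @S => // k _ A _; exists (delta_mx 0 0) => /=.
  rewrite dotvE (bigD1 0)//= !mxE !eqxx mulr1 big1 ?addr0// => j j0.
  by rewrite !mxE (negbTE j0) andbF mul0r.
have cS : compact S.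
  apply: bounded_closed_compact.
    exists 1; split; first exact: num_real.
    move=> M M1 x /= Sx; rewrite (_ : `|x| = mx_norm x)// mx_normrE.
    apply: bigmax_le; first by rewrite ltW// (lt_trans _ M1).
    move=> [i j] _ /=; rewrite ord1 (le_trans _ (ltW M1))//.
    have := normr_entry_le x^T j; rewrite mxE.
    have -> : enorm x^T = 1; last by [].
    by apply/eqP; rewrite -(@eqrXn2 _ 2) ?enorm_ge0// enorm_sqr Sx expr1n.
  have -> : S = (fun x => dotv x^T x^T) @^-1` [set 1] by [].
  apply: closed_comp; last exact: closed_eq.
  move=> x _; have := @continuous_quad m 1%:M x.
  by under eq_fun do rewrite mul1mx.
have [x Sx minx] := compact_EVT_min S0 cS
  (continuous_subspaceT (continuous_quad (A := A))).
set v := x^T; set a := dotv v (A *m v).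
have vv : dotv v v = 1 by move: Sx; rewrite inE.
have quad w : a * enorm w ^+ 2 <= dotv w (A *m w).
  have [->|w0] := eqVneq w 0; first by rewrite enorm0 expr0n mulr0 mulmx0 dotv0r.
  have ew : enorm w != 0 by apply: contra w0 => /eqP/enorm_eq0/eqP.
  set y := (enorm w)^-1 *: w.
  have yy : dotv y y = 1 by rewrite -enorm_sqr normalize_unit// expr1n.
  have := minx y^T; rewrite /= !trmxK inE /S /= trmxK => /(_ yy).
  rewrite -/v -/a /y -scalemxAr dotvZl dotvZr mulrA -expr2 exprVn => h.
  rewrite mulrC -ler_pdivlMl//; first by rewrite exprn_gt0// lt_neqAle eq_sym ew enorm_ge0.
exists a => //.
(* [p] is half of the derivative at the minimiser in the direction [h]; the
   witnesses [s] below make [2 s p + s^2 q] negative unless [p = 0] *)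
have lin h : dotv h (A *m v - a *: v) = 0.
  set p := dotv h _; set q := dotv h (A *m h) - a * dotv h h.
  have key s : 0 <= 2 * s * p + s ^+ 2 * q.
    have := quad (v + s *: h); rewrite enorm_sqr mulmxDr -scalemxAr.
    rewrite !(dotvDl, dotvDr, dotvZl, dotvZr) vv -/a (dotvC v h).
    have -> : dotv v (A *m h) = dotv h (A *m v) by rewrite dotv_mx Asym dotvC.
    rewrite /p /q dotvBr dotvZr; nra.
  have [//|p0] := eqVneq p 0; exfalso.
  have q0 : 0 <= q.
    rewrite leNgt; apply/negP => q0; have := key (- 3 * p / q).
    have -> : 2 * (- 3 * p / q) * p + (- 3 * p / q) ^+ 2 * q = 3 * p ^+ 2 / q.
      by field; rewrite lt_eqF.
    rewrite ler_ndivlMr// mul0r => h1.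
    have : 0 < p ^+ 2 by rewrite exprn_even_gt0.
    lra.
  have q1 : 0 < q + 1 by lra.
  have := key (- p / (q + 1)).
  have -> : 2 * (- p / (q + 1)) * p + (- p / (q + 1)) ^+ 2 * q =
    - (p ^+ 2 * ((q + 2) / (q + 1) ^+ 2)) by field; rewrite gt_eqF.
  have : 0 < p ^+ 2 * ((q + 2) / (q + 1) ^+ 2).
    by rewrite mulr_gt0 ?exprn_even_gt0// divr_gt0 ?exprn_gt0//; lra.
  lra.
have Av : A *m v = a *: v.
  by apply: dotv_ext => h; have := lin h; rewrite dotvBr => /eqP; rewrite subr_eq0 => /eqP.
apply/eigenvalueP; exists x.
  by rewrite -[x]trmxK -[X in _ *m X]Asym -trmx_mul Av linearZ.
apply/eqP => x0; have := vv; rewrite /v x0 trmx0 dotv0r => /esym/eqP.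
by rewrite oner_eq0.
Qed.

Lemma eigenvalue_quad m (A : 'M[R]_m) a : eigenvalue A a ->
  exists2 v, enorm v = 1 & dotv v (A *m v) = a.
Proof.
move=> /eigenvalueP[x xA x0].
have v0 : x^T != 0 by apply: contra x0 => /eqP/(congr1 trmx); rewrite trmxK trmx0 => ->.
exists ((enorm x^T)^-1 *: x^T); first exact: normalize_unit.
have h : dotv x^T (A *m x^T) = a * dotv x^T x^T.
  by rewrite dotv_mx -[A^T *m _]trmxK trmx_mul !trmxK xA linearZ dotvZl.
rewrite -scalemxAr dotvZl dotvZr h -enorm_sqr; field.
by apply: contra v0 => /eqP/enorm_eq0/eqP.
Qed.

Lemma lambda_min_quad m (A : 'M[R]_m) v : (0 < m)%N -> A^T = A ->
  lambda_min A * enorm v ^+ 2 <= dotv v (A *m v).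
Proof.
move=> m0 As; have [a ea qa] := rayleigh_min m0 As.
rewrite (le_trans _ (qa v))// ler_wpM2r ?sqr_ge0//.
apply: ge_inf => //; exists a => b /eigenvalue_quad[w w1 <-].
by have := qa w; rewrite w1 expr1n mulr1.
Qed.

Lemma lambda_max_quad m (A : 'M[R]_m) v : (0 < m)%N -> A^T = A ->
  dotv v (A *m v) <= lambda_max A * enorm v ^+ 2.
Proof.
move=> m0 As.
have [|a ea qa] := @rayleigh_min m (- A) m0; first by rewrite linearN/= As.
have qa' w : dotv w (A *m w) <= - a * enorm w ^+ 2.
  by have := qa w; rewrite mulNmx dotvNr; lra.
rewrite (le_trans (qa' v))// ler_wpM2r ?sqr_ge0//.
apply: ub_le_sup; last first.
  rewrite /=; case/eigenvalueP: ea => x xA x0; apply/eigenvalueP; exists x => //.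
  by rewrite scaleNr -xA mulmxN opprK.
exists (- a) => b /eigenvalue_quad[w w1 <-].
by have := qa' w; rewrite w1 expr1n mulr1.
Qed.

Lemma lambda_min_ge m (A : 'M[R]_m) c : (0 < m)%N -> A^T = A ->
  (forall v, c * enorm v ^+ 2 <= dotv v (A *m v)) -> c <= lambda_min A.
Proof.
move=> m0 As H; apply: lb_le_inf.
  by have [a ea _] := rayleigh_min m0 As; exists a.
move=> b /eigenvalue_quad[w w1 <-].
by have := H w; rewrite w1 expr1n mulr1.
Qed.

(** Cauchy--Schwarz turns the bound of the form into [c |v| <= |A v|], hence into
    injectivity and a bound of the inverse. *)
Lemma posdef_invmx m (A : 'M[R]_m) c : 0 < c ->
  (forall v, c * enorm v ^+ 2 <= dotv v (A *m v)) ->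
  A \in unitmx /\ forall v, enorm (invmx A *m v) <= c^-1 * enorm v.
Proof.
move=> c0 H.
have bnd w : c * enorm w <= enorm (A *m w).
  have [->|w0] := eqVneq (enorm w) 0; first by rewrite mulr0 enorm_ge0.
  rewrite -(@ler_pM2l _ (enorm w)) ?lt_neqAle ?enorm_ge0 1?eq_sym ?w0//.
  by rewrite mulrCA -expr2 (le_trans (H w))// dotv_le.
have uA : A \in unitmx.
  rewrite -unitmx_tr -row_free_unit -kermx_eq0; apply/eqP/row_matrixP => i.
  rewrite row0; set k := row i _.
  have kA : k *m A^T = 0 by rewrite -row_mul mulmx_ker row0.
  rewrite -[k]trmxK; apply/(canLR (@trmxK _ _ _)); rewrite trmx0; apply: enorm_eq0.
  have := bnd k^T; rewrite -[A]trmxK -trmx_mul kA trmx0 enorm0.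
  rewrite pmulr_rle0// => h; apply/eqP; rewrite eq_le h enorm_ge0//.
split=> // v; rewrite ler_pdivlMl// (le_trans (bnd _))//.
by rewrite mulmxA mulmxV// mul1mx.
Qed.

End rayleigh.

(** * Expectations of bounded random variables *)

Section bounded_expectation.
Context {d : measure_display} {T : measurableType d} {R : realType}.
Variable P : probability T R.
Implicit Types (f g : T -> R) (A B : set T).

(** On bounded measurable functions the expectation is linear and monotone
    without integrability side conditions. *)
Definition bmf f := measurable_fun setT f /\ exists M : R, forall w, `|f w| <= M.

Local Notation Ex f := (Rintegral P setT f).

Lemma bmf_integrable f : bmf f -> P.-integrable setT (EFin \o f).
Proof.
move=> [mf [M fM]]; apply: measurable_bounded_integrable => //.
  exact: le_lt_trans (probability_le1 P measurableT) (ltry _).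
exists M; split; first exact: num_real.
by move=> N MN w _; exact: le_trans (fM w) (ltW MN).
Qed.

Lemma bmf_cst (a : R) : bmf (fun=> a).
Proof. by split; [exact: measurable_cst|exists `|a|]. Qed.

Lemma bmfD f g : bmf f -> bmf g -> bmf (fun w => f w + g w).
Proof.
move=> [mf [M fM]] [mg [N gN]]; split; first exact: measurable_funD.
by exists (M + N) => w; rewrite (le_trans (ler_normD _ _))// lerD.
Qed.

Lemma bmfM f g : bmf f -> bmf g -> bmf (fun w => f w * g w).
Proof.
move=> [mf [M fM]] [mg [N gN]]; split; first exact: measurable_funM.
by exists (M * N) => w; rewrite normrM ler_pM.
Qed.

Lemma bmfN f : bmf f -> bmf (fun w => - f w).
Proof.
move=> [mf [M fM]]; split; first exact: measurableT_comp.
by exists M => w; rewrite normrN.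
Qed.

Lemma bmfB f g : bmf f -> bmf g -> bmf (fun w => f w - g w).
Proof. by move=> bf /bmfN; exact: bmfD. Qed.

Lemma bmfZ a f : bmf f -> bmf (fun w => a * f w).
Proof. by move=> bf; apply: bmfM => //; exact: bmf_cst. Qed.

Lemma bmf_norm f : bmf f -> bmf (fun w => `|f w|).
Proof.
move=> [mf [M fM]]; split; first exact: measurableT_comp.
by exists M => w; rewrite normr_id.
Qed.

Lemma bmf_sum (I : Type) (r : seq I) (F : I -> T -> R) :
  (forall i, bmf (F i)) -> bmf (fun w => \sum_(i <- r) F i w).
Proof.
move=> bF; elim: r => [|i r IH].
  by under eq_fun do rewrite big_nil; exact: bmf_cst.
by under eq_fun do rewrite big_cons; exact: bmfD.
Qed.

Lemma bmf_prod (I : Type) (r : seq I) (Q : pred I) (F : I -> T -> R) :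
  (forall i, bmf (F i)) -> bmf (fun w => \prod_(i <- r | Q i) F i w).
Proof.
move=> bF; elim: r => [|i r IH].
  by under eq_fun do rewrite big_nil; exact: bmf_cst.
under eq_fun do rewrite big_cons; case: (Q i) => //; exact: bmfM.
Qed.

Lemma bmf_bool (b : T -> bool) : measurable_fun setT b ->
  bmf (fun w => (b w)%:R).
Proof.
move=> mb; split; last by exists 1 => w; case: (b w); rewrite ?normr1 ?normr0.
rewrite (_ : (fun w => _) = (fun w => if b w then 1 else 0 : R)).
  by apply: measurable_fun_ifT => //; exact: measurable_cst.
by apply/funext => w; case: (b w).
Qed.

Lemma exD f g : bmf f -> bmf g -> Ex (fun w => f w + g w) = Ex f + Ex g.
Proof. by move=> /bmf_integrable bf /bmf_integrable bg; rewrite RintegralD. Qed.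

Lemma exZ a f : bmf f -> Ex (fun w => a * f w) = a * Ex f.
Proof. by move=> /bmf_integrable bf; rewrite RintegralZl. Qed.

Lemma exN f : bmf f -> Ex (fun w => - f w) = - Ex f.
Proof.
move=> bf; rewrite -mulN1r -exZ//.
by congr (Rintegral _ _ _); apply/funext => w; rewrite mulN1r.
Qed.

Lemma exB f g : bmf f -> bmf g -> Ex (fun w => f w - g w) = Ex f - Ex g.
Proof. by move=> bf bg; rewrite exD ?exN//; exact: bmfN. Qed.

Lemma ex_cst a : Ex (fun=> a) = a.
Proof. rewrite Rintegral_cst//; have -> : fine (P setT) = 1 by rewrite probability_setT.
by rewrite mulr1. Qed.

Lemma ex_sum (I : Type) (r : seq I) (F : I -> T -> R) :
  (forall i, bmf (F i)) ->
  Ex (fun w => \sum_(i <- r) F i w) = \sum_(i <- r) Ex (F i).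
Proof.
move=> bF; elim: r => [|i r IH].
  by under eq_fun do rewrite big_nil; rewrite ex_cst big_nil.
under eq_fun do rewrite big_cons.
by rewrite exD// ?IH ?big_cons//; exact: bmf_sum.
Qed.

Lemma ler_ex f g : bmf f -> bmf g -> (forall w, f w <= g w) -> Ex f <= Ex g.
Proof.
by move=> /bmf_integrable bf /bmf_integrable bg fg; apply: le_Rintegral.
Qed.

Lemma ex_ge0 f : (forall w, 0 <= f w) -> 0 <= Ex f.
Proof. by move=> f0; apply: Rintegral_ge0. Qed.

Lemma ler_norm_ex f : bmf f -> `|Ex f| <= Ex (fun w => `|f w|).
Proof. by move=> /bmf_integrable bf; exact: le_normr_Rintegral. Qed.

Lemma ex_bool (b : T -> bool) : measurable_fun setT b ->
  (Ex (fun w => (b w)%:R))%:E = P [set w | b w].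
Proof.
move=> mb.
have mA : measurable [set w | b w].
  by have := mb measurableT [set true]; rewrite setTI; exact.
rewrite /Rintegral fineK.
  rewrite -[X in P X]setIT -integral_indic//; apply: eq_integral => w _.
  by rewrite indicE; congr ((nat_of_bool _)%:R%:E); apply/idP/idP; rewrite inE.
by apply: integrable_fin_num => //; apply: bmf_integrable; exact: bmf_bool.
Qed.

(** The sum is the integer part of [x]; rescaled, this approximates a bounded
    function uniformly by sums of indicators. *)
Lemma layer_cake N (x : R) : 0 <= x -> x <= N%:R ->
  `|x - \sum_(j < N) (j.+1%:R <= x)%R%:R| <= 1.
Proof.
elim: N x => [|N IH] x x0 xN.
  by rewrite big_ord0 subr0 (_ : x = 0) ?normr0//; apply/eqP; rewrite eq_le x0 xN.
rewrite big_ord_recr/=; have [xN'|xN'] := leP x N%:R.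
  rewrite (_ : (N.+1%:R <= x) = false) ?addr0 ?IH//.
  by apply/negbTE; rewrite -ltNge (le_lt_trans xN')// ltr_nat.
rewrite (eq_bigr (fun=> 1)) => [|j _]; last first.
  by rewrite (_ : _ <= _) // (le_trans _ (ltW xN'))// ler_nat.
rewrite sumr_const card_ord -natr1 in xN *.
by case: (leP (N%:R + 1) x) => h; rewrite ler_norml/=; apply/andP; split; lra.
Qed.

End bounded_expectation.

Section change.
Context {d d' : measure_display} {T : measurableType d} {S : measurableType d'}.
Context {R : realType}.
Variables (P : probability T R) (V : T -> S).
Hypothesis mV : measurable_fun setT V.

Local Notation Ex f := (Rintegral P setT f).

Lemma bmf_comp (h : S -> R) : bmf h -> bmf (h \o V).
Proof. by move=> [mh [M hM]]; split; [exact: measurableT_comp|exists M => w; exact: hM]. Qed.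

(** From indicators to bounded functions of [V]: [h] is shifted to be
    nonnegative and replaced by its layer-cake discretisation. *)
Lemma ex_change (W1 W2 : T -> R) (h : S -> R) :
  bmf W1 -> bmf W2 -> (forall w, 0 <= W1 w) -> (forall w, 0 <= W2 w) ->
  (forall b : S -> bool, measurable_fun setT b ->
     Ex (fun w => (b (V w))%:R * W1 w) = Ex (fun w => (b (V w))%:R * W2 w)) ->
  bmf h -> Ex (fun w => h (V w) * W1 w) = Ex (fun w => h (V w) * W2 w).
Proof.
move=> bW1 bW2 W10 W20 H bh.
have bV (k : S -> R) W : bmf k -> bmf W -> bmf (fun w => k (V w) * W w).
  by move=> bk bW; apply: bmfM => //; exact: bmf_comp.
have HT : Ex W1 = Ex W2.
  have := H (fun=> true) (measurable_cst _).
  under eq_Rintegral do rewrite mul1r.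
  by under [X in _ = X -> _]eq_Rintegral do rewrite mul1r.
wlog h0 : h bh / forall s, 0 <= h s.
  move=> wl; have [mh [M hM]] := bh.
  have bM : bmf (fun s => h s + M) by apply: bmfD => //; exact: bmf_cst.
  have hM0 s : 0 <= h s + M by have := hM s; rewrite ler_norml => /andP[]; lra.
  have e W : bmf W -> Ex (fun w => (h (V w) + M) * W w) =
      Ex (fun w => h (V w) * W w) + M * Ex W.
    move=> bW; rewrite -exZ// -exD//; [|exact: bV|exact: bmfZ].
    by apply: eq_Rintegral => w _; rewrite mulrDl.
  by have := wl _ bM hM0; rewrite !e// HT => /addIr.
(* both sides are within [O(1 / k)] of their discretisation at scale [1 / k] *)
have [mh [M hM]] := bh.
pose lay (k : nat) (s : S) : R := \sum_(j < `|Num.ceil (M * k%:R)|%N)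
  (j.+1%:R <= k%:R * h s)%R%:R.
have mlay (k : nat) (c : R) : measurable_fun setT (fun s => c <= k%:R * h s).
  by apply: measurable_fun_ler => //; exact: measurable_funM.
have blay k : bmf (lay k) by apply: bmf_sum => j; exact: bmf_bool.
have approx (k : nat) s : (0 < k)%N -> `|k%:R * h s - lay k s| <= 1.
  move=> k0; apply: layer_cake; first by rewrite mulr_ge0.
  rewrite (le_trans (_ : _ <= M * k%:R))//.
    by rewrite mulrC ler_wpM2r// (le_trans (ler_norm _)).
  by rewrite natr_absz ger0_norm ?ceil_ge// -(ler_int R) (le_trans _ (ceil_ge _))//
    mulr_ge0// (le_trans _ (hM s)).
have layE k : Ex (fun w => lay k (V w) * W1 w) = Ex (fun w => lay k (V w) * W2 w).
  have e W : bmf W -> Ex (fun w => lay k (V w) * W w) =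
     \sum_(j < `|Num.ceil (M * k%:R)|%N)
       Ex (fun w => (j.+1%:R <= k%:R * h (V w))%R%:R * W w).
    move=> bW; rewrite -ex_sum; last first.
      by move=> j; apply: (bV (fun s => (_ <= k%:R * h s)%R%:R)) => //; exact: bmf_bool.
    by apply: eq_Rintegral => w _; rewrite mulr_suml.
  by rewrite !e//; apply: eq_bigr => j _; exact: (H (fun s => _ <= k%:R * h s)).
have close k W : (0 < k)%N -> bmf W -> (forall w, 0 <= W w) ->
    `|k%:R * Ex (fun w => h (V w) * W w) - Ex (fun w => lay k (V w) * W w)| <= Ex W.
  move=> k0 bW W0; have bhW := bV _ _ bh bW.
  rewrite -(exZ _ k%:R bhW) -exB; [|exact: bmfZ|exact: bV].
  apply: le_trans (ler_norm_ex _ _) _.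
    by apply: bmfB; [apply: bmfZ|]; exact: bV.
  apply: ler_ex => // [|w].
    by apply: bmf_norm; apply: bmfB; [apply: bmfZ|]; exact: bV.
  by rewrite mulrA -mulrBl normrM (ger0_norm (W0 w)) ler_piMl// approx.
apply/eqP; rewrite -subr_eq0 -normr_le0; apply/ler_addgt0Pr => e e0; rewrite add0r.
set A1 := Ex _; set A2 := Ex _.
pose k := (Num.bound (2 * Ex W1 / e)).+1.
have k0 : 0 < k%:R :> R by [].
have c1 := close k W1 isT bW1 W10.
have := close k W2 isT bW2 W20.
rewrite -layE -HT -/A2 => c2; rewrite -/A1 in c1.
rewrite -(ler_pM2l k0) -[X in X * `|_|]ger0_norm// -normrM mulrBr.
apply: (@le_trans _ _ (2 * Ex W1)).
  move: c1 c2; rewrite !ler_norml => /andP[? ?] /andP[? ?].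
  by apply/andP; split; lra.
rewrite -ler_pdivrMr// ltW// (lt_trans (archi_boundP _))//.
  by apply: divr_ge0 (ltW e0); rewrite mulr_ge0// ex_ge0.
by rewrite ltr_nat.
Qed.
End change.

Section independence.
Context {d d' : measure_display} {T : measurableType d} {S : measurableType d'}.
Context {R : realType}.
Variables (P : probability T R) (n : nat) (V : 'I_n -> T -> S).
Hypothesis mV : forall i, measurable_fun setT (V i).
Hypothesis indepV : mutually_independent P V.

Local Notation Ex f := (Rintegral P setT f).

(** The factors from [k] on are still indicators; the induction on [k] frees one
    of them at each step by [ex_change]. *)
Let ex_prod_upto (k : nat) (F : 'I_n -> S -> R) : (k <= n)%N ->
  (forall i, bmf (F i)) -> (forall i s, 0 <= F i s) ->
  (forall i : 'I_n, (k <= i)%N ->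
     exists2 b : S -> bool, measurable_fun setT b & F i = (fun s => (b s)%:R)) ->
  Ex (fun w => \prod_i F i (V i w)) = \prod_i Ex (fun w => F i (V i w)).
Proof.
elim: k F => [|k IH] F kn bF F0 HF.
  have /choice[b bP] i : exists b : S -> bool,
      measurable_fun setT b /\ F i = (fun s => (b s)%:R).
    by have [b mb Fb] := HF i isT; exists b.
  have mbV i : measurable_fun setT (fun w => b i (V i w)).
    by have [mb _] := bP i; exact: measurableT_comp mb (mV i).
  have mB i : measurable [set s | b i s].
    by have [mb _] := bP i; have := mb measurableT [set true]; rewrite setTI; exact.
  have := indepV mB.
  have -> : \bigcap_(i in [set: 'I_n]) V i @^-1` [set s | b i s] =
      [set w | [forall i, b i (V i w)]].
    apply/seteqP; split => w /=; first by move=> H; apply/forallP => i; exact: H.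
    by move=> /forallP H i _; exact: H.
  have mall : measurable_fun setT (fun w => [forall i, b i (V i w)]).
    apply: (@measurable_fun_bool _ _ _ _ true); rewrite setTI.
    have -> : (fun w => [forall i, b i (V i w)]) @^-1` [set true] =
        \bigcap_(i in [set: 'I_n]) V i @^-1` [set s | b i s].
      apply/seteqP; split => w /=; last by move=> H; apply/forallP => i; exact: H.
      by move=> /forallP H i _; exact: H.
    apply: fin_bigcap_measurable => // i _.
    by rewrite -[X in measurable X]setTI; exact: mV.
  rewrite -ex_bool//.
  rewrite (eq_bigr (fun i => (Ex (fun w => (b i (V i w))%:R))%:E)); last first.
    by move=> i _; rewrite ex_bool.
  rewrite prodEFin => -[E].
  transitivity (Ex (fun w => [forall i, b i (V i w)]%:R)).
    apply: eq_Rintegral => w _; under eq_bigr => i _ do rewrite (bP i).2.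
    have [/forallP H|/forallPn[i Hi]] := boolP [forall i, b i (V i w)].
      by rewrite big1// => i _; rewrite H.
    by rewrite (bigD1 i)//= (negbTE Hi) mul0r.
  by rewrite E; apply: eq_bigr => i _; rewrite (bP i).2.
pose i0 := Ordinal kn.
have bFV i : bmf (fun w => F i (V i w)) by exact: (bmf_comp (mV i) (bF i)).
pose W1 w := \prod_(i | i != i0) F i (V i w).
pose W2 (w : T) := \prod_(i | i != i0) Ex (fun w => F i (V i w)).
transitivity (Ex (fun w => F i0 (V i0 w) * W1 w)).
  by apply: eq_Rintegral => w _; rewrite (bigD1 i0).
rewrite (ex_change (mV i0) (W2 := W2)) //.
- under eq_Rintegral do rewrite mulrC; rewrite exZ// mulrC.
  by rewrite [RHS](bigD1 i0).
- exact: bmf_prod.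
- exact: bmf_cst.
- by move=> w; apply: prodr_ge0.
- by move=> w; apply: prodr_ge0 => i _; apply: ex_ge0.
move=> b mb; pose G i s := if i == i0 then (b s)%:R else F i s.
have e : Ex (fun w => \prod_i G i (V i w)) = \prod_i Ex (fun w => G i (V i w)).
  apply: IH => [|i|i s|i ki]; rewrite ?(ltnW kn) /G//.
  - by case: eqP => // _; exact: bmf_bool.
  - by case: eqP.
  - case: eqP => [_|/eqP ii0]; first by exists b.
    by apply: HF; rewrite ltn_neqAle ki andbT eq_sym.
transitivity (Ex (fun w => \prod_i G i (V i w))).
  apply: eq_Rintegral => w _; rewrite (bigD1 i0)//= /G eqxx; congr (_ * _).
  by apply: eq_bigr => i /negbTE ->.
rewrite e (bigD1 i0)//= /G eqxx.
under [in RHS]eq_Rintegral do rewrite mulrC.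
rewrite exZ; last by apply: bmf_bool; exact: measurableT_comp mb (mV i0).
rewrite mulrC; congr (_ * _).
by apply: eq_bigr => i /negbTE ->.
Qed.

Lemma ex_prod_indep (F : 'I_n -> S -> R) :
  (forall i, bmf (F i)) -> (forall i s, 0 <= F i s) ->
  Ex (fun w => \prod_i F i (V i w)) = \prod_i Ex (fun w => F i (V i w)).
Proof.
move=> bF F0; apply: (@ex_prod_upto n) => // i; by rewrite leqNgt ltn_ord.
Qed.

End independence.

(** * Bernstein's inequality *)

Section bernstein.
Context {d d' : measure_display} {T : measurableType d} {S : measurableType d'}.
Context {R : realType}.
Variables (P : probability T R) (n : nat) (V : 'I_n -> T -> S) (V0 : T -> S).
Hypothesis mV : forall i, measurable_fun setT (V i).
Hypothesis mV0 : measurable_fun setT V0.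
Hypothesis indepV : mutually_independent P V.
Hypothesis lawV : forall i, same_law P (V i) V0.
Hypothesis n0 : (0 < n)%N.

Local Notation Ex f := (Rintegral P setT f).

Lemma expR_quad (y : R) : y <= 1 / 2 -> expR y <= 1 + y + 2 * y ^+ 2.
Proof.
move=> y2; have h : 1 - y <= expR (- y) := expR_ge1Dx (- y).
have y1 : 0 < 1 - y by lra.
rewrite -[expR y]invrK -expRN (@le_trans _ _ (1 - y)^-1)//.
  by rewrite lef_pV2// ?posrE ?expR_gt0.
rewrite -[_^-1]mul1r ler_pdivrMr//.
have : 0 <= y ^+ 2 * (1 - 2 * y) by rewrite mulr_ge0 ?sqr_ge0//; lra.
by lra.
Qed.

Lemma ex_same_law i (h : S -> R) : bmf h ->
  Ex (fun w => h (V i w)) = Ex (fun w => h (V0 w)).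
Proof.
move=> bh; have e (W : T -> S) : measurable_fun setT W ->
    (\int[P]_w (h (W w))%:E = \int[pushforward P W]_s (h s)%:E)%E.
  move=> mW; rewrite integral_pushforward//.
  - by apply/measurable_EFinP; case: bh.
  - by apply: (@bmf_integrable _ _ _ P (h \o W)); exact: bmf_comp.
rewrite /Rintegral !e//; congr fine; apply: eq_measure_integral => A mA _.
exact: lawV.
Qed.

(** Exponential moments with [expR_quad]. The exponent is [sqrt (x / n) / sigma],
    capped at the end [1 / (2 * B)] of the range in which the quadratic bound
    applies; the two terms of the threshold are the two cases. *)
Lemma bernstein (h : S -> R) (B sigma x : R) :
  measurable_fun setT h -> 0 < B -> (forall s, `|h s| <= B) -> 0 < sigma ->
  Ex (fun w => h (V0 w) ^+ 2) <= sigma ^+ 2 -> 0 <= x ->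
  (P [set w | (n%:R * (3 * sigma * Num.sqrt (x / n%:R) + 6 * B * (x / n%:R)) <
      \sum_i (h (V i w) - Ex (fun w => h (V0 w))))%R] <= (expR (- x))%:E)%E.
Proof.
move=> mh B0 hB s0 hs x0.
have bh : bmf h by split => //; exists B.
have bhV i : bmf (fun w => h (V i w)) by exact: (bmf_comp (mV i) bh).
have bhV0 : bmf (fun w => h (V0 w)) by exact: (bmf_comp mV0 bh).
set mu := Ex _; set t := n%:R * _.
have nR : 0 < n%:R :> R by rewrite ltr0n.
have main lam : 0 <= lam -> lam * B <= 1 / 2 ->
    (P [set w | (t < \sum_i (h (V i w) - mu))%R] <=
     (expR (- (lam * t) + n%:R * (2 * lam ^+ 2 * sigma ^+ 2)))%:E)%E.
  move=> l0 lB.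
  pose F (i : 'I_n) s := expR (lam * (h s - mu)).
  have bF i : bmf (F i).
    split; first by apply: measurableT_comp => //; apply: measurable_funM => //;
      exact: measurable_funB.
    exists (expR (lam * (B + `|mu|))) => s.
    have -> : `|F i s| = F i s by rewrite ger0_norm// expR_ge0.
    rewrite ler_expR ler_wpM2l// lerD//.
      exact: le_trans (ler_norm _) (hB s).
    by rewrite -normrN ler_norm.
  have bFV i : bmf (fun w => F i (V i w)) by exact: (bmf_comp (mV i) (bF i)).
  have mev : measurable_fun setT (fun w => t < \sum_i (h (V i w) - mu)).
    apply: measurable_fun_ltr => //.
    have [] // : bmf (fun w => \sum_i (h (V i w) - mu)).
    by apply: bmf_sum => i; apply: bmfB => //; exact: bmf_cst.
  rewrite -ex_bool// lee_fin.
  apply: (@le_trans _ _ (Ex (fun w => expR (- (lam * t)) * \prod_i F i (V i w)))).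
    apply: ler_ex => [||w]; first exact: bmf_bool.
      by apply: bmfZ; exact: bmf_prod.
    rewrite -expR_sum -expRD; case: ltP => [h1|_]; last exact: expR_ge0.
    rewrite -[leLHS]expR0 ler_expR -mulr_sumr addrC subr_ge0.
    by rewrite ler_wpM2l// ltW.
  rewrite exZ; last exact: bmf_prod.
  rewrite expRD ler_wpM2l ?expR_ge0//.
  rewrite ex_prod_indep//; last by move=> i s; exact: expR_ge0.
  rewrite (_ : n%:R * _ = \sum_(i < n) (2 * lam ^+ 2 * sigma ^+ 2)); last first.
    by rewrite sumr_const card_ord mulr_natl.
  rewrite expR_sum.
  apply: ler_prod => i _; apply/andP; split.
    by apply: ex_ge0 => w; exact: expR_ge0.
  rewrite (ex_same_law i (bF i)).
  apply: (@le_trans _ _ (Ex (fun w => expR (- (lam * mu)) *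
      (1 + lam * h (V0 w) + 2 * lam ^+ 2 * h (V0 w) ^+ 2)))).
    have b2 : bmf (fun w => h (V0 w) ^+ 2).
      by under eq_fun do rewrite expr2; exact: bmfM.
    apply: ler_ex => [||w].
    - exact: (bmf_comp mV0 (bF i)).
    - apply: bmfZ; apply: bmfD; last exact: bmfZ.
      by apply: bmfD; [exact: bmf_cst|exact: bmfZ].
    rewrite /F mulrBr expRD mulrC ler_wpM2l ?expR_ge0//.
    rewrite (le_trans (expR_quad _))//; last by rewrite exprMn mulrA.
    rewrite (le_trans _ lB)// ler_wpM2l// (le_trans _ (hB (V0 w)))// ler_norm//.
  have b2 : bmf (fun w => h (V0 w) ^+ 2).
    by under eq_fun do rewrite expr2; exact: bmfM.
  rewrite exZ; last first.
    apply: bmfD; last exact: bmfZ.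
    by apply: bmfD; [exact: bmf_cst|exact: bmfZ].
  rewrite exD; [|by apply: bmfD; [exact: bmf_cst|exact: bmfZ]|exact: bmfZ].
  rewrite exD; [|exact: bmf_cst|exact: bmfZ].
  rewrite ex_cst !exZ// -/mu -ler_pdivlMl ?expR_gt0// -expRN opprK -expRD.
  apply: le_trans (expR_ge1Dx _); rewrite addrA lerD2l.
  by rewrite ler_wpM2l// mulr_ge0// sqr_ge0.
pose q := Num.sqrt (x / n%:R).
have q0 : 0 <= q by exact: sqrtr_ge0.
have qq : q ^+ 2 = x / n%:R by rewrite sqr_sqrtr// divr_ge0// ltW.
have xq : x = n%:R * q ^+ 2 by rewrite qq mulrCA divff ?mulr1// gt_eqF.
have tE : t = n%:R * (3 * sigma * q + 6 * B * q ^+ 2) by rewrite qq.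
have choose lam : 0 <= lam -> lam * B <= 1 / 2 ->
    q ^+ 2 + 2 * lam ^+ 2 * sigma ^+ 2 <= lam * (3 * sigma * q + 6 * B * q ^+ 2) ->
    (P [set w | (t < \sum_i (h (V i w) - mu))%R] <= (expR (- x))%:E)%E.
  move=> l0 lB /(ler_wpM2l (ltW nR)) hq; apply: le_trans (main lam l0 lB) _.
  by rewrite lee_fin ler_expR xq tE; lra.
have [qs|qs] := leP (q / sigma) (1 / (2 * B)).
  apply: (choose (q / sigma)).
  - by rewrite divr_ge0// ltW.
  - by rewrite -ler_pdivlMr// (_ : 1 / 2 / B = 1 / (2 * B))//; field; rewrite gt_eqF.
  have -> : q / sigma * (3 * sigma * q + 6 * B * q ^+ 2) =
      3 * q ^+ 2 + 6 * (B * q ^+ 2 * (q / sigma)) by field; rewrite gt_eqF.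
  have -> : 2 * (q / sigma) ^+ 2 * sigma ^+ 2 = 2 * q ^+ 2 by field; rewrite gt_eqF.
  have : 0 <= B * q ^+ 2 * (q / sigma).
    apply: mulr_ge0; last by apply: divr_ge0 => //; exact: ltW.
    by apply: mulr_ge0; [exact: ltW|exact: sqr_ge0].
  by lra.
have lB0 : 0 <= 1 / (2 * B) by rewrite divr_ge0// mulr_ge0// ltW.
apply: (choose (1 / (2 * B))) => //.
  by rewrite le_eqVlt; apply/orP; left; apply/eqP; field; rewrite gt_eqF.
have -> : 1 / (2 * B) * (3 * sigma * q + 6 * B * q ^+ 2) =
    3 * q ^+ 2 + 3 * (1 / (2 * B) * sigma * q) by field; rewrite gt_eqF.
have h1 : 1 / (2 * B) * sigma <= q.
  by rewrite -ler_pdivlMr// ltW.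
have h2 : 0 <= 1 / (2 * B) * sigma by rewrite mulr_ge0// ltW.
rewrite -mulrA -exprMn.
set r := 1 / (2 * B) * sigma in h1 h2 *.
nra.
Qed.

End bernstein.

(** * The conditional distribution function and its quantiles *)

Section conditional_law.
Context {R : realType} {n : nat}.
Variable D : qr_row R n.

Local Notation P := (Pr D).
Local Notation RX := (Rd R (dimX D)).
Local Notation MR := (measurableTypeR R).
Local Notation Ex f := (Rintegral P setT f).

Let mX : measurable_fun setT (X D : Omega D -> RX).
Proof. exact: measurable_funPT. Qed.

Let mY : measurable_fun setT (Y D : Omega D -> MR).
Proof. exact: measurable_funPT. Qed.

Lemma condY_setT x : condY D x [set: MR] = 1%E.
Proof. exact: prob_kernel. Qed.

Lemma condY_le1 x (B : set MR) : measurable B -> (condY D x B <= 1)%E.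
Proof. by move=> mB; rewrite -(condY_setT x); apply: le_measure; rewrite ?inE. Qed.

Lemma condY_fin x (B : set MR) : measurable B -> condY D x B \is a fin_num.
Proof.
move=> mB; rewrite ge0_fin_numE//; exact: le_lt_trans (condY_le1 x mB) (ltry _).
Qed.

Lemma condY_setC x (B : set MR) : measurable B ->
  (condY D x B + condY D x (~` B) = 1)%E.
Proof.
move=> mB; rewrite -measureU//; last 2 first.
- exact: measurableC.
- exact: setICr.
by rewrite setUv; exact: condY_setT.
Qed.

Lemma measurable_condY_xsection (M : set (RX * MR)) : measurable M ->
  measurable_fun setT (fun x => condY D x (xsection M x)).
Proof. by move=> mM; apply: measurable_fun_xsection_finite_kernel; rewrite inE. Qed.

(** Rectangles are a pi-system that generates the product sigma-algebra, so the
    disintegration of the joint law extends from them. *)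
Lemma joint_law (M : set (RX * MR)) : measurable M ->
  (P [set w | M (X D w, Y D w)] = \int[P]_w condY D (X D w) (xsection M (X D w)))%E.
Proof.
have mXY : measurable_fun setT (fun w => (X D w, Y D w) : RX * MR).
  exact: measurable_fun_pair.
have mpre (N : set (RX * MR)) : measurable N ->
    measurable [set w | N (X D w, Y D w)].
  by move=> mN; have := mXY measurableT N mN; rewrite setTI.
have mk (N : set (RX * MR)) : measurable N ->
    measurable_fun setT (fun w => condY D (X D w) (xsection N (X D w))).
  by move=> /measurable_condY_xsection mN; exact: (measurableT_comp mN mX).
have PT : P setT = 1%E by exact: probability_setT.
have int1 : (\int[P]_w (fun=> 1%E) w = 1)%E.
  by rewrite integral_cst// mul1e; exact: probability_setT.
have QT : P [set w | [set: RX * MR] (X D w, Y D w)] =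
    (\int[P]_w condY D (X D w) (xsection setT (X D w)))%E.
  have -> : [set w | [set: RX * MR] (X D w, Y D w)] = setT by apply/seteqP; split.
  rewrite PT; under eq_integral => w _.
    rewrite (_ : xsection setT (X D w) = setT) ?condY_setT; last first.
      by apply/seteqP; split => y // _; rewrite /xsection/= inE.
    over.
  by rewrite int1.
pose Q (N : set (RX * MR)) : Prop := (P [set w | N (X D w, Y D w)] =
  \int[P]_w condY D (X D w) (xsection N (X D w)))%E.
rewrite measurable_prod_measurableType; move: M; rewrite -/(Q _).
apply: (dynkin_induction (P := Q)
  (measurable_prod_measurableType RX MR)) => //; rewrite /Q {Q}.
- move=> _ _ [A1 mA1 [A2 mA2 <-]] [B1 mB1 [B2 mB2 <-]].
  exists (A1 `&` B1); first exact: measurableI.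
  exists (A2 `&` B2); first exact: measurableI.
  by rewrite setXI.
- move=> _ [A mA [B mB <-]].
  rewrite (_ : [set w | _] = X D @^-1` A `&` Y D @^-1` B)//.
  rewrite condYP// integral_mkcond; apply: eq_integral => w _.
  rewrite patchE; have [wA|wA] := pselect (A (X D w)).
    by rewrite mem_set// in_xsectionX// inE.
  by rewrite memNset// notin_xsectionX ?measure0// notin_setE.
- move=> M mM IH; have mCM := measurableC mM.
  have h1 : (P [set w | M (X D w, Y D w)] + P [set w | (~` M) (X D w, Y D w)] = 1)%E.
    rewrite -measureU; [|exact: mpre|exact: mpre|]; last first.
      by apply/seteqP; split => w //= -[].
    rewrite -PT; congr (P _); apply/seteqP; split => w //= _.
    exact: lem.
  have h2 : (\int[P]_w condY D (X D w) (xsection M (X D w)) +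
      \int[P]_w condY D (X D w) (xsection (~` M) (X D w)) = 1)%E.
    rewrite -ge0_integralD//; [|exact: mk|exact: mk].
    under eq_integral => w _.
      rewrite (_ : xsection (~` M) (X D w) = ~` xsection M (X D w)).
        rewrite condY_setC; last exact: measurable_xsection.
        over.
      apply/seteqP; split => y; rewrite /xsection/= !inE//.
    by rewrite int1.
  have f1 : P [set w | M (X D w, Y D w)] \is a fin_num.
    by apply: fin_num_measure; exact: mpre.
  rewrite -IH in h2; rewrite -h2 in h1.
  move: h1 f1; set a := P [set w | M _] => h1 f1.
  by have := congr1 (fun x => x - a)%E h1; rewrite !(addeC a) !addeK.
- move=> F mF tF IH.
  transitivity (\sum_(0 <= k <oo) P [set w | F k (X D w, Y D w)])%E.
    rewrite -measure_semi_bigcup//.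
    + by move=> k; exact: mpre.
    + by move=> i j _ _ [w [Fi Fj]]; apply: (tF i j) => //; exists (X D w, Y D w).
    + by apply: bigcup_measurable => k _; exact: mpre.
  rewrite (eq_eseriesr (fun k _ => IH k)) -integral_nneseries//; last first.
    by move=> k; exact: mk.
  apply: eq_integral => w _; rewrite -measure_semi_bigcup//.
  + by rewrite xsection_bigcup.
  + by move=> k; exact: measurable_xsection.
  + exact: trivIset_xsection.
  + by apply: bigcup_measurable => k _; exact: measurable_xsection.
Qed.

Lemma condF_EFin (x : RX) y : (condF (D := D) x y)%:E = condY D x `]-oo, y]%classic.
Proof. by rewrite /condF fineK// condY_fin. Qed.

Lemma condF_ge0 (x : RX) y : 0 <= condF (D := D) x y.
Proof. by rewrite -lee_fin condF_EFin. Qed.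

Lemma condF_le1 (x : RX) y : condF (D := D) x y <= 1.
Proof. by rewrite -lee_fin condF_EFin; exact: condY_le1. Qed.

Lemma condF_mono (x : RX) y y' : y <= y' -> condF (D := D) x y <= condF (D := D) x y'.
Proof.
move=> yy; rewrite -lee_fin !condF_EFin; apply: le_measure; rewrite ?inE//.
by move=> u /=; rewrite !in_itv/= => /le_trans; apply.
Qed.

Let measurable_subgraph (c : RX -> bool) (b : RX -> R) : measurable_fun setT c ->
  measurable_fun setT (b : RX -> MR) ->
  measurable [set p : RX * MR | c p.1 && (p.2 <= b p.1)%R].
Proof.
move=> mc mb.
have mc' : measurable_fun setT (fun p : RX * MR => c p.1).
  exact: (measurableT_comp mc measurable_fst).
have mb' : measurable_fun setT (fun p : RX * MR => (p.2 <= b p.1)%R).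
  apply: measurable_fun_ler; first exact: measurable_snd.
  exact: (measurableT_comp mb measurable_fst).
have := measurable_and mc' mb'.
by move=> /(_ measurableT [set true]); rewrite setTI; apply.
Qed.

Lemma measurable_condF (b : RX -> R) : measurable_fun setT (b : RX -> MR) ->
  measurable_fun setT (fun x : RX => condF (D := D) x (b x) : MR).
Proof.
move=> mb; apply/measurable_EFinP.
have := measurable_condY_xsection (measurable_subgraph (measurable_cst true) mb).
apply: eq_measurable_fun => x _ /=; rewrite condF_EFin; congr (condY D x _).
by apply/seteqP; split => y; rewrite /xsection/= inE/= in_itv/=.
Qed.

Lemma bmf_condF (b : RX -> R) : measurable_fun setT (b : RX -> MR) ->
  bmf (fun x : RX => condF (D := D) x (b x)).
Proof.
move=> mb; split; first exact: measurable_condF.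
by exists 1 => x; rewrite ger0_norm ?condF_ge0// condF_le1.
Qed.

Lemma measurable_YleX (b : RX -> R) : measurable_fun setT (b : RX -> MR) ->
  measurable_fun setT (fun w => (Y D w <= b (X D w))%R).
Proof.
by move=> mb; apply: measurable_fun_ler => //; exact: (measurableT_comp mb mX).
Qed.

(** For an indicator [a] this is the disintegration of the region below the graph
    of [b]; [ex_change] passes to bounded [a]. *)
Lemma ex_cond (a b : RX -> R) : bmf a -> measurable_fun setT (b : RX -> MR) ->
  Ex (fun w => a (X D w) * (Y D w <= b (X D w))%R%:R) =
  Ex (fun w => a (X D w) * condF (D := D) (X D w) (b (X D w))).
Proof.
move=> ba mb; have bF := bmf_condF mb.
apply: (ex_change mX (W1 := fun w => (Y D w <= b (X D w))%R%:R)
  (W2 := fun w => condF (D := D) (X D w) (b (X D w)))) => //.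
- by apply: bmf_bool; exact: measurable_YleX.
- exact: (bmf_comp mX bF).
- by move=> w; exact: condF_ge0.
move=> c mc.
have mcX : measurable_fun setT (fun w => c (X D w)) by exact: (measurableT_comp mc mX).
have := joint_law (measurable_subgraph mc mb).
rewrite (_ : [set w | _] = [set w | c (X D w) && (Y D w <= b (X D w))%R])//.
rewrite -ex_bool; last by apply: measurable_and => //; exact: measurable_YleX.
rewrite (_ : (\int[P]_w _)%E =
    (\int[P]_w ((c (X D w))%:R * condF (D := D) (X D w) (b (X D w)))%:E)%E); last first.
  apply: eq_integral => w _; case cX: (c (X D w)); last first.
    rewrite mul0r (_ : xsection _ _ = set0) ?measure0//.
    by apply/seteqP; split => y //; rewrite /xsection/= inE/= cX.
  rewrite mul1r condF_EFin; congr (condY D _ _).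
  by apply/seteqP; split => y; rewrite /xsection/= inE/= in_itv/= cX.
move=> E; rewrite [RHS]/Rintegral -E /=; apply: eq_Rintegral => w _.
by case: (c _) => /=; rewrite ?mul1r ?mul0r.
Qed.

Section quantile.
Variables (x : RX) (tau : R).
Hypotheses (tau0 : 0 < tau) (tau1 : tau < 1).

Let level_nonempty : [set y | tau <= condF (D := D) x y] !=set0.
Proof.
pose F (k : nat) : set MR := `]-oo, (k%:R : R)]%classic.
have FT : \bigcup_k F k = setT.
  apply/seteqP; split => y // _; exists (Num.bound `|y|) => //.
  by rewrite /F/= in_itv/= ltW// (le_lt_trans (ler_norm y))// archi_boundP.
have ndF : nondecreasing_seq F.
  move=> i j ij; apply/subsetPset => y; rewrite /F/= !in_itv/= => /le_trans; apply.
  by rewrite ler_nat.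
have mF k : measurable (F k) by exact: measurable_itv.
have := @nondecreasing_cvg_mu _ _ _ (condY D x) F mF.
rewrite FT => /(_ measurableT ndF); rewrite condY_setT => cF.
apply: contrapT => noy; suff : (1 <= tau%:E)%E by rewrite lee_fin leNgt tau1.
apply: (cvge_to_le cF); apply: nearW => k /=.
rewrite -condF_EFin lee_fin leNgt; apply/negP => tk.
by apply: noy; exists k%:R => /=; exact: ltW.
Qed.

Let level_lbound : has_lbound [set y | tau <= condF (D := D) x y].
Proof.
pose F (k : nat) : set MR := `]-oo, (- k%:R : R)]%classic.
have F0 : \bigcap_k F k = set0.
  apply/seteqP; split => y //= Hy; have := Hy (Num.bound `|y|) I.
  rewrite /F/= in_itv/= leNgt => /negP; apply; rewrite ltrNl.
  by rewrite (le_lt_trans (ler_norm _))// normrN archi_boundP.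
have niF : nonincreasing_seq F.
  move=> i j ij; apply/subsetPset => y; rewrite /F/= !in_itv/= => /le_trans; apply.
  by rewrite lerN2 ler_nat.
have mF k : measurable (F k) by exact: measurable_itv.
have := @nonincreasing_cvg_mu _ _ _ (condY D x) F
  (le_lt_trans (condY_le1 x (mF 0%N)) (ltry _)) mF.
rewrite F0 => /(_ measurable0 niF); rewrite measure0 => cF.
apply: contrapT => nolb; suff : (tau%:E <= 0)%E by rewrite lee_fin leNgt tau0.
apply: (cvge_to_ge cF); apply: nearW => k /=.
rewrite -condF_EFin lee_fin leNgt; apply/negP => tk.
apply: nolb; exists (- k%:R) => y /= ty; rewrite leNgt; apply/negP => yk.
by have := le_lt_trans (le_trans ty (condF_mono x (ltW yk))) tk; rewrite ltxx.
Qed.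

Lemma condQ_ge : tau <= condF (D := D) x (condQ (D := D) x tau).
Proof.
set q := condQ x tau.
pose F (k : nat) : set MR := `]-oo, (q + k.+1%:R^-1 : R)]%classic.
have FI : \bigcap_k F k = `]-oo, q]%classic.
  apply/seteqP; split => y /=; rewrite in_itv/=; last first.
    by move=> yq k _; rewrite /F/= in_itv/= (le_trans yq)// lerDl invr_ge0.
  move=> Hy; apply/ler_addgt0Pr => e e0; have := Hy (Num.bound e^-1) I.
  rewrite /F/= in_itv/= => /le_trans; apply; rewrite lerD2l.
  rewrite -[leRHS]invrK lef_pV2 ?posrE ?invr_gt0//.
  rewrite ltW// (lt_trans (archi_boundP _)) ?ltr_nat// invr_ge0; exact: ltW.
have niF : nonincreasing_seq F.
  move=> i j ij; apply/subsetPset => y; rewrite /F/= !in_itv/= => /le_trans; apply.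
  by rewrite lerD2l lef_pV2 ?posrE// ler_nat.
have mF k : measurable (F k) by exact: measurable_itv.
have := @nonincreasing_cvg_mu _ _ _ (condY D x) F
  (le_lt_trans (condY_le1 x (mF 0%N)) (ltry _)) mF.
rewrite FI => /(_ (measurable_itv _) niF) cF.
rewrite -lee_fin condF_EFin; apply: (cvge_to_ge cF); apply: nearW => k.
rewrite /= /F -condF_EFin lee_fin.
have [y ty yq] : exists2 y, tau <= condF (D := D) x y & y < q + k.+1%:R^-1.
  apply: (@inf_adherent _ [set y | tau <= condF (D := D) x y] k.+1%:R^-1).
    by rewrite invr_gt0.
  by split.
exact: le_trans ty (condF_mono x (ltW yq)).
Qed.

(** The infimum is attained by right continuity, which makes quantile and
    distribution function a Galois connection. *)
Lemma condQ_le y : (condQ (D := D) x tau <= y) = (tau <= condF (D := D) x y).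
Proof.
apply/idP/idP => [qy|ty]; first exact: le_trans condQ_ge (condF_mono x qy).
exact: ge_inf.
Qed.

End quantile.

Lemma measurable_condQ tau : 0 < tau -> tau < 1 ->
  measurable_fun setT (fun x : RX => condQ (D := D) x tau : MR).
Proof.
move=> t0 t1; apply: (measurability _ (RGenOInfty.measurableE R)) => //.
move=> _ [_ [y ->] <-]; rewrite setTI.
have -> : (fun x => condQ (D := D) x tau) @^-1` `]y, +oo[%classic =
    [set x | condF (D := D) x y < tau].
  by apply/seteqP; split => x /=; rewrite in_itv/= andbT !ltNge condQ_le.
have : measurable_fun setT (fun x => (condF (D := D) x y < tau)%R).
  by apply: measurable_fun_ltr => //; exact: measurable_condF.
by move=> /(_ measurableT [set true]); rewrite setTI; apply.
Qed.

End conditional_law.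

(** * Smooth conditional distribution functions *)

Section calculus.
Context {R : realType}.

Lemma mvt_any (g : R -> R) (a b : R) : (forall y, derivable g y 1) ->
  exists2 c, Num.min a b <= c <= Num.max a b & g b - g a = (derive1 g) c * (b - a).
Proof.
move=> dg; have cg : continuous g.
  by move=> y; apply: differentiable_continuous; apply/derivable1_diffP.
have seg u v : u <= v -> exists2 c, u <= c <= v & g v - g u = (derive1 g) c * (v - u).
  move=> uv; have [|c] := @MVT_segment R g (derive1 g) u v uv _ (continuous_subspaceT cg).
    by move=> y _; rewrite derive1E; apply: derivableP.
  by rewrite in_itv/= => cuv ->; exists c.
have [ab|ba] := leP a b; first by have [c ? ?] := seg a b ab; exists c.
have [c c1 c2] := seg b a (ltW ba); exists c => //.
by rewrite -[LHS]opprB c2 -mulrN opprB.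
Qed.

Lemma between_dist (a b c : R) : Num.min a b <= c <= Num.max a b ->
  `|c - a| <= `|b - a|.
Proof.
have [ab|ba] := leP a b => /andP[h1 h2].
  by rewrite !ger0_norm ?subr_ge0// lerD2r.
by rewrite !ler0_norm ?subr_le0// ?(ltW ba)// lerN2 lerD2r.
Qed.

Lemma lipschitz_of_derive (g : R -> R) K a b : (forall y, derivable g y 1) ->
  (forall y, `|(derive1 g) y| <= K) -> `|g b - g a| <= K * `|b - a|.
Proof.
move=> dg gK; have [c _ ->] := mvt_any a b dg.
by rewrite normrM ler_wpM2r.
Qed.

Lemma taylor1 (g : R -> R) K a b : (forall y, derivable g y 1) ->
  (forall y, derivable (derive1 g) y 1) -> (forall y, `|(derive1 (derive1 g)) y| <= K) ->
  `|g b - g a - (derive1 g) a * (b - a)| <= K * (b - a) ^+ 2.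
Proof.
move=> dg dg' gK; have [c cab ->] := mvt_any a b dg.
have K0 : 0 <= K by rewrite (le_trans _ (gK 0)).
rewrite -mulrBl normrM -[(b - a) ^+ 2]real_normK ?num_real// expr2 mulrA.
rewrite ler_wpM2r// (le_trans (lipschitz_of_derive _ _ dg' gK))//.
by rewrite ler_wpM2l// between_dist.
Qed.

End calculus.

Section smooth_row.
Context {R : realType} {n : nat}.
Variables (D : qr_row R n) (K : R).
Hypothesis smooth : forall x, calX D x -> forall y : R,
  derivable (condF (D := D) x) y 1 /\ derivable (condf (D := D) x) y 1.
Hypothesis dens_bound : forall x, calX D x -> forall y : R,
  `|condf (D := D) x y| <= K /\ `|derive1 (condf (D := D) x) y| <= K.

Local Notation RX := (Rd R (dimX D)).
Local Notation MR := (measurableTypeR R).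

Lemma condF_lip x y y' : calX D x ->
  `|condF (D := D) x y' - condF (D := D) x y| <= K * `|y' - y|.
Proof.
move=> cx; apply: lipschitz_of_derive => u; first by have [] := smooth cx u.
by have [] := dens_bound cx u.
Qed.

Lemma condf_lip x y y' : calX D x ->
  `|condf (D := D) x y' - condf (D := D) x y| <= K * `|y' - y|.
Proof.
move=> cx; apply: lipschitz_of_derive => u; first by have [] := smooth cx u.
by have [] := dens_bound cx u.
Qed.

Lemma condF_taylor x y y' : calX D x ->
  `|condF (D := D) x y' - condF (D := D) x y - condf (D := D) x y * (y' - y)| <=
    K * (y' - y) ^+ 2.
Proof.
move=> cx; apply: taylor1 => u; first by have [] := smooth cx u.
  by have [] := smooth cx u.
by have [] := dens_bound cx u.
Qed.

Lemma dens_bound_ge0 x : calX D x -> 0 <= K.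
Proof. by move=> cx; have [h _] := dens_bound cx 0; exact: le_trans h. Qed.

Lemma condQ_eq x tau : calX D x -> 0 < tau -> tau < 1 ->
  condF (D := D) x (condQ (D := D) x tau) = tau.
Proof.
move=> cx t0 t1; apply/eqP; rewrite eq_le condQ_ge// andbT leNgt; apply/negP => h.
have K0 := dens_bound_ge0 cx; set q := condQ x tau in h.
set e := condF (D := D) x q - tau; have e0 : 0 < e by rewrite subr_gt0.
have K1 : 0 < K + 1 by lra.
have := condF_lip q (q - e / (K + 1)) cx.
have -> : q - e / (K + 1) - q = - (e / (K + 1)) by lra.
have d0 : 0 < e / (K + 1) by rewrite divr_gt0.
rewrite normrN (gtr0_norm d0) ler_norml => /andP[h1 _].
have h2 : K * (e / (K + 1)) <= e.
  by rewrite mulrCA ler_piMr ?(ltW e0)// ler_pdivrMr// mul1r; lra.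
have : condQ (D := D) x tau <= q - e / (K + 1).
  by have eE : e = condF (D := D) x q - tau by []; rewrite condQ_le//; lra.
by rewrite -/q; lra.
Qed.

Section quantile_lipschitz.
Variables (tl tu fmin : R).
Hypotheses (tl0 : 0 < tl) (tu1 : tu < 1) (fmin0 : 0 < fmin).
Hypothesis dens_min : forall tau, `[tl, tu]%classic tau ->
  forall x, calX D x -> fmin <= condf (D := D) x (condQ (D := D) x tau).

(** A point between two quantiles is itself the quantile of its level: the
    density is positive at that quantile, so the distribution function cannot be
    flat to its right. *)
Lemma condf_ge_between x y : calX D x -> tl <= condF (D := D) x y ->
  condF (D := D) x y <= tu -> fmin <= condf (D := D) x y.
Proof.
move=> cx lo hi; set s := condF x y in lo hi.
have s0 : 0 < s := lt_le_trans tl0 lo.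
have s1 : s < 1 := le_lt_trans hi tu1.
have Ts : `[tl, tu]%classic s by rewrite /= in_itv/= lo hi.
set q := condQ (D := D) x s; have qy : q <= y by rewrite /q condQ_le.
have fq := dens_min Ts cx; rewrite -/q in fq.
have Fq : condF (D := D) x q = s by exact: condQ_eq.
move: qy; rewrite le_eqVlt => /orP[/eqP <-//|qy]; exfalso.
have K0 := dens_bound_ge0 cx.
set h := Num.min (y - q) (fmin / (2 * (K + 1))).
have h0 : 0 < h by rewrite lt_min subr_gt0 qy divr_gt0// mulr_gt0//; lra.
have hyq : h <= y - q by rewrite ge_min lexx.
have hy : q + h <= y by lra.
have hf : h * (2 * (K + 1)) <= fmin.
  by rewrite -ler_pdivlMr ?ge_min ?lexx ?orbT// mulr_gt0//; lra.
have Fh : condF (D := D) x (q + h) = s.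
  apply/eqP; rewrite eq_le (condF_mono x hy)/= -{1}Fq condF_mono// lerDl ltW//.
have := condF_taylor q (q + h) cx; rewrite Fh Fq subrr sub0r normrN.
have -> : q + h - q = h by lra.
move=> /(le_trans (ler_norm _)); rewrite expr2 mulrA ler_pM2r// => h1.
nra.
Qed.

(** Between the two quantiles the distribution function has slope at least
    [fmin]. *)
Lemma condQ_lip x t1 t2 : calX D x -> tl <= t1 -> t1 <= t2 -> t2 <= tu ->
  0 <= condQ (D := D) x t2 - condQ (D := D) x t1 <= (t2 - t1) / fmin.
Proof.
move=> cx lo t12 hi.
have t10 : 0 < t1 := lt_le_trans tl0 lo.
have t21 : t2 < 1 := le_lt_trans hi tu1.
have t20 : 0 < t2 := lt_le_trans t10 t12.
have t11 : t1 < 1 := le_lt_trans t12 t21.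
have q12 : condQ (D := D) x t1 <= condQ (D := D) x t2.
  by rewrite condQ_le// condQ_eq.
rewrite subr_ge0 q12/= ler_pdivlMr//.
have [c] := @mvt_any R (condF (D := D) x) (condQ (D := D) x t1)
  (condQ (D := D) x t2) (fun u => (smooth cx u).1).
rewrite min_l// max_r// !condQ_eq// => /andP[c1 c2] ->.
rewrite mulrC ler_wpM2r ?subr_ge0//.
apply: condf_ge_between => //.
  by rewrite (le_trans lo)// -(condQ_eq cx t10 t11); exact: condF_mono.
by rewrite (le_trans _ hi)// -(condQ_eq cx t20 t21); exact: condF_mono.
Qed.

End quantile_lipschitz.

(** The density is a pointwise limit of difference quotients. It exists only on
    [calX], hence the composition with [X]. *)
Lemma measurable_condf (b : RX -> R) : measurable_fun setT (b : RX -> MR) ->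
  measurable_fun setT (fun w => condf (D := D) (X D w) (b (X D w)) : MR).
Proof.
move=> mb.
have mX : measurable_fun setT (X D : Omega D -> RX) by exact: measurable_funPT.
pose h (k : nat) w : MR := k.+1%:R *
  (condF (D := D) (X D w) (b (X D w) + k.+1%:R^-1) - condF (D := D) (X D w) (b (X D w))).
apply: (@measurable_fun_cvg _ _ R setT h) => [k|w _].
  apply: measurable_funM => //; apply: measurable_funB.
    have mb' : measurable_fun setT (fun x : RX => b x + k.+1%:R^-1 : MR).
      exact: measurable_funD.
    exact: (measurableT_comp (measurable_condF mb') mX).
  exact: (measurableT_comp (measurable_condF mb) mX).
have cx := X_in (q := D) w; have K0 := dens_bound_ge0 cx.
apply/cvgrPdist_le => e e0.
exists (Num.bound (K / e)) => // k /= Hk.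
rewrite distrC /h; set y := b (X D w).
have k0 : 0 < k.+1%:R :> R by [].
have := condF_taylor y (y + k.+1%:R^-1) cx.
have -> : y + k.+1%:R^-1 - y = k.+1%:R^-1 by rewrite addrAC subrr add0r.
rewrite -(ler_pM2l k0) -{1}(gtr0_norm k0) -normrM mulrBr => H.
rewrite [X in `|_ - X|](_ : _ = k.+1%:R * (condf (D := D) (X D w) y / k.+1%:R)).
  apply: (le_trans H).
  have -> : k.+1%:R * (K * k.+1%:R^-1 ^+ 2) = K / k.+1%:R.
    by field; rewrite gt_eqF.
  rewrite ler_pdivrMr// mulrC -ler_pdivrMr//.
  rewrite ltW// (lt_trans (archi_boundP _)) ?ltr_nat//; last by rewrite divr_ge0// ltW.
by field; rewrite gt_eqF.
Qed.

Lemma bmf_condf (b : RX -> R) : measurable_fun setT (b : RX -> MR) ->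
  bmf (fun w => condf (D := D) (X D w) (b (X D w))).
Proof.
move=> mb; split; first exact: measurable_condf.
by exists K => w; have [] := dens_bound (X_in w) (b (X D w)).
Qed.

End smooth_row.

(** * First-order condition *)

Section first_order.
Context {R : realType} {m n : nat}.
Variables (ys : 'I_n -> R) (zs : 'I_n -> 'cV[R]_m) (tau : R) (b : 'cV[R]_m).
Hypothesis b_min : forall b' : 'cV[R]_m,
  \sum_(i < n) check_loss tau (ys i - dotv b (zs i)) <=
  \sum_(i < n) check_loss tau (ys i - dotv b' (zs i)).

(** The condition on [s] keeps the step on the linear piece of the check loss where
    it starts, unless it starts at the kink. *)
Let check_loss_step (u h s : R) : 0 < s -> (u != 0 -> s * `|h| < `|u|) ->
  check_loss tau (u - s * h) - check_loss tau u <=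
  s * (((u <= 0)%R%:R - tau) * h + (u == 0)%:R * `|h|).
Proof.
move=> s0; rewrite /check_loss; have [->|u0] := eqVneq u 0.
  move=> _; rewrite sub0r lexx /= mulr0 subr0 oppr_le0 pmulr_rge0//.
  case: (leP 0 h) => h0 /=; first by rewrite (ger0_norm h0); nra.
  by rewrite (ltr0_norm h0); nra.
move=> /(_ isT) small; rewrite mul0r addr0.
have : s * h <= s * `|h| by rewrite ler_wpM2l ?ler_norm// ltW.
have : - (s * h) <= s * `|h| by rewrite -mulrN (ler_pM2l s0) -normrN ler_norm.
have [u1|u1] := leP u 0.
  rewrite (ler0_norm u1) in small; case: (leP (u - s * h) 0) => /=; nra.
rewrite (gtr0_norm u1) in small; case: (leP (u - s * h) 0) => /=; nra.
Qed.

(** The directional derivative of the loss against the score [S] is nonnegative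
    at the minimiser. It equals [- |S|^2] up to the contribution of the
    observations at the kink. *)
Lemma score_at_minimiser :
  enorm (\sum_i ((ys i <= dotv b (zs i))%R%:R - tau) *: zs i) <=
  \sum_(i | ys i == dotv b (zs i)) enorm (zs i).
Proof.
set S := \sum_i _; pose u i := ys i - dotv b (zs i); pose h i := - dotv S (zs i).
(* a step so short that no residual changes sign *)
pose s := \big[Num.min/1]_(i | u i != 0) (`|u i| / (`|h i| + 1)).
have h1 i : 0 < `|h i| + 1 by rewrite ltr_wpDl.
have s0 : 0 < s.
  by apply: lt_bigmin => // i ui; rewrite divr_gt0// normr_gt0.
have small i : u i != 0 -> s * `|h i| < `|u i|.
  move=> ui; have : s <= `|u i| / (`|h i| + 1) by exact: bigmin_le_cond.
  rewrite ler_pdivlMr// => /(lt_le_trans _); apply.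
  by rewrite ltr_pM2l// ltrDl.
have Sh : \sum_i ((u i <= 0)%R%:R - tau) * h i = - enorm S ^+ 2.
  rewrite enorm_sqr {2}/S dotv_sumr -sumrN; apply: eq_bigr => i _.
  by rewrite /u subr_le0 dotvZr mulrN.
have := b_min (b - s *: S).
rewrite -subr_ge0 -sumrB => H.
have {H} : 0 <= \sum_i s * (((u i <= 0)%R%:R - tau) * h i + (u i == 0)%:R * `|h i|).
  apply: (le_trans H); apply: ler_sum => i _.
  rewrite (_ : ys i - dotv (b - s *: S) (zs i) = u i - s * h i).
    exact: check_loss_step (small i).
  by rewrite /u /h dotvBl dotvZl; ring.
rewrite -mulr_sumr pmulr_rge0// big_split/= Sh addrC subr_ge0 => H.
have {}H : enorm S ^+ 2 <= enorm S * \sum_(i | ys i == dotv b (zs i)) enorm (zs i).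
  apply: (le_trans H); rewrite [in leRHS]big_mkcond/= mulr_sumr; apply: ler_sum => i _.
  rewrite /u subr_eq0; case: ifPn => _; last by rewrite mul0r mulr0.
  by rewrite mul1r /h normrN normr_dotv_le.
have [S0|S0] := eqVneq (enorm S) 0.
  by rewrite S0; apply: sumr_ge0 => i _; exact: enorm_ge0.
by move: H; rewrite expr2 ler_pM2l// lt_neqAle eq_sym S0 enorm_ge0.
Qed.

(** The check loss is convex, and up to a constant this is its derivative along a
    ray. *)
Lemma score_mono (v : 'cV[R]_m) s t : s <= t ->
  dotv v (\sum_i (ys i <= dotv (b + s *: v) (zs i))%R%:R *: zs i) <=
  dotv v (\sum_i (ys i <= dotv (b + t *: v) (zs i))%R%:R *: zs i).
Proof.
move=> st; rewrite !dotv_sumr; apply: ler_sum => i _; rewrite !dotvZr.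
rewrite !dotvDl !dotvZl; have [v0|v0] := leP 0 (dotv v (zs i)).
  rewrite ler_wpM2r// ler_nat; case: leP => //= h1.
  by rewrite (le_trans h1)// lerD2l ler_wpM2r.
rewrite ler_nM2r// ler_nat; case: leP => //= h1; rewrite ?leq_b1//.
by rewrite (le_trans h1)// lerD2l ler_wnM2r// ltW.
Qed.

End first_order.

(** * Grids *)

Section grid.
Context {R : realType} {m : nat}.

Definition grid_index (N : nat) := {ffun 'I_m -> 'I_(2 * N).+1}.

(** The index [N] in each coordinate is the centre [b0] of the cube. *)
Definition grid_point (b0 : 'cV[R]_m) (rho : R) (N : nat) (k : grid_index N) :
  'cV[R]_m := \col_j (b0 j 0 + rho * ((k j)%:R - N%:R) / N%:R).

Lemma card_grid N : #|{: grid_index N}| = ((2 * N).+1 ^ m)%N.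
Proof. by rewrite card_ffun !card_ord. Qed.

Lemma grid_approx (b0 b : 'cV[R]_m) rho N : 0 < rho -> (0 < N)%N ->
  enorm (b - b0) <= rho ->
  exists k : grid_index N, enorm (grid_point b0 rho k - b) <= m%:R * (rho / N%:R).
Proof.
move=> rho0 N0 bb; have NR : 0 < N%:R :> R by rewrite ltr0n.
pose y j : R := N%:R + N%:R * ((b - b0) j 0 / rho).
have yb j : 0 <= y j <= 2 * N%:R.
  have := le_trans (normr_entry_le (b - b0) j) bb; rewrite ler_norml => /andP[h1 h2].
  have e1 : (b - b0) j 0 / rho <= 1 by rewrite ler_pdivrMr// mul1r.
  have e2 : -1 <= (b - b0) j 0 / rho by rewrite ler_pdivlMr// mulN1r.
  by rewrite /y; apply/andP; split; nra.
have tr j : (Num.truncn (y j) < (2 * N).+1)%N.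
  have /andP[y0 y2] := yb j; have /andP[t1 _] := truncn_itv y0.
  by rewrite ltnS -(ler_nat R) natrM (le_trans t1).
exists [ffun j => Ordinal (tr j)].
apply: enorm_le_entry => [|j]; first by rewrite divr_ge0// ltW.
have /andP[y0 y2] := yb j; have /andP[t1 t2] := truncn_itv y0.
rewrite !mxE ffunE /=; set t := (Num.truncn (y j))%:R in t1 t2 *.
rewrite (_ : _ - b j 0 = rho / N%:R * (t - y j)); last first.
  rewrite /y !mxE; field; by rewrite !gt_eqF.
have q0 : 0 < rho / N%:R by rewrite divr_gt0.
rewrite normrM (gtr0_norm q0) (ler_piMr (ltW q0))//.
rewrite -natr1 -/t in t2; rewrite ler_norml; apply/andP; split; lra.
Qed.

End grid.

(** * Finite unions and null sets *)

Section events.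
Context {d : measure_display} {T : measurableType d} {R : realType}.
Variable P : probability T R.
Local Notation Ex f := (Rintegral P setT f).

Lemma bool_diff_le1 (a b : bool) : `|a%:R - b%:R : R| <= 1.
Proof. by case: a; case: b; rewrite ?subrr ?subr0 ?sub0r ?normrN ?normr0 ?normr1. Qed.

Lemma measurable_bool_set (b : T -> bool) : measurable_fun setT b ->
  measurable [set w | b w].
Proof. by move=> /(_ measurableT [set true]); rewrite setTI; apply. Qed.

Lemma measurable_exists (I : finType) (b : I -> T -> bool) :
  (forall i, measurable_fun setT (b i)) ->
  measurable_fun setT (fun w => [exists i, b i w]).
Proof.
move=> mb; apply: (@measurable_fun_bool _ _ _ _ true); rewrite setTI.
have -> : (fun w => [exists i, b i w]) @^-1` [set true] =
    \bigcup_(i in [set: I]) [set w | b i w].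
  apply/seteqP; split => w /=; first by move=> /existsP[i bi]; exists i.
  by move=> [i _ bi]; apply/existsP; exists i.
apply: fin_bigcup_measurable => // i _.
by have := mb i measurableT [set true]; rewrite setTI; apply.
Qed.

Lemma pr_exists_le (I : finType) (b : I -> T -> bool) (e : R) :
  (forall i, measurable_fun setT (b i)) ->
  (forall i, (P [set w | b i w] <= e%:E)%E) ->
  (P [set w | [exists i, b i w]] <= (#|I|%:R * e)%:E)%E.
Proof.
move=> mb be; rewrite -ex_bool; last exact: measurable_exists.
rewrite lee_fin.
apply: (@le_trans _ _ (Ex (fun w => \sum_i (b i w)%:R))).
  apply: ler_ex => [||w].
  - by apply: bmf_bool; exact: measurable_exists.
  - by apply: bmf_sum => i; exact: bmf_bool.
  have [/existsP[i bi]|_] := boolP [exists i, b i w]; last exact: sumr_ge0.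
  by rewrite (bigD1 i)//= bi lerDl sumr_ge0.
rewrite ex_sum => [|i]; last exact: bmf_bool.
rewrite mulr_natl -sumr_const; apply: ler_sum => i _.
by rewrite -lee_fin ex_bool.
Qed.

Lemma exists_subset_card (I : finType) (A : {pred I}) k : (k <= #|A|)%N ->
  exists2 S : {set I}, S \subset A & #|S| = k.
Proof.
move=> kA; exists [set x in take k (enum A)].
  by apply/fintype.subsetP => i; rewrite inE => /mem_take; rewrite mem_enum.
rewrite cardsE (card_uniqP _) ?take_uniq ?enum_uniq// size_takel//.
by rewrite -cardE.
Qed.

Lemma negligible_small (A : set T) :
  (forall e : R, 0 < e -> exists2 B, measurable B & A `<=` B /\ (P B <= e%:E)%E) ->
  P.-negligible A.
Proof.
move=> small.
have /choice[B HB] (k : nat) : exists B, [/\ measurable B, A `<=` B &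
    (P B <= k.+1%:R^-1%:E)%E].
  by have [|B mB [AB PB]] := small k.+1%:R^-1; [rewrite invr_gt0|exists B].
have mB k : measurable (B k) by have [] := HB k.
exists (\bigcap_k B k); split; first exact: bigcapT_measurable.
  apply/eqP; rewrite eq_le measure_ge0 andbT; apply/lee_addgt0Pr => e e0.
  rewrite add0e; pose k := Num.bound e^-1.
  apply: (@le_trans _ _ (P (B k))).
    apply: le_measure; rewrite ?inE//; first exact: bigcapT_measurable.
    exact: bigcap_inf.
  have [_ _ /le_trans] := HB k; apply; rewrite lee_fin.
  rewrite -[leRHS]invrK lef_pV2 ?posrE ?invr_gt0//.
  by rewrite ltW// (lt_trans (archi_boundP _)) ?ltr_nat// invr_ge0 ltW.
by move=> w Aw k _; have [_ AB _] := HB k; exact: AB.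
Qed.

Lemma ae_forall_fin (I : finType) (A : I -> T -> Prop) :
  (forall i, {ae P, forall w, A i w}) -> {ae P, forall w, forall i, A i w}.
Proof.
move=> H.
have : {ae P, forall w, forall k : nat, if @unpickle I k is Some i then A i w else True}.
  by apply: ae_foralln => k; case: unpickle => [i|]; [exact: H|exact: aeW].
by apply: filterS => w Hw i; have := Hw (pickle i); rewrite pickleK.
Qed.

End events.

(** * Choice of the parameters *)

Lemma half_gap (R : realFieldType) (p q e f : R) : p - q <= e -> f <= p ->
  e <= f / 2 -> f / 2 <= q.
Proof. by move=> *; lra. Qed.

Lemma ray_gap (R : realFieldType) (D1 D2 g k e v : R) y1 y2 y3 y4 y5 :
  D1 + g + D2 + k + e < v -> - D2 <= y1 -> - D1 <= y2 -> - g <= y3 -> - k <= y4 ->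
  v <= y5 -> e < y1 + y2 + y3 + y4 + y5.
Proof. by move=> *; lra. Qed.

(** Once the speed is fixed, every smallness requirement below is of the form
    [y * theta <= 1] for one of finitely many constants [y]. *)
Lemma small_threshold (R : realType) (M K speed : R) : 0 < M -> 0 <= K -> 0 < speed ->
  exists theta : R, [/\ 0 < theta, 16 * theta <= 1,
    8 * (K + 1) * M * speed * theta <= 1, K * M * speed ^+ 2 * theta <= 1 &
    speed * (M + 1) * theta <= 1].
Proof.
move=> M0 K0 s0; have K1 : 0 < K + 1 by rewrite ltr_wpDl.
have M1 : 0 < M + 1 by rewrite addr_gt0.
have p1 : 0 < 8 * (K + 1) * M * speed by rewrite !mulr_gt0.
have p2 : 0 <= K * M * speed ^+ 2 by rewrite mulr_ge0 ?sqr_ge0// mulr_ge0// ltW.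
have p3 : 0 < speed * (M + 1) by rewrite mulr_gt0.
move: p1 p2 p3; move: (8 * _ * _ * _) (K * _ * _) (speed * _) => a b c a0 b0 c0.
have s : 0 < 16 + a + b + c by lra.
by exists (16 + a + b + c)^-1; rewrite invr_gt0 !ler_pdivrMr// mul1r; split => //; lra.
Qed.

(** [speed] is the constant in the radius [t] within which the estimator is found,
    [x] the level in Bernstein's inequality, [D1] and [D2] the resulting bounds of
    the process and of its increments over the distance [t]. Adding
    [16 * m * ln n] to [kappa] pays for the union bound over three grids of
    [(2 * n ^ 3 + 1) ^ m] points. *)
Section parameters.
Context {R : realType}.
Variables (M K fmin rho speed theta : R).
Hypotheses (M_gt0 : 0 < M) (K_ge0 : 0 <= K) (fmin_gt0 : 0 < fmin) (rho_gt0 : 0 < rho).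
Hypothesis speed_gt0 : 0 < speed.
Hypothesis speedE : speed * (fmin / M / 2) = 132 + 96 * (M + 1).
Hypothesis theta_gt0 : 0 < theta.
Hypothesis theta16 : 16 * theta <= 1.
Hypothesis theta_var : 8 * (K + 1) * M * speed * theta <= 1.
Hypothesis theta_quad : K * M * speed ^+ 2 * theta <= 1.
Hypothesis theta_speed : speed * (M + 1) * theta <= 1.

Definition bahadur_constant : R := M / fmin *
  (K * M * speed ^+ 2 + (K * M * speed + (736 + 24 * Num.sqrt (8 * (K + 1) * M * speed)))).

Let K1 : 0 < K + 1. Proof. by rewrite ltr_wpDl. Qed.
Let M1 : 0 < M + 1. Proof. by rewrite addr_gt0. Qed.
Let p1 : 0 < 8 * (K + 1) * M * speed.
Proof. by rewrite !mulr_gt0. Qed.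
Let p2 : 0 <= K * M * speed ^+ 2.
Proof. exact: (mulr_ge0 (mulr_ge0 K_ge0 (ltW M_gt0)) (sqr_ge0 _)). Qed.
Let KMs_ge0 : 0 <= K * M * speed.
Proof. exact: (mulr_ge0 (mulr_ge0 K_ge0 (ltW M_gt0)) (ltW speed_gt0)). Qed.
Let Mf0 : 0 < M / fmin. Proof. exact: divr_gt0. Qed.

Lemma bahadur_constant_gt0 : 0 < bahadur_constant.
Proof.
apply: (mulr_gt0 Mf0); move: p2 KMs_ge0 (sqrtr_ge0 (8 * (K + 1) * M * speed)).
by move: (Num.sqrt _) (K * M * speed ^+ 2) (K * M * speed) => a b c; lra.
Qed.

Section one_row.
Variables (n m : nat) (xi g kappa : R).
Local Notation L := (ln n%:R : R).
Local Notation a1 := (Num.sqrt (m%:R / n%:R * L)).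
Local Notation a2 := (Num.sqrt (kappa / n%:R)).
Let a : R := a1 + a2.
Let delta : R := a1 + a2 + g.
Let x : R := kappa + 16 * (m%:R * L).
Let t : R := speed * delta.
Let e : R := x / n%:R.
Hypotheses (m_gt0 : (0 < m)%N) (L_ge1 : 1 <= L) (xi_gt0 : 0 < xi) (g_ge0 : 0 <= g).
Hypotheses (kappa_gt0 : 0 < kappa) (n_gt0 : (0 < n)%N).
Hypothesis xi_large : 1 <= M * xi ^+ 2.
Hypothesis delta_small : xi * delta <= theta.

Let nR : 0 < n%:R :> R. Proof. by rewrite ltr0n. Qed.
Let mR : 1 <= m%:R :> R. Proof. by rewrite ler1n. Qed.
Let mL : 1 <= m%:R * L. Proof. exact: mulr_ege1. Qed.
Let a1_ge0 : 0 <= a1. Proof. exact: sqrtr_ge0. Qed.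
Let a2_gt0 : 0 < a2. Proof. by rewrite sqrtr_gt0 divr_gt0. Qed.
Let a_gt0 : 0 < a. Proof. exact: ltr_wpDl. Qed.
Let delta_gt0 : 0 < delta. Proof. exact: ltr_wpDr. Qed.
Let a_le : a <= delta. Proof. by rewrite lerDl. Qed.
Let a1_sqr : a1 ^+ 2 = m%:R * L / n%:R.
Proof. by rewrite sqr_sqrtr mulrAC// divr_ge0 ?(le_trans ler01 mL)// ltW. Qed.
Let a2_sqr : a2 ^+ 2 = kappa / n%:R.
Proof. by rewrite sqr_sqrtr// divr_ge0 ?ltW. Qed.

Lemma level_gt0 : 0 < x.
Proof. by rewrite /x; move: kappa_gt0 mL; lra. Qed.

Let e_gt0 : 0 < e. Proof. exact: divr_gt0 level_gt0 nR. Qed.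

Let e_le : e <= 16 * a ^+ 2.
Proof.
have -> : e = a2 ^+ 2 + 16 * a1 ^+ 2.
  by rewrite a1_sqr a2_sqr /e /x; field; rewrite gt_eqF.
have := mulr_ge0 a1_ge0 (ltW a2_gt0); have := sqr_ge0 a2.
rewrite /a sqrrD -mulr_natr; move: (a1 * a2) (a1 ^+ 2) (a2 ^+ 2) => u v w; lra.
Qed.

Let eps_le : Num.sqrt e <= 4 * a.
Proof.
have a4 : 0 <= 4 * a by rewrite mulr_ge0// ltW.
rewrite -[leRHS](ger0_norm a4) -sqrtr_sqr; apply: ler_wsqrtr.
by apply: (le_trans e_le); rewrite exprMn -natrX.
Qed.

Let xia : xi * a <= theta.
Proof. by apply: le_trans delta_small; rewrite ler_pM2l. Qed.

Let xie : xi * e <= a.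
Proof.
have h : xi * e <= xi * (16 * a ^+ 2) by rewrite ler_pM2l.
apply: (le_trans h); have -> : xi * (16 * a ^+ 2) = 16 * (xi * a) * a by ring.
rewrite -[leRHS]mul1r ler_pM2r//; apply: le_trans theta16.
by rewrite ler_pM2l.
Qed.

Lemma radius_gt0 : 0 < t.
Proof. exact: mulr_gt0 speed_gt0 delta_gt0. Qed.

(** [xi] is bounded away from [0], so that [xi * delta <= theta] bounds [delta]. *)
Lemma radius_le1 : t <= 1.
Proof.
have d2 : delta ^+ 2 <= ((M + 1) * theta) ^+ 2.
  have h : (xi * delta) ^+ 2 <= theta ^+ 2.
    by rewrite lerXn2r// nnegrE ?(ltW theta_gt0)// mulr_ge0// ltW.
  apply: (@le_trans _ _ (M * xi ^+ 2 * delta ^+ 2)).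
    by rewrite ler_peMl// sqr_ge0.
  rewrite -mulrA -exprMn [leRHS]exprMn.
  apply: ler_pM => //; [exact: ltW|exact: sqr_ge0|].
  by move: M_gt0 (sqr_ge0 M); rewrite sqrrD expr1n mulr1 -mulr_natr; move: (M ^+ 2) => ?; lra.
have d1 : delta <= (M + 1) * theta.
  rewrite -(@ler_pXn2r _ 2)// nnegrE ?(ltW delta_gt0)//.
  by rewrite mulr_ge0 ?(ltW M1) ?(ltW theta_gt0).
apply: le_trans theta_speed; rewrite /t -mulrA ler_pM2l ?speed_gt0//.
Qed.

Local Notation eps := (Num.sqrt e).
Local Notation D1 := (11 * xi * e + 4 * (3 * (2 * (M + 1)) * eps + 6 * (2 * xi) * e)).
Local Notation S := (Num.sqrt (8 * (K + 1) * M * xi * t)).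
Local Notation D2 := (22 * xi * e + 2 * (3 * S * eps + 6 * (2 * xi) * e)).

Let SE : S = Num.sqrt (8 * (K + 1) * M * speed) * Num.sqrt (xi * delta).
Proof.
rewrite -sqrtrM ?(ltW p1)//; congr Num.sqrt.
by rewrite /t; ring.
Qed.

Let S_le1 : S <= 1.
Proof.
rewrite -[leRHS]sqrtr1; apply: ler_wsqrtr; apply: le_trans theta_var.
have -> : 8 * (K + 1) * M * xi * t = 8 * (K + 1) * M * speed * (xi * delta) by rewrite /t; ring.
by rewrite ler_pM2l.
Qed.

(** With [xi * e <= a], [eps <= 4 * a] and [S <= 1], [D1] is at most
    [(59 + 96 * (M + 1)) * a] and [D2] at most [70 * a]; the quadratic term is
    at most [delta], and so are [g] and the score at the minimiser together. *)
Lemma radius_dominates : D1 + g + D2 + K * xi * M * t ^+ 2 + m%:R * xi / n%:R < t * (fmin / M / 2).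
Proof.
have tE : t * (fmin / M / 2) = (132 + 96 * (M + 1)) * delta.
  by rewrite -speedE /t; ring.
have q : K * xi * M * t ^+ 2 <= delta.
  have -> : K * xi * M * t ^+ 2 = K * M * speed ^+ 2 * (xi * delta) * delta by rewrite /t; ring.
  rewrite -[leRHS]mul1r ler_pM2r//; apply: le_trans theta_quad.
  by rewrite ler_wpM2l.
have r : m%:R * xi / n%:R <= a.
  have -> : m%:R * xi / n%:R = xi * (m%:R / n%:R) by ring.
  apply: le_trans xie; rewrite ler_pM2l// /e ler_pM2r ?invr_gt0//.
  have : m%:R <= m%:R * L by rewrite ler_peMr// (le_trans ler01 mR).
  by rewrite /x; move: kappa_gt0 mL mR; move: (m%:R * L) => ?; lra.
have Me : (M + 1) * eps <= (M + 1) * (4 * a) by rewrite ler_pM2l.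
have Se : S * eps <= 4 * a.
  apply: le_trans eps_le; rewrite ler_piMl ?sqrtr_ge0//.
have Md : (M + 1) * a <= (M + 1) * delta by rewrite ler_pM2l.
rewrite tE; move: xie q r Me Se Md a_gt0; rewrite /delta -/a.
have -> : 11 * xi * e = 11 * (xi * e) by ring.
have -> : 22 * xi * e = 22 * (xi * e) by ring.
have -> : 6 * (2 * xi) * e = 12 * (xi * e) by ring.
have -> : 3 * (2 * (M + 1)) * eps = 6 * ((M + 1) * eps) by ring.
have -> : 3 * S * eps = 3 * (S * eps) by ring.
have -> : (132 + 96 * (M + 1)) * (a + g) = 132 * (a + g) + 96 * ((M + 1) * (a + g)) by ring.
have -> : (M + 1) * (4 * a) = 4 * ((M + 1) * a) by ring.
move: ((M + 1) * (a + g)) ((M + 1) * a) ((M + 1) * eps) (S * eps) (xi * e) (m%:R * xi / n%:R)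
  (K * xi * M * t ^+ 2) => *.
move: g_ge0 delta_gt0; rewrite /delta -/a => *; lra.
Qed.

Lemma rem2_rate : M / fmin * (K * xi * M * t ^+ 2) <=
  bahadur_constant * rate2 n m xi g kappa.
Proof.
have -> : M / fmin * (K * xi * M * t ^+ 2) =
    M / fmin * (K * M * speed ^+ 2) * rate2 n m xi g kappa.
  by rewrite /rate2 -/delta /t; ring.
have r0 : 0 <= rate2 n m xi g kappa by rewrite mulr_ge0 ?sqr_ge0// ltW.
apply: (ler_wpM2r r0); apply: (ler_wpM2l (ltW Mf0)).
have := sqrtr_ge0 (8 * (K + 1) * M * speed); move: KMs_ge0.
by move: (Num.sqrt _) (K * M * speed ^+ 2) (K * M * speed) => *; lra.
Qed.

Lemma rem4_rate (c : R) : 0 <= c -> c <= 1 ->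
  M / fmin * (K * c * M * t) <= bahadur_constant * rate4 n m g c kappa.
Proof.
move=> c0 c1.
have r0 := mulr_ge0 c0 (ltW delta_gt0).
have -> : M / fmin * (K * c * M * t) = M / fmin * (K * M * speed) * (c * delta).
  by rewrite /t; ring.
apply: ler_pM => //.
- exact: mulr_ge0 (ltW Mf0) KMs_ge0.
- apply: (ler_wpM2l (ltW Mf0)).
  move: p2 (sqrtr_ge0 (8 * (K + 1) * M * speed)).
  move: (K * M * speed ^+ 2) (K * M * speed) (Num.sqrt _) => *; lra.
- by rewrite /rate4 /delta mulrDr lerD2l ler_piMl.
Qed.

(** [xi * a ^+ 2] is dominated because [xi * a <= 1] and [a <= delta]. *)
Lemma rem3_rate : M / fmin * D2 <= bahadur_constant * rate3 n m xi g kappa.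
Proof.
have rE : rate3 n m xi g kappa = Num.sqrt delta * (Num.sqrt xi * a).
  rewrite /rate3 [m%:R * L / n%:R]mulrAC -/delta; congr (_ * _).
  rewrite /a mulrDr -!sqrtrM ?(ltW xi_gt0)//; congr (Num.sqrt _ + Num.sqrt _); ring.
set r := rate3 _ _ _ _ _ in rE *.
have sx0 := sqrtr_ge0 xi; have sd0 := sqrtr_ge0 delta.
have r0 : 0 <= r by rewrite rE !mulr_ge0// ltW.
have b1 : S * eps <= 4 * (Num.sqrt (8 * (K + 1) * M * speed) * r).
  rewrite SE (sqrtrM delta (ltW xi_gt0)) rE.
  have -> : 4 * (Num.sqrt (8 * (K + 1) * M * speed) * (Num.sqrt delta * (Num.sqrt xi * a))) =
    Num.sqrt (8 * (K + 1) * M * speed) * (Num.sqrt xi * Num.sqrt delta) * (4 * a) by ring.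
  by rewrite ler_wpM2l// !mulr_ge0// sqrtr_ge0.
have b2 : xi * e <= 16 * r.
  have h : xi * e <= xi * (16 * a ^+ 2) by rewrite ler_pM2l.
  apply: (le_trans h).
  have -> : xi * (16 * a ^+ 2) = 16 * (xi * a * a) by ring.
  rewrite ler_pM2l// rE mulrA ler_pM2r//.
  rewrite -{1}(sqr_sqrtr (ltW xi_gt0)) expr2 -mulrA [leRHS]mulrC ler_wpM2l//.
  rewrite -[X in _ * X](sqr_sqrtr (ltW a_gt0)) expr2 mulrA -(sqrtrM _ (ltW xi_gt0)).
  apply: (@le_trans _ _ (1 * Num.sqrt a)); last by rewrite mul1r ler_wsqrtr.
  rewrite ler_wpM2r ?sqrtr_ge0// -[leRHS]sqrtr1 ler_wsqrtr//.
  apply: (le_trans xia); have := theta16; have := theta_gt0; lra.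
rewrite /bahadur_constant -[leRHS]mulrA; apply: (ler_wpM2l (ltW Mf0)).
have k0 := KMs_ge0.
apply: (@le_trans _ _ ((736 + 24 * Num.sqrt (8 * (K + 1) * M * speed)) * r)); last first.
  rewrite ler_wpM2r//; move: p2 k0.
  move: (K * M * speed ^+ 2) (K * M * speed) (Num.sqrt _) => *; lra.
have -> : 22 * xi * e = 22 * (xi * e) by ring.
have -> : 6 * (2 * xi) * e = 12 * (xi * e) by ring.
have -> : 3 * S * eps = 3 * (S * eps) by ring.
have -> : (736 + 24 * Num.sqrt (8 * (K + 1) * M * speed)) * r =
  736 * r + 24 * (Num.sqrt (8 * (K + 1) * M * speed) * r) by ring.
move: b1 b2; move: (S * eps) (Num.sqrt _ * r) (xi * e) => *; lra.
Qed.

Section mesh.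
Hypothesis dim_small : m%:R * xi ^+ 2 * L <= n%:R.
Hypotheses (n_large1 : 2 * M <= n%:R) (n_large2 : 2 * M * rho <= speed * n%:R).
Hypothesis n_large3 : (M + 1) * (K + 1) * rho < n%:R.
Hypothesis n_ge3 : (3 <= n)%N.
Local Notation N := (n ^ 3)%N.
Let h : R := ((K + 1) * n%:R)^-1.

Let m_le : m%:R <= M * n%:R.
Proof.
apply: (@le_trans _ _ (M * (m%:R * xi ^+ 2 * L))); last by rewrite ler_pM2l.
have -> : M * (m%:R * xi ^+ 2 * L) = m%:R * (M * xi ^+ 2 * L) by ring.
by rewrite ler_peMr ?(le_trans ler01 mR)// mulr_ege1.
Qed.

Let xim_le : xi * m%:R <= (M + 1) * n%:R.
Proof.
apply: (@le_trans _ _ ((M + 1) * (m%:R * xi ^+ 2 * L))); last by rewrite ler_pM2l.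
have -> : (M + 1) * (m%:R * xi ^+ 2 * L) = (M + 1) * xi ^+ 2 * L * m%:R by ring.
rewrite ler_pM2r ?(lt_le_trans ltr01 mR)//.
apply: (@le_trans _ _ ((M + 1) * xi ^+ 2)); last first.
  by rewrite ler_peMr// mulr_ge0 ?sqr_ge0 ?(ltW M1).
rewrite mulrDl mul1r; have := sqr_ge0 (xi - 1); rewrite sqrrB expr1n mulr1 -mulr_natr.
by move: xi_large xi_gt0; move: (M * xi ^+ 2) (xi ^+ 2) => *; lra.
Qed.

Let NE : N%:R = n%:R * n%:R * n%:R :> R.
Proof. by rewrite natrX exprSr expr2. Qed.

Let n1 : 1 <= n%:R :> R. Proof. by rewrite ler1n. Qed.
Let N0 : 0 < N%:R :> R. Proof. by rewrite NE !mulr_gt0. Qed.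

Lemma mesh_of_directions : m%:R * (1 / N%:R) <= 1 / 2 :> R.
Proof.
rewrite mul1r ler_pdivrMr// NE.
have : m%:R <= M * n%:R * n%:R by rewrite (le_trans m_le)// ler_peMr// mulr_ge0// ltW.
have : (2 * M) * (n%:R * n%:R) <= n%:R * (n%:R * n%:R).
  by rewrite ler_wpM2r// mulr_ge0// ltW.
have -> : (2 * M) * (n%:R * n%:R) = 2 * (M * n%:R * n%:R) :> R by ring.
by rewrite (mulrA n%:R); move: (M * n%:R * n%:R) (n%:R * n%:R * n%:R : R) => *; lra.
Qed.

Let delta_ge : 1 <= delta * n%:R.
Proof.
have : 1 <= a1 * n%:R.
  rewrite -(@ler_pXn2r _ 2)// ?nnegrE ?mulr_ge0 ?(ltW nR)//.
  rewrite expr1n exprMn a1_sqr expr2 mulrA divfK ?gt_eqF//.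
  exact: mulr_ege1.
move=> /le_trans; apply; rewrite ler_pM2r// /delta -addrA lerDl.
by rewrite addr_ge0// ltW.
Qed.

Lemma mesh_of_coefficients : 2 * (m%:R * (rho / N%:R)) <= t.
Proof.
have -> : 2 * (m%:R * (rho / N%:R)) = 2 * m%:R * rho / N%:R by ring.
rewrite ler_pdivrMr// NE /t.
have -> : speed * delta * (n%:R * n%:R * n%:R) = speed * n%:R * n%:R * (delta * n%:R) by ring.
have s0 := mulr_ge0 (mulr_ge0 (ltW speed_gt0) (ltW nR)) (ltW nR).
apply: (@le_trans _ _ (speed * n%:R * n%:R)); last by rewrite ler_peMr.
apply: (@le_trans _ _ (2 * M * rho * n%:R)); last by rewrite ler_pM2r.
have -> : 2 * M * rho * n%:R = 2 * (M * n%:R) * rho by ring.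
by rewrite ler_pM2r// ler_pM2l.
Qed.

Lemma band_covers_mesh : xi * (m%:R * (rho / N%:R)) < h.
Proof.
have -> : xi * (m%:R * (rho / N%:R)) = xi * m%:R * rho / N%:R by ring.
have Kn : 0 < (K + 1) * n%:R by rewrite mulr_gt0.
rewrite ltr_pdivrMr// /h ltr_pdivlMl// NE.
apply: (@le_lt_trans _ _ ((K + 1) * n%:R * ((M + 1) * n%:R * rho))).
  by rewrite ler_pM2l// ler_pM2r.
have -> : (K + 1) * n%:R * ((M + 1) * n%:R * rho) =
  (M + 1) * (K + 1) * rho * (n%:R * n%:R) by ring.
by rewrite -[ltRHS]mulrA ltr_pM2r// mulr_gt0.
Qed.

Lemma band_is_thin : 2 * K * h <= x / n%:R.
Proof.
rewrite /h invfM mulrA ler_pM2r ?invr_gt0// ler_pdivrMr//.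
have : K + 1 <= m%:R * L * (K + 1) by rewrite ler_peMl// ltW.
have -> : x * (K + 1) = kappa * (K + 1) + 16 * (m%:R * L * (K + 1)) by rewrite /x; ring.
move: K_ge0 (mulr_ge0 (ltW kappa_gt0) (ltW K1)).
by move: (kappa * (K + 1)) (m%:R * L * (K + 1)) => *; lra.
Qed.

(** [2 * n ^ 3 + 1 <= n ^ 4], so the number of bad events is at most
    [4 * expR (12 * m * ln n)]. *)
Lemma failure_probability : (4 * (((2 * N).+1 ^ m) ^ 3))%:R * expR (- x) <= 2 * expR (- kappa).
Proof.
have nL : expR L = n%:R by rewrite lnK// posrE.
have h1 : ((2 * N).+1 <= n ^ 4)%N.
  rewrite (expnSr n 3) (leq_trans _ (leq_mul (leqnn _) n_ge3))// mulnS addnC mulnC.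
  by rewrite -addn1 leq_add2l expn_gt0 n_gt0.
have h2 : (((2 * N).+1 ^ m) ^ 3)%:R <= expR (12 * (m%:R * L)).
  apply: (@le_trans _ _ ((n ^ (4 * m * 3))%:R)).
    by rewrite ler_nat !expnM leq_exp2r// leq_exp2r.
  rewrite natrX -[n%:R in leLHS]nL -expRM_natl ler_expR !natrM.
  by rewrite (_ : _ * _ = 12 * (m%:R * L)) ?lexx//; ring.
have h3 : 2 <= expR (4 * (m%:R * L)).
  by have := expR_ge1Dx (4 * (m%:R * L)); move: mL; lra.
rewrite natrM /x opprD expRD.
have e1 := expR_gt0 (- kappa); have e4 := expR_gt0 (4 * (m%:R * L)).
have h4 : expR (- (16 * (m%:R * L))) * expR (12 * (m%:R * L)) * expR (4 * (m%:R * L)) = 1.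
  by rewrite -!expRD (_ : _ + _ = 0) ?expR0//; ring.
have e16 := expR_gt0 (- (16 * (m%:R * L))).
rewrite mulrCA [leRHS]mulrC ler_pM2l// -mulrA -ler_pdivlMl//.
apply: (@le_trans _ _ (expR (12 * (m%:R * L)) * expR (- (16 * (m%:R * L))))).
  by rewrite ler_pM2r.
rewrite [leLHS]mulrC; move: h4 h3 e4; move: (_ * expR (12 * _)) (expR (4 * _)) => u v.
by move=> uv v2 v0; nra.
Qed.

End mesh.

End one_row.

End parameters.

(** * Population quantities of one row *)

Section population.
Context {R : realType} {n : nat}.
Variables (D : qr_row R n) (xi M K fmin tl tu : R).
Hypothesis n_gt0 : (0 < n)%N.
Hypothesis Zs_bound : forall i : 'I_n, {ae Pr D, forall w, enorm (Zs (D := D) i w) <= xi}.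
Hypothesis M_gt0 : 0 < M.
Hypothesis gram_min : 1 / M <= lambda_min (gram D).
Hypothesis gram_max : lambda_max (gram D) <= M.
Hypothesis smooth : forall x, calX D x -> forall y : R,
  derivable (condF (D := D) x) y 1 /\ derivable (condf (D := D) x) y 1.
Hypothesis dens_bound : forall x, calX D x -> forall y : R,
  `|condf (D := D) x y| <= K /\ `|derive1 (condf (D := D) x) y| <= K.
Hypotheses (tl0 : 0 < tl) (tltu : tl <= tu) (tu1 : tu < 1) (fmin0 : 0 < fmin).
Hypothesis dens_min : forall tau, `[tl, tu]%classic tau ->
  forall x, calX D x -> fmin <= condf (D := D) x (condQ (D := D) x tau).

Local Notation P := (Pr D).
Local Notation RX := (Rd R (dimX D)).
Local Notation MR := (measurableTypeR R).
Local Notation m := (dimZ D).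
Local Notation Ex f := (Rintegral P setT f).
Local Notation F := (condF (D := D)).
Local Notation f := (condf (D := D)).
Local Notation Q := (condQ (D := D)).

Let mX : measurable_fun setT (X D : Omega D -> RX).
Proof. exact: measurable_funPT. Qed.

Let mY : measurable_fun setT (Y D : Omega D -> MR).
Proof. exact: measurable_funPT. Qed.

Lemma ex_ae (g h : Omega D -> R) : measurable_fun setT g -> measurable_fun setT h ->
  {ae P, forall w, g w = h w} -> Ex g = Ex h.
Proof.
move=> mg mh gh; rewrite /Rintegral; congr fine; apply: ae_eq_integral => //.
- exact/measurable_EFinP.
- exact/measurable_EFinP.
- by apply: filterS gh => w gw _; rewrite gw.
Qed.

Lemma measurable_dotZ (b : 'cV[R]_m) :
  measurable_fun setT (fun x : RX => dotv b (Z D x) : MR).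
Proof.
under eq_fun do rewrite dotvE.
apply: measurable_sum => j; apply: measurable_funM => //; exact: Z_meas.
Qed.

Lemma measurable_enormZ : measurable_fun setT (fun x : RX => enorm (Z D x) : MR).
Proof.
apply: (@measurableT_comp _ _ _ _ _ _ (@Num.sqrt R)); last first.
  by apply: measurable_sum => j; apply: measurable_funX; exact: Z_meas.
by apply: continuous_measurable_fun => x; exact: sqrt_continuous.
Qed.

(** The bound of the regressor holds almost surely only; truncation makes it a
    bounded function of [x] and leaves every expectation unchanged. *)
Definition ztr (x : RX) : 'cV[R]_m := if enorm (Z D x) <= xi then Z D x else 0.

(** The bound is assumed for the sample, whose law is that of [X]. *)
Lemma ZX_ae : {ae P, forall w, enorm (ZX (D := D) w) <= xi}.
Proof.
pose i0 := Ordinal n_gt0.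
have mB : measurable [set x : RX | enorm (Z D x) <= xi].
  have := measurable_fun_ler measurable_enormZ (measurable_cst (xi : MR)).
  by move=> /(_ measurableT [set true]); rewrite setTI; apply.
pose B : set (RX * MR) := [set p | enorm (Z D p.1) <= xi].
have mB2 : measurable B.
  by have := (@measurable_fst _ _ RX MR) measurableT _ mB; rewrite setTI.
have mBX : measurable [set w | enorm (Z D (X D w)) <= xi].
  by have := mX measurableT mB; rewrite setTI.
have mBXi : measurable [set w | enorm (Z D (Xs D i0 w)) <= xi].
  by have := measurable_funPT (Xs D i0) measurableT _ mB; rewrite setTI.
have := XYs_law (q := D) i0 mB2.
rewrite (_ : _ @^-1` _ = [set w | enorm (Z D (Xs D i0 w)) <= xi])//.
rewrite (_ : (fun w => (X D w, Y D w)) @^-1` _ = [set w | enorm (Z D (X D w)) <= xi])//.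
have aeC (A : set (Omega D)) : measurable A -> ({ae P, forall w, A w} <-> P A = 1%E).
  move=> mA; split=> [[N [mN N0 AN]]|PA].
    have : P (~` A) = 0%E.
      apply/eqP; rewrite eq_le measure_ge0 andbT -N0 le_measure ?inE//.
      exact: measurableC.
    rewrite probability_setC// => h.
    have := @fin_num_measure _ _ _ P _ mA.
    case: (P A) h => //= r [h] _; congr EFin; lra.
  exists (~` A); split => //; first exact: measurableC.
  by rewrite probability_setC// PA subee.
move=> h; apply/(aeC _ mBX); rewrite -h; apply/aeC => //.
exact: (Zs_bound i0).
Qed.

Lemma ztr_ae : {ae P, forall w, ztr (X D w) = ZX (D := D) w}.
Proof. by apply: filterS ZX_ae => w; rewrite /ztr /ZX => ->. Qed.

Lemma ae_exists (A : set (Omega D)) : {ae P, forall w, A w} -> exists w, A w.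
Proof.
move=> [N [mN N0 HN]]; apply: contrapT => noA; have NT : N = setT.
  by apply/seteqP; split => w // _; apply: HN => Aw; apply: noA; exists w.
have : P setT = 0%E by rewrite -NT.
by rewrite probability_setT => /eqP; rewrite onee_eq0.
Qed.

Lemma xi_ge0 : 0 <= xi.
Proof.
have [w] := ae_exists ZX_ae; apply: le_trans; exact: enorm_ge0.
Qed.

Lemma K_ge0 : 0 <= K.
Proof.
have [w _] := ae_exists ZX_ae; exact: (dens_bound_ge0 dens_bound (X_in (q := D) w)).
Qed.

Lemma enorm_ztr x : enorm (ztr x) <= xi.
Proof. by rewrite /ztr; case: ifPn => // _; rewrite enorm0 xi_ge0. Qed.

Lemma dotv_ztr_le u x : `|dotv u (ztr x)| <= enorm u * xi.
Proof.
by rewrite (le_trans (normr_dotv_le _ _))// ler_wpM2l ?enorm_ge0// enorm_ztr.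
Qed.

Lemma measurable_dotz (b : 'cV[R]_m) :
  measurable_fun setT (fun x : RX => dotv b (ztr x) : MR).
Proof.
rewrite (_ : (fun _ => _) = fun x : RX => if enorm (Z D x) <= xi then dotv b (Z D x) else 0 : MR).
  apply: measurable_fun_ifT => //; last exact: measurable_dotZ.
  by apply: measurable_fun_ler => //; exact: measurable_enormZ.
by apply/funext => x; rewrite /ztr; case: ifP => // _; rewrite dotv0r.
Qed.

Lemma bmf_dotz u : bmf (fun x : RX => dotv u (ztr x)).
Proof.
split; first exact: measurable_dotz.
by exists (enorm u * xi) => x; exact: dotv_ztr_le.
Qed.

Lemma bmf_dotzX u : bmf (fun w => dotv u (ztr (X D w))).
Proof. exact: (bmf_comp mX (bmf_dotz u)). Qed.

Lemma dotv_expect_cv u (V : Omega D -> 'cV[R]_m) :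
  (forall j, bmf (fun w => V w j 0)) ->
  dotv u (expect_cv P V) = Ex (fun w => dotv u (V w)).
Proof.
move=> bV; rewrite dotvE.
under [in RHS]eq_Rintegral do rewrite dotvE.
rewrite ex_sum => [|j]; last exact: bmfZ.
by apply: eq_bigr => j _; rewrite exZ// mxE unlock.
Qed.

Lemma dotv_expect_mx u v (A : Omega D -> 'M[R]_m) :
  (forall i j, bmf (fun w => A w i j)) ->
  dotv u (expect_mx P A *m v) = Ex (fun w => dotv u (A w *m v)).
Proof.
move=> bA; have bAv i : bmf (fun w => (A w *m v) i 0).
  under eq_fun do rewrite mxE; apply: bmf_sum => j.
  by apply: bmfM => //; exact: bmf_cst.
rewrite -dotv_expect_cv//; congr dotv; apply/colP => i.
rewrite mxE [RHS]mxE (_ : fine _ = Ex (fun w => \sum_j A w i j * v j 0)); last first.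
  by rewrite unlock; apply: eq_Rintegral => w _; rewrite mxE.
rewrite ex_sum; last by move=> j; apply: bmfM => //; exact: bmf_cst.
apply: eq_bigr => j _; rewrite mxE unlock mulrC -[fine _]/(Ex _) -exZ//.
by apply: eq_Rintegral => w _; rewrite mulrC.
Qed.

Lemma expect_mx_ztr (a : Omega D -> R) : bmf a ->
  expect_mx P (fun w => a w *: (ZX (D := D) w *m (ZX w)^T)) =
  expect_mx P (fun w => a w *: (ztr (X D w) *m (ztr (X D w))^T)).
Proof.
move=> [ma _]; apply/matrixP => i j; rewrite !mxE unlock; apply: ex_ae.
- under eq_fun do rewrite !mxE big_ord1 !mxE.
  apply: measurable_funM => //.
  by apply: measurable_funM; exact: (measurableT_comp (Z_meas _) mX).
- have mz k : measurable_fun setT (fun w => ztr (X D w) k 0 : MR).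
    have [+ _] := bmf_dotzX (delta_mx k 0); apply: eq_measurable_fun => w _.
    rewrite dotvE (bigD1 k)//= mxE !eqxx mul1r big1 ?addr0// => l lk.
    by rewrite mxE (negbTE lk) mul0r.
  under eq_fun do rewrite !mxE big_ord1 !mxE.
  apply: measurable_funM; first exact: ma.
  by apply: measurable_funM; exact: mz.
- by apply: filterS ztr_ae => w ->.
Qed.

Lemma quad_ztr (a : Omega D -> R) u v : bmf a ->
  dotv u (expect_mx P (fun w => a w *: (ZX (D := D) w *m (ZX w)^T)) *m v) =
  Ex (fun w => a w * (dotv u (ztr (X D w)) * dotv v (ztr (X D w)))).
Proof.
move=> ba; rewrite expect_mx_ztr// dotv_expect_mx.
  apply: eq_Rintegral => w _; rewrite -scalemxAl dotvZr -mulmxA.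
  rewrite (_ : (ztr (X D w))^T *m v = (dotv v (ztr (X D w)))%:M).
    by rewrite mul_mx_scalar dotvZr; congr (_ * _); rewrite mulrC.
  by apply/matrixP => i j; rewrite !ord1 [RHS]mxE eqxx mulr1n dotvC.
move=> i j; under eq_fun do rewrite !mxE big_ord1 !mxE.
have bz k : bmf (fun w => ztr (X D w) k 0).
  have := bmf_dotzX (delta_mx k 0); congr bmf; apply/funext => w.
  rewrite dotvE (bigD1 k)//= mxE !eqxx mul1r big1 ?addr0// => l lk.
  by rewrite mxE (negbTE lk) mul0r.
by apply: bmfM => //; exact: bmfM.
Qed.

Local Notation EZZ a :=
  (expect_mx P (fun w => a w *: (ZX (D := D) w *m (ZX w)^T))).

Lemma expect_mx_sym (a : Omega D -> R) : (EZZ a)^T = EZZ a.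
Proof.
apply/matrixP => i j; rewrite mxE [LHS]mxE [RHS]mxE; congr (fine _).
by congr expectation; apply/funext => w; rewrite !mxE !big_ord1 !mxE (mulrC (Z D _ j 0)).
Qed.

Lemma gramE : gram D = EZZ (fun=> 1).
Proof.
by rewrite /gram; congr expect_mx; apply/funext => w; rewrite scale1r.
Qed.

(** In dimension [0] the smallest eigenvalue is [0]. *)
Lemma dimZ_gt0 : (0 < m)%N.
Proof.
rewrite lt0n; apply/negP => /eqP m0; move: gram_min; rewrite /lambda_min.
rewrite (_ : [set a | _] = set0).
  by rewrite inf0 leNgt divr_gt0.
apply/seteqP; split => a //= /eigenvalueP[v _] /eqP; apply; apply/rowP => j.
by have := ltn_ord j; rewrite {2}m0.
Qed.

Lemma gram_quad u v :
  dotv u (gram D *m v) = Ex (fun w => dotv u (ztr (X D w)) * dotv v (ztr (X D w))).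
Proof.
rewrite gramE quad_ztr; last exact: bmf_cst.
by apply: eq_Rintegral => w _; rewrite mul1r.
Qed.

Lemma bmf_dotz2 u v : bmf (fun w => dotv u (ztr (X D w)) * dotv v (ztr (X D w))).
Proof. by apply: bmfM; exact: bmf_dotzX. Qed.

Lemma bmf_sqr_dotz u : bmf (fun w => dotv u (ztr (X D w)) ^+ 2).
Proof. by under eq_fun do rewrite expr2; exact: bmf_dotz2. Qed.

Lemma ex_sqr_dotz u : Ex (fun w => dotv u (ztr (X D w)) ^+ 2) = dotv u (gram D *m u).
Proof. by rewrite gram_quad; apply: eq_Rintegral => w _; rewrite expr2. Qed.

Lemma ex_sqr_ge u : enorm u ^+ 2 / M <= Ex (fun w => dotv u (ztr (X D w)) ^+ 2).
Proof.
rewrite ex_sqr_dotz; have gs : (gram D)^T = gram D by rewrite gramE expect_mx_sym.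
apply: le_trans (lambda_min_quad u dimZ_gt0 gs).
by rewrite mulrC -div1r ler_wpM2r// sqr_ge0.
Qed.

Lemma ex_sqr_le u : Ex (fun w => dotv u (ztr (X D w)) ^+ 2) <= M * enorm u ^+ 2.
Proof.
rewrite ex_sqr_dotz; have gs : (gram D)^T = gram D by rewrite gramE expect_mx_sym.
apply: (le_trans (lambda_max_quad u dimZ_gt0 gs)).
by rewrite ler_wpM2r// sqr_ge0.
Qed.

(** Young's inequality for [u] and [v] rescaled to the same length. *)
Lemma ex_norm_dotz2 u v :
  Ex (fun w => `|dotv u (ztr (X D w)) * dotv v (ztr (X D w))|) <=
    M * (enorm u * enorm v).
Proof.
have [->|u0] := eqVneq u 0.
  rewrite enorm0 mul0r mulr0 le_eqVlt; apply/orP; left; apply/eqP.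
  rewrite -[RHS](ex_cst P); apply: eq_Rintegral => w _.
  by rewrite dotvC dotv0r mul0r normr0.
have [->|v0] := eqVneq v 0.
  rewrite enorm0 !mulr0 le_eqVlt; apply/orP; left; apply/eqP.
  rewrite -[RHS](ex_cst P); apply: eq_Rintegral => w _.
  by rewrite (dotvC 0) dotv0r mulr0 normr0.
have eu : 0 < enorm u.
  by rewrite lt_neqAle enorm_ge0 eq_sym andbT; apply: contra u0 => /eqP/enorm_eq0/eqP.
have ev : 0 < enorm v.
  by rewrite lt_neqAle enorm_ge0 eq_sym andbT; apply: contra v0 => /eqP/enorm_eq0/eqP.
set s := enorm v / enorm u; have s0 : 0 < s by rewrite divr_gt0.
apply: (@le_trans _ _ (Ex (fun w => s / 2 * dotv u (ztr (X D w)) ^+ 2 +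
    s^-1 / 2 * dotv v (ztr (X D w)) ^+ 2))).
  apply: ler_ex => [||w].
  - by apply: bmf_norm; exact: bmf_dotz2.
  - by apply: bmfD; apply: bmfZ; exact: bmf_sqr_dotz.
  set a := dotv u _; set b := dotv v _.
  have h1 : 0 <= s / 2 * (a - b / s) ^+ 2 by rewrite mulr_ge0 ?sqr_ge0// divr_ge0// ltW.
  have h2 : 0 <= s / 2 * (a + b / s) ^+ 2 by rewrite mulr_ge0 ?sqr_ge0// divr_ge0// ltW.
  have e1 : s / 2 * (a - b / s) ^+ 2 = s / 2 * a ^+ 2 + s^-1 / 2 * b ^+ 2 - a * b.
    by field; rewrite gt_eqF.
  have e2 : s / 2 * (a + b / s) ^+ 2 = s / 2 * a ^+ 2 + s^-1 / 2 * b ^+ 2 + a * b.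
    by field; rewrite gt_eqF.
  by rewrite ler_norml; apply/andP; split; lra.
rewrite exD ?exZ; try by [exact: bmf_sqr_dotz|apply: bmfZ; exact: bmf_sqr_dotz].
apply: (@le_trans _ _ (s / 2 * (M * enorm u ^+ 2) + s^-1 / 2 * (M * enorm v ^+ 2))).
  by rewrite lerD// ler_wpM2l ?ex_sqr_le// divr_ge0// ?invr_ge0 ltW.
rewrite le_eqVlt; apply/orP; left; apply/eqP; rewrite /s; field.
by rewrite !gt_eqF.
Qed.

(** The derivative of the mean score at [b]; it is [Jm] when the conditional
    quantile is linear in [Z] with coefficient [b]. *)
Definition density_gram (b : 'cV[R]_m) : 'M[R]_m := EZZ (fun w => f (X D w) (dotv b (ztr (X D w)))).

Lemma bmf_fb b : bmf (fun w => f (X D w) (dotv b (ztr (X D w)))).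
Proof.
apply: (bmf_condf smooth dens_bound (b := fun x => dotv b (ztr x))).
exact: measurable_dotz.
Qed.

Lemma tau_in tau : `[tl, tu]%classic tau -> [/\ tl <= tau, tau <= tu, 0 < tau & tau < 1].
Proof.
rewrite /= in_itv/= => /andP[h1 h2]; split => //.
  exact: lt_le_trans tl0 h1.
exact: le_lt_trans h2 tu1.
Qed.

Lemma bmf_fQ tau : `[tl, tu]%classic tau -> bmf (fun w => f (X D w) (Q (X D w) tau)).
Proof.
move=> /tau_in[_ _ t0 t1].
apply: (bmf_condf smooth dens_bound (b := fun x => Q x tau)).
exact: measurable_condQ.
Qed.

Lemma Jm_quad tau u v : `[tl, tu]%classic tau -> dotv u (Jm D tau *m v) =
  Ex (fun w => f (X D w) (Q (X D w) tau) *
    (dotv u (ztr (X D w)) * dotv v (ztr (X D w)))).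
Proof. by move=> Tt; rewrite /Jm quad_ztr; last exact: bmf_fQ. Qed.

Lemma density_gram_quad b u v : dotv u (density_gram b *m v) =
  Ex (fun w => f (X D w) (dotv b (ztr (X D w))) *
    (dotv u (ztr (X D w)) * dotv v (ztr (X D w)))).
Proof. by rewrite /density_gram quad_ztr; last exact: bmf_fb. Qed.

Lemma Jm_quad_ge tau v : `[tl, tu]%classic tau ->
  fmin / M * enorm v ^+ 2 <= dotv v (Jm D tau *m v).
Proof.
move=> Tt; rewrite Jm_quad//.
apply: (@le_trans _ _ (Ex (fun w => fmin * dotv v (ztr (X D w)) ^+ 2))).
  rewrite exZ; last exact: bmf_sqr_dotz.
  by rewrite -mulrA ler_wpM2l ?(ltW fmin0)// mulrC ex_sqr_ge.
apply: ler_ex => [||w].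
- by apply: bmfZ; exact: bmf_sqr_dotz.
- by apply: bmfM; [exact: bmf_fQ|exact: bmf_dotz2].
rewrite -expr2 ler_wpM2r ?sqr_ge0//; apply: dens_min => //; exact: X_in.
Qed.

Lemma Jm_sym tau : (Jm D tau)^T = Jm D tau.
Proof. exact: expect_mx_sym. Qed.

Lemma lambda_min_Jm_ge tau : `[tl, tu]%classic tau -> fmin / M <= lambda_min (Jm D tau).
Proof.
move=> Tt; apply: lambda_min_ge; [exact: dimZ_gt0|exact: Jm_sym|move=> v].
exact: Jm_quad_ge.
Qed.

Section approximation.
Variables (c tau : R) (b : 'cV[R]_m).
Hypothesis T_tau : `[tl, tu]%classic tau.
Hypothesis c_bound : forall x, calX D x -> `|Q x tau - dotv (Z D x) b| <= c.

(* [c_bound] concerns the regressor before truncation; where the truncation is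
   active the factor [dotv v (ztr _)] vanishes *)
Let fdiff w v : `|f (X D w) (Q (X D w) tau) - f (X D w) (dotv b (ztr (X D w)))| *
    `|dotv v (ztr (X D w))| <= K * c * `|dotv v (ztr (X D w))|.
Proof.
rewrite /ztr; case: ifPn => _; last by rewrite !dotv0r normr0 !mulr0.
rewrite ler_wpM2r// (le_trans (condf_lip smooth dens_bound _ _ (X_in (q := D) w)))//.
rewrite ler_wpM2l ?K_ge0// dotvC; apply: c_bound; exact: X_in.
Qed.

Lemma Jm_density_gram_close u v :
  `|dotv u (Jm D tau *m v) - dotv u (density_gram b *m v)| <= K * c * M * (enorm u * enorm v).
Proof.
have bQ := bmf_fQ T_tau; have bb := bmf_fb b; have buv := bmf_dotz2 u v.
rewrite [X in `|X - _|](Jm_quad u v T_tau) [X in `|_ - X|](density_gram_quad b u v).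
have b1 := bmfM bQ buv.
have b2 := bmfM bb buv.
rewrite -exB //.
rewrite (le_trans (ler_norm_ex _ _))//; first by apply: bmfB; exact: bmfM.
apply: (@le_trans _ _ (Ex (fun w => K * c *
    `|dotv u (ztr (X D w)) * dotv v (ztr (X D w))|))).
  apply: ler_ex => [||w].
  - by apply: bmf_norm; apply: bmfB; exact: bmfM.
  - by apply: bmfZ; exact: bmf_norm.
  rewrite -mulrBl normrM [in leLHS]normrM [in leRHS]normrM !mulrA.
  rewrite -[leLHS]mulrAC -[leRHS]mulrAC; exact: ler_wpM2r.
rewrite exZ; last exact: bmf_norm.
have c0 : 0 <= c.
  by have [w _] := ae_exists ZX_ae; exact: le_trans (c_bound (X_in (q := D) w)).
by rewrite -[leRHS]mulrA ler_wpM2l ?mulr_ge0 ?K_ge0// ex_norm_dotz2.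
Qed.

End approximation.

Definition mean_score (b : 'cV[R]_m) : 'cV[R]_m :=
  expect_cv P (fun w => (Y D w <= dotv b (ztr (X D w)))%R%:R *: ztr (X D w)).

Definition mean_regressor : 'cV[R]_m := expect_cv P (fun w => ztr (X D w)).

Lemma ztr_entry x j : ztr x j 0 = dotv (delta_mx j 0) (ztr x).
Proof.
rewrite dotvE (bigD1 j)//= mxE !eqxx mul1r big1 ?addr0// => l lj.
by rewrite mxE (negbTE lj) mul0r.
Qed.

Lemma bmf_Yle (b : RX -> R) : measurable_fun setT (b : RX -> MR) ->
  bmf (fun w => (Y D w <= b (X D w))%R%:R : R).
Proof. by move=> mb; apply: bmf_bool; exact: measurable_YleX. Qed.

Lemma bmf_FX (p : RX -> R) : measurable_fun setT (p : RX -> MR) ->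
  bmf (fun w => F (X D w) (p (X D w))).
Proof. by move=> mp; exact: (bmf_comp mX (bmf_condF mp)). Qed.

Lemma dotv_mean_score u b : dotv u (mean_score b) =
  Ex (fun w => dotv u (ztr (X D w)) * F (X D w) (dotv b (ztr (X D w)))).
Proof.
have bY := bmf_Yle (measurable_dotz b).
rewrite dotv_expect_cv; last first.
  move=> j; under eq_fun do rewrite mxE ztr_entry; apply: bmfM => //; exact: bmf_dotzX.
rewrite -(ex_cond (bmf_dotz u) (measurable_dotz b)).
by apply: eq_Rintegral => w _; rewrite dotvZr mulrC.
Qed.

Lemma dotv_mean_regressor u : dotv u mean_regressor = Ex (fun w => dotv u (ztr (X D w))).
Proof.
rewrite dotv_expect_cv// => j; under eq_fun do rewrite ztr_entry; exact: bmf_dotzX.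
Qed.

(** The left-hand side is the vector in [g_err]. *)
Lemma expect_score b tau :
  expect_cv P (fun w => (F (X D w) (dotv (ZX w) b) - tau) *: ZX (D := D) w) =
  mean_score b - tau *: mean_regressor.
Proof.
have bF := bmf_FX (measurable_dotz b).
apply/colP => j; rewrite mxE unlock.
transitivity (Ex (fun w => (F (X D w) (dotv b (ztr (X D w))) - tau) *
    dotv (delta_mx j 0) (ztr (X D w)))).
  apply: ex_ae.
  - under eq_fun do rewrite mxE dotvC; apply: measurable_funM; last first.
      exact: (measurableT_comp (Z_meas j) mX).
    apply: measurable_funB => //.
    exact: (measurableT_comp (measurable_condF (measurable_dotZ b)) mX).
  - have [] // : bmf (fun w => (F (X D w) (dotv b (ztr (X D w))) - tau) *
      dotv (delta_mx j 0) (ztr (X D w))).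
    by apply: bmfM; [apply: bmfB => //; exact: bmf_cst|exact: bmf_dotzX].
  - by apply: filterS ztr_ae => w zw; rewrite mxE -ztr_entry zw dotvC.
have -> : (mean_score b - tau *: mean_regressor) j 0 =
    dotv (delta_mx j 0) (mean_score b - tau *: mean_regressor).
  rewrite dotvE (bigD1 j)//= [delta_mx _ _ _ _]mxE !eqxx mul1r big1 ?addr0// => l lj.
  by rewrite [delta_mx _ _ _ _]mxE (negbTE lj) mul0r.
rewrite dotvBr dotvZr dotv_mean_score dotv_mean_regressor -exZ; last exact: bmf_dotzX.
have bz := bmf_dotzX (delta_mx j 0).
rewrite -exB; [|exact: bmfM|exact: bmfZ].
by apply: eq_Rintegral => w _; rewrite mulrBl mulrC.
Qed.

Lemma mean_score_taylor u b1 b2 :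
  `|dotv u (mean_score b2 - mean_score b1 - density_gram b1 *m (b2 - b1))| <=
    K * xi * M * enorm u * enorm (b2 - b1) ^+ 2.
Proof.
have bF b : bmf (fun w => F (X D w) (dotv b (ztr (X D w)))).
  exact: (bmf_FX (measurable_dotz b)).
have bu := bmf_dotzX u; have bf := bmf_fb b1; have b2u := bmf_dotz2 u (b2 - b1).
have e := density_gram_quad b1 u (b2 - b1).
have h1 := bmfM bu (bF b2); have h2 := bmfM bu (bF b1); have h3 := bmfM bf b2u.
rewrite !dotvBr e !dotv_mean_score -exB// -exB//; last exact: bmfB.
have h4 := bmfB (bmfB h1 h2) h3.
rewrite (le_trans (ler_norm_ex _ _))//.
have hq := bmf_sqr_dotz (b2 - b1).
apply: (@le_trans _ _ (Ex (fun w => (K * xi * enorm u) *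
    dotv (b2 - b1) (ztr (X D w)) ^+ 2))); last first.
  rewrite exZ// (le_trans (ler_wpM2l _ (ex_sqr_le _)))//.
    by rewrite !mulr_ge0 ?K_ge0 ?xi_ge0 ?enorm_ge0.
  by rewrite le_eqVlt; apply/orP; left; apply/eqP; ring.
apply: ler_ex => [||w]; [exact: bmf_norm|exact: bmfZ|].
have := condF_taylor smooth dens_bound (dotv b1 (ztr (X D w)))
  (dotv b2 (ztr (X D w))) (X_in (q := D) w).
rewrite -dotvBl => ht; have hz := dotv_ztr_le u (X D w).
set a := dotv u _ in hz *; set p := F _ _ - F _ _ - _ in ht.
rewrite (_ : a * _ - _ - _ = a * p); last by rewrite /p; ring.
rewrite normrM (le_trans (ler_pM _ _ hz ht))//.
by rewrite le_eqVlt; apply/orP; left; apply/eqP; ring.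
Qed.

(** The conditional mass of a band is at most [K] times its width. *)
Lemma ex_band (a p q : RX -> R) : bmf a -> (forall x, 0 <= a x) ->
  measurable_fun setT (p : RX -> MR) -> measurable_fun setT (q : RX -> MR) ->
  (forall x, p x <= q x) -> bmf (fun x => q x - p x) ->
  Ex (fun w => a (X D w) * ((Y D w <= q (X D w))%R%:R - (Y D w <= p (X D w))%R%:R)) <=
  K * Ex (fun w => a (X D w) * (q (X D w) - p (X D w))).
Proof.
move=> ba a0 mp mq pq bpq.
have baX := bmf_comp mX ba.
have bpqX : bmf (fun w => q (X D w) - p (X D w)) := bmf_comp mX bpq.
have bp := bmf_FX mp; have bq := bmf_FX mq.
under eq_Rintegral do rewrite mulrBr.
rewrite exB; [|by apply: bmfM => //; exact: bmf_Yle|by apply: bmfM => //; exact: bmf_Yle].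
have hq := bmfM baX bq; have hp := bmfM baX bp; have hpq := bmfM baX bpqX.
rewrite !ex_cond// -exB// -exZ//; apply: ler_ex => [||w]; [exact: bmfB|exact: bmfZ|].
rewrite -mulrBr mulrCA ler_wpM2l//.
have := condF_lip smooth dens_bound (p (X D w)) (q (X D w)) (X_in (q := D) w).
rewrite (ger0_norm (_ : 0 <= q _ - p _)) ?subr_ge0//.
exact: le_trans (ler_norm _).
Qed.

Lemma ex_band_cst (p : RX -> R) h : 0 <= h -> measurable_fun setT (p : RX -> MR) ->
  Ex (fun w => (Y D w <= p (X D w) + h)%R%:R - (Y D w <= p (X D w) - h)%R%:R) <=
  2 * K * h.
Proof.
move=> h0 mp.
have := @ex_band (fun=> 1) (fun x => p x - h) (fun x => p x + h).
under eq_Rintegral do rewrite mul1r.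
have width x : p x + h - (p x - h) = 2 * h by ring.
under [X in _ <= _ * X]eq_Rintegral do rewrite mul1r width.
rewrite ex_cst mulrCA mulrA; apply.
- exact: bmf_cst.
- by [].
- exact: measurable_funB.
- exact: measurable_funD.
- by move=> x; lra.
- by under eq_fun do rewrite width; exact: bmf_cst.
Qed.

Lemma sqr_diff_indicator (y p q : R) :
  ((y <= p)%R%:R - (y <= q)%R%:R) ^+ 2 =
  (y <= Num.max p q)%R%:R - (y <= Num.min p q)%R%:R :> R.
Proof.
rewrite le_max le_min; case: (y <= p); case: (y <= q) => /=; ring.
Qed.

(** The square of the difference of the indicators is the indicator of a band of
    width [|dotv (b1 - b2) Z|], which is at most [xi * enorm (b1 - b2)]. *)
Lemma ex_score_var u b1 b2 :
  Ex (fun w => (dotv u (ztr (X D w)) * ((Y D w <= dotv b1 (ztr (X D w)))%R%:R -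
     (Y D w <= dotv b2 (ztr (X D w)))%R%:R)) ^+ 2) <=
  K * xi * M * enorm (b1 - b2) * enorm u ^+ 2.
Proof.
under eq_Rintegral do rewrite exprMn sqr_diff_indicator.
have ba : bmf (fun x => dotv u (ztr x) ^+ 2).
  by under eq_fun do rewrite expr2; apply: bmfM; exact: bmf_dotz.
pose p x := Num.min (dotv b1 (ztr x)) (dotv b2 (ztr x)).
pose q x := Num.max (dotv b1 (ztr x)) (dotv b2 (ztr x)).
have qpE x : q x - p x = `|dotv (b1 - b2) (ztr x)|.
  rewrite dotvBl /q /p; case: leP => h; last by rewrite gtr0_norm ?subr_gt0.
  by rewrite ler0_norm ?subr_le0// opprB.
have mp : measurable_fun setT (p : RX -> MR).
  by apply: measurable_minr; exact: measurable_dotz.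
have mq : measurable_fun setT (q : RX -> MR).
  by apply: measurable_maxr; exact: measurable_dotz.
have bqp : bmf (fun x => q x - p x).
  by under eq_fun do rewrite qpE; apply: bmf_norm; exact: bmf_dotz.
have pq x : p x <= q x by rewrite -subr_ge0 qpE.
apply: (le_trans (ex_band ba (fun x => sqr_ge0 _) mp mq pq bqp)).
rewrite -!mulrA ler_wpM2l ?K_ge0//.
have bu := bmf_sqr_dotz u.
apply: (@le_trans _ _ (Ex (fun w => (enorm (b1 - b2) * xi) * dotv u (ztr (X D w)) ^+ 2))).
  apply: ler_ex => [||w]; last first.
  - by rewrite mulrC qpE ler_wpM2r ?sqr_ge0// dotv_ztr_le.
  - exact: bmfZ.
  - by apply: (bmfM bu); exact: (bmf_comp mX bqp).
rewrite exZ// (le_trans (ler_wpM2l _ (ex_sqr_le _)))//.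
  by rewrite mulr_ge0 ?xi_ge0 ?enorm_ge0.
by rewrite le_eqVlt; apply/orP; left; apply/eqP; ring.
Qed.

(** ** Exact fits *)

Definition obs (i : 'I_n) (w : Omega D) : RX * MR := (Xs D i w, Ys D i w).

Lemma measurable_obs i : measurable_fun setT (obs i).
Proof. by apply: measurable_fun_pair; exact: measurable_funPT. Qed.

Lemma measurable_pop : measurable_fun setT (fun w => (X D w, Y D w) : RX * MR).
Proof. by apply: measurable_fun_pair; exact: measurable_funPT. Qed.

Definition in_band (b : 'cV[R]_m) (h : R) (s : RX * MR) : bool :=
  (s.2 <= dotv b (ztr s.1) + h)%R && ~~ (s.2 <= dotv b (ztr s.1) - h)%R.

Lemma in_bandE b h s : 0 <= h -> (in_band b h s)%:R =
  (s.2 <= dotv b (ztr s.1) + h)%R%:R - (s.2 <= dotv b (ztr s.1) - h)%R%:R :> R.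
Proof.
rewrite /in_band => h0; case: (leP s.2 (dotv b (ztr s.1) - h)) => h1 /=.
  have -> : (s.2 <= dotv b (ztr s.1) + h)%R by rewrite (le_trans h1)// lerD2l; lra.
  by rewrite subrr.
by rewrite andbT subr0.
Qed.

Lemma measurable_leband b h :
  measurable_fun setT (fun s : RX * MR => (s.2 <= dotv b (ztr s.1) + h)%R).
Proof.
apply: measurable_fun_ler; first exact: measurable_snd.
apply: measurable_funD => //.
exact: (measurableT_comp (measurable_dotz b) measurable_fst).
Qed.

Lemma measurable_band b h : measurable_fun setT (in_band b h).
Proof.
by apply: measurable_and; [|apply: measurable_neg]; exact: measurable_leband.
Qed.

Lemma ex_in_band b h : 0 <= h ->
  Ex (fun w => (in_band b h (X D w, Y D w))%:R) <= 2 * K * h.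
Proof.
move=> h0; under eq_Rintegral do rewrite in_bandE//=.
exact: (ex_band_cst h0 (measurable_dotz b)).
Qed.

Definition all_in_band (S : {set 'I_n}) (b : 'cV[R]_m) (h : R) (w : Omega D) : bool :=
  [forall i, (i \in S) ==> in_band b h (obs i w)].

Lemma measurable_all_in_band S b h : measurable_fun setT (all_in_band S b h).
Proof.
have := measurable_exists (fun i : 'I_n => measurable_and (measurable_cst (i \in S))
  (measurable_neg (measurableT_comp (measurable_band b h) (measurable_obs i)))).
move=> /measurable_neg; apply: eq_measurable_fun => w _ /=.
by rewrite negb_exists; apply: eq_forallb => i; rewrite /= negb_and negbK implybE.
Qed.

Lemma pr_all_in_band (S : {set 'I_n}) b h : 0 <= h ->
  (P [set w | all_in_band S b h w] <= ((2 * K * h) ^+ #|S|)%:E)%E.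
Proof.
move=> h0; pose F (i : 'I_n) s : R := if i \in S then (in_band b h s)%:R else 1.
have bF i : bmf (F i).
  rewrite /F; case: (i \in S); last exact: bmf_cst.
  by apply: bmf_bool; exact: measurable_band.
have F0 i s : 0 <= F i s by rewrite /F; case: (i \in S).
have E w : ((all_in_band S b h w)%:R : R) = \prod_i F i (obs i w).
  have [/forallP H|/forallPn[i]] := boolP (all_in_band S b h w).
    by rewrite big1// => i _; have := H i; rewrite /F; case: (i \in S) => //= ->.
  by rewrite negb_imply => /andP[iS Hi]; rewrite (bigD1 i)//= /F iS (negbTE Hi) mul0r.
rewrite -ex_bool; last exact: measurable_all_in_band.
rewrite lee_fin.
under eq_Rintegral do rewrite E.
rewrite (ex_prod_indep measurable_obs (@XYs_indep _ _ D) bF F0).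
rewrite -prodr_const [leRHS]big_mkcond/=; apply: ler_prod => i _; apply/andP; split.
  by apply: ex_ge0 => w; exact: F0.
rewrite (ex_same_law measurable_obs measurable_pop (@XYs_law _ _ D) i (bF i)).
rewrite /F; case: (i \in S); first exact: ex_in_band.
by rewrite ex_cst.
Qed.

(** Almost surely no hyperplane passes through more than [m] observations: a
    grid of mesh [1/N] has of order [N^m] points, and a band of width [1/N]
    catches [m+1] given independent observations with probability of order
    [N^-(m+1)]. *)
Lemma ae_exact_fit : {ae P, forall w, forall b : 'cV[R]_m,
  (#|[pred i : 'I_n | Ys D i w == dotv b (Zs i w)]| <= m)%N}.
Proof.
have xi0 := xi_ge0.
have K0 := K_ge0.
pose good w (S : {set 'I_n}) (r : nat) := #|S| = m.+1 ->
  ~ exists b : 'cV[R]_m, enorm b <= r.+1%:R /\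
      forall i, i \in S -> Ys D i w = dotv b (ztr (Xs D i w)).
have aegood (S : {set 'I_n}) : {ae P, forall w, forall r, good w S r}.
  apply: ae_foralln => r; rewrite /good.
  have [cS|nS] := eqVneq #|S| m.+1; last by apply: aeW => w h; move: nS; rewrite h eqxx.
  apply: negligible_small => e e0.
  (* half-width [a / N] of the bands: the distance to the grid moves fits by less *)
  pose a := xi * (m%:R * r.+1%:R) + 1.
  have a0 : 0 < a by rewrite ltr_wpDl// mulr_ge0.
  (* the union bound is [C / N] *)
  pose C := 3 ^+ m * (2 * K * a) ^+ m.+1.
  have C0 : 0 <= C by rewrite mulr_ge0// exprn_ge0// mulr_ge0// ?mulr_ge0// ltW.
  pose N := (Num.bound (C / e)).+1.
  have NR : 0 < N%:R :> R by rewrite ltr0n.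
  pose h := a / N%:R; have h0 : 0 < h by rewrite divr_gt0.
  pose bad (k : grid_index (m := m) N) := all_in_band S (grid_point 0 r.+1%:R k) h.
  have mbad k : measurable_fun setT (bad k) by exact: measurable_all_in_band.
  exists [set w | [exists k, bad k w]].
    exact: (measurable_bool_set (measurable_exists mbad)).
  split.
    move=> w /= Hw; have [b [br Hb]] : exists b : 'cV[R]_m, enorm b <= r.+1%:R /\
      forall i, i \in S -> Ys D i w = dotv b (ztr (Xs D i w)).
      by apply: contrapT => nb; apply: Hw => _.
    have [|k Hk] := @grid_approx R m 0 b r.+1%:R N (ltr0Sn _ _) isT.
      by rewrite subr0.
    apply/existsP; exists k; apply/forallP => i; apply/implyP => iS.
    have e1 : `|dotv (grid_point 0 r.+1%:R k - b) (ztr (Xs D i w))| < h.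
      apply: (@le_lt_trans _ _ (m%:R * (r.+1%:R / N%:R) * xi)).
        rewrite (le_trans (dotv_ztr_le _ _))//.
        by rewrite ler_wpM2r.
      rewrite /h /a mulrDl (_ : _ * xi = xi * (m%:R * r.+1%:R) / N%:R).
        by rewrite ltrDl divr_gt0.
      by field; rewrite gt_eqF.
    have := Hb i iS; rewrite /in_band /= dotvBl in e1 *.
    move: e1; rewrite ltr_norml => /andP[e1 e2] ->.
    by apply/andP; split; [|rewrite -ltNge]; lra.
  have := pr_exists_le mbad (fun k => pr_all_in_band S (grid_point 0 r.+1%:R k) (ltW h0)).
  move=> /le_trans; apply; rewrite lee_fin card_grid cS.
  apply: (@le_trans _ _ ((3 * N%:R) ^+ m * (2 * K * h) ^+ m.+1)).
    have hKh : 0 <= 2 * K * h by rewrite !mulr_ge0// ltW.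
    have N3 : (2 * N).+1%:R <= 3 * N%:R :> R.
      by rewrite -natrM ler_nat -addn1 (mulnDl 2 1) leq_add2l mul1n.
    rewrite (ler_wpM2r (exprn_ge0 _ hKh))// natrX lerXn2r ?nnegrE//.
  have -> : (3 * N%:R) ^+ m * (2 * K * h) ^+ m.+1 = C / N%:R.
    rewrite /C /h !exprMn !exprVn [N%:R ^+ m.+1]exprS; field.
    by rewrite expf_neq0 gt_eqF.
  rewrite ler_pdivrMr// mulrC -ler_pdivrMr//.
  by rewrite ltW// (lt_trans (archi_boundP _)) ?ltr_nat// divr_ge0// ltW.
have all_good := ae_forall_fin aegood.
have all_bound := ae_forall_fin Zs_bound.
apply: filterS2 all_good all_bound => w Hg Hb b.
rewrite leqNgt; apply/negP => lt_m.
have [S SA cS] := exists_subset_card lt_m.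
apply: (Hg S (Num.bound (enorm b)) cS); exists b; split.
  by rewrite ltW// (lt_trans (archi_boundP (enorm_ge0 b)))// ltr_nat.
move=> i iS; have := fintype.subsetP SA i iS; rewrite inE => /eqP ->.
by rewrite /ztr; have := Hb i; rewrite /Zs => ->.
Qed.

(** ** Uniform deviation of the empirical score *)

Definition emp_mean (h : RX * MR -> R) (w : Omega D) : R := n%:R^-1 * \sum_i h (obs i w).

Let nR : 0 < n%:R :> R.
Proof. by rewrite ltr0n. Qed.

Lemma sqr_le_norm (y a : R) : `|y| <= a -> y ^+ 2 <= a ^+ 2.
Proof.
move=> ya; rewrite -real_normK ?num_real// lerXn2r// nnegrE//.
exact: le_trans ya.
Qed.

(** A unit direction has second moment at least [1 / M] and at most [xi ^+ 2]. *)
Lemma xi_sqr_ge : 1 <= M * xi ^+ 2.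
Proof.
pose u : 'cV[R]_m := delta_mx (Ordinal dimZ_gt0) 0.
have u1 : enorm u = 1.
  apply/eqP; rewrite -(@eqrXn2 _ 2) ?enorm_ge0// enorm_sqr dotvE.
  rewrite (bigD1 (Ordinal dimZ_gt0))//= !mxE !eqxx mulr1 big1 ?addr0 ?expr1n// => j j0.
  by rewrite !mxE (negbTE j0) mul0r.
have := ex_sqr_ge u; rewrite u1 expr1n ler_pdivrMr// => /le_trans; apply.
rewrite mulrC ler_wpM2l ?(ltW M_gt0)// -[leRHS](ex_cst P).
apply: ler_ex => [||w]; [exact: bmf_sqr_dotz|exact: bmf_cst|].
by have := dotv_ztr_le u (X D w); rewrite u1 mul1r => /sqr_le_norm.
Qed.

Lemma xi_gt0 : 0 < xi.
Proof.
rewrite lt_neqAle xi_ge0 andbT; apply/eqP => xi0.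
by have := xi_sqr_ge; rewrite -xi0 expr0n/= mulr0 ler10.
Qed.

Lemma bernstein_mean (h : RX * MR -> R) B sigma x :
  measurable_fun setT h -> 0 < B -> (forall s, `|h s| <= B) -> 0 < sigma ->
  Ex (fun w => h (X D w, Y D w) ^+ 2) <= sigma ^+ 2 -> 0 <= x ->
  (P [set w | (3 * sigma * Num.sqrt (x / n%:R) + 6 * B * (x / n%:R) <
      emp_mean h w - Ex (fun w => h (X D w, Y D w)))%R] <= (expR (- x))%:E)%E.
Proof.
move=> mh B0 hB s0 hs x0.
have := bernstein measurable_obs measurable_pop (@XYs_indep _ _ D) (@XYs_law _ _ D)
  n_gt0 mh B0 hB s0 hs x0.
have E w : \sum_i (h (obs i w) - Ex (fun w => h (X D w, Y D w))) =
    n%:R * (emp_mean h w - Ex (fun w => h (X D w, Y D w))).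
  by rewrite sumrB sumr_const card_ord mulrBr mulVKf ?gt_eqF// mulr_natl.
by congr (P _ <= _)%E; apply/seteqP; split => w /=; rewrite E ltr_pM2l.
Qed.

Lemma measurable_emp_mean h : measurable_fun setT h -> measurable_fun setT (emp_mean h).
Proof.
move=> mh; apply: measurable_funM => //; apply: measurable_sum => i.
exact: (measurableT_comp mh (measurable_obs i)).
Qed.

Definition score_fun (u b : 'cV[R]_m) (s : RX * MR) : R :=
  (s.2 <= dotv b (ztr s.1))%R%:R * dotv u (ztr s.1).

Lemma measurable_dot_fst u : measurable_fun setT (fun s : RX * MR => dotv u (ztr s.1)).
Proof. exact: (measurableT_comp (measurable_dotz u) measurable_fst). Qed.

Lemma measurable_le_fst b :
  measurable_fun setT (fun s : RX * MR => (s.2 <= dotv b (ztr s.1))%R%:R : R).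
Proof.
have [] // : bmf (fun s : RX * MR => (s.2 <= dotv b (ztr s.1))%R%:R : R).
apply: bmf_bool; apply: measurable_fun_ler; first exact: measurable_snd.
exact: measurable_dot_fst.
Qed.

Lemma measurable_score_fun u b : measurable_fun setT (score_fun u b).
Proof.
apply: measurable_funM; [exact: measurable_le_fst|exact: measurable_dot_fst].
Qed.

Lemma score_fun_le u b s : `|score_fun u b s| <= enorm u * xi.
Proof.
rewrite /score_fun normrM; have := dotv_ztr_le u s.1.
case: (s.2 <= _) => /= h; first by rewrite normr1 mul1r.
by rewrite normr0 mul0r mulr_ge0 ?enorm_ge0 ?xi_ge0.
Qed.

Definition emp_score (b : 'cV[R]_m) (w : Omega D) : 'cV[R]_m :=
  n%:R^-1 *: \sum_i (Ys D i w <= dotv b (ztr (Xs D i w)))%R%:R *: ztr (Xs D i w).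

Definition emp_regressor (w : Omega D) : 'cV[R]_m := n%:R^-1 *: \sum_i ztr (Xs D i w).

Definition score_process (b : 'cV[R]_m) (w : Omega D) : 'cV[R]_m := emp_score b w - mean_score b.

Lemma dotv_emp_score u b w : dotv u (emp_score b w) = emp_mean (score_fun u b) w.
Proof. by rewrite dotvZr dotv_sumr; congr (_ * _); apply: eq_bigr => i _; rewrite dotvZr. Qed.

Lemma dotv_emp_regressor u w : dotv u (emp_regressor w) = emp_mean (fun s => dotv u (ztr s.1)) w.
Proof. by rewrite dotvZr dotv_sumr. Qed.

Lemma bmf_score u b : bmf (fun w => score_fun u b (X D w, Y D w)).
Proof.
by apply: bmfM; [apply: (bmf_Yle (measurable_dotz b))|exact: bmf_dotzX].
Qed.

Lemma mean_score_ex u b : dotv u (mean_score b) = Ex (fun w => score_fun u b (X D w, Y D w)).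
Proof.
rewrite dotv_mean_score -(ex_cond (bmf_dotz u) (measurable_dotz b)).
by apply: eq_Rintegral => w _; rewrite mulrC.
Qed.

Lemma dotv_score_process u b w : dotv u (score_process b w) =
  emp_mean (score_fun u b) w - Ex (fun w => score_fun u b (X D w, Y D w)).
Proof. by rewrite dotvBr dotv_emp_score mean_score_ex. Qed.

Lemma ex_score_sqr_le u b :
  Ex (fun w => score_fun u b (X D w, Y D w) ^+ 2) <= M * enorm u ^+ 2.
Proof.
apply: le_trans (ex_sqr_le u); apply: ler_ex => [||w].
- by under eq_fun do rewrite expr2; apply: bmfM; exact: bmf_score.
- exact: bmf_sqr_dotz.
rewrite /score_fun /=; case: (Y D w <= _) => /=; first by rewrite mul1r.
by rewrite mul0r expr0n sqr_ge0.
Qed.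

Section uniform_deviation.
Variables (x t rho h : R) (N : nat) (b0 : 'cV[R]_m).
Hypotheses (x_gt0 : 0 < x) (t_gt0 : 0 < t) (rho_gt0 : 0 < rho) (N_gt0 : (0 < N)%N).
Hypothesis mesh_u : m%:R * (1 / N%:R) <= 1 / 2 :> R.
Local Notation eta := (m%:R * (rho / N%:R)).
Hypothesis mesh_t : 2 * eta <= t.
Hypothesis band_wide : xi * eta < h.
Hypothesis band_thin : 2 * K * h <= x / n%:R.

Local Notation eps := (Num.sqrt (x / n%:R)).
Local Notation G := (grid_index (m := m) N).
Local Notation gu := (grid_point (0 : 'cV[R]_m) 1 (N := N)).
Local Notation gb := (grid_point b0 rho (N := N)).
Let s1 : R := 3 * (2 * (M + 1)) * eps + 6 * (2 * xi) * (x / n%:R).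
Let s2 : R := 3 * Num.sqrt (8 * (K + 1) * M * xi * t) * eps + 6 * (2 * xi) * (x / n%:R).
Let s3 : R := 3 * eps * eps + 6 * 1 * (x / n%:R).

(** Large deviations of the process, of the mean regressor, of increments of the
    process, and of the mass of a band. Two booleans select the family, so that a
    single union bound covers all four. *)
Let bad (j : bool * bool * G * G * G) (w : Omega D) : bool :=
  let: (a, b, k, l1, l2) := j in
  if a then
    if b then (enorm (gu k) <= 2)%R && (s1 < dotv (gu k) (score_process (gb l1) w))%R
    else (enorm (gu k) <= 2)%R && (s1 < dotv (gu k) (mean_regressor - emp_regressor w))%R
  else
    if b then [&& (enorm (gu k) <= 2)%R, (enorm (gb l1 - gb l2) <= 2 * t)%R &
      (s2 < dotv (gu k) (score_process (gb l1) w - score_process (gb l2) w))%R]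
    else (s3 < emp_mean (fun s => (in_band (gb l1) h s)%:R) w -
      Ex (fun w => (in_band (gb l1) h (X D w, Y D w))%:R))%R.

Let xn0 : 0 < x / n%:R. Proof. by rewrite divr_gt0. Qed.
Let eps_gt0 : 0 < eps. Proof. by rewrite sqrtr_gt0. Qed.
Let eps2 : eps * eps = x / n%:R. Proof. by rewrite -expr2 sqr_sqrtr// ltW. Qed.
Let var2_gt0 : 0 < 8 * (K + 1) * M * xi * t.
Proof.
have K1 : 0 < K + 1 by rewrite ltr_wpDl// K_ge0.
have X0 := xi_gt0.
by rewrite (mulr_gt0 (mulr_gt0 (mulr_gt0 (mulr_gt0 _ K1) M_gt0) X0) t_gt0).
Qed.

Let h_gt0 : 0 < h.
Proof.
apply: le_lt_trans band_wide; rewrite mulr_ge0 ?xi_ge0// mulr_ge0// divr_ge0// ltW//.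
Qed.

Let measurable_dot_process u b : measurable_fun setT (fun w => dotv u (score_process b w)).
Proof.
under eq_fun do rewrite dotv_score_process; apply: measurable_funB => //.
exact: (measurable_emp_mean (measurable_score_fun u b)).
Qed.

Let measurable_bad j : measurable_fun setT (bad j).
Proof.
case: j => [[[[a b] k] l1] l2] /=.
have mc (c : bool) (g : Omega D -> bool) : measurable_fun setT g ->
    measurable_fun setT (fun w => c && g w) by move=> mg; exact: measurable_and.
case: a; case: b.
- by apply: mc; apply: measurable_fun_ltr => //; exact: measurable_dot_process.
- apply: mc; apply: measurable_fun_ltr => //.
  under eq_fun do rewrite dotvBr dotv_emp_regressor; apply: measurable_funB => //.
  exact: (measurable_emp_mean (measurable_dot_fst _)).
- apply: (mc _ _); apply: (mc _ _); apply: measurable_fun_ltr => //.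
  by under eq_fun do rewrite dotvBr; apply: measurable_funB; exact: measurable_dot_process.
- apply: measurable_fun_ltr => //; apply: measurable_funB => //.
  apply: measurable_emp_mean.
  by have [] // := bmf_bool (R := R) (measurable_band (gb l1) h).
Qed.

Let pr_bad j : (P [set w | bad j w] <= (expR (- x))%:E)%E.
Proof.
have x0 : 0 <= x := ltW x_gt0.
have e0 : (0 <= (expR (- x))%:E)%E by rewrite lee_fin expR_ge0.
have guard (c : bool) (g : Omega D -> bool) :
    (c -> (P [set w | g w] <= (expR (- x))%:E)%E) ->
    (P [set w | c && g w] <= (expR (- x))%:E)%E.
  case: c => [/(_ isT)//|_]; rewrite (_ : [set _ | _] = set0) ?measure0//.
  by apply/seteqP; split.
have B2 : 0 < 2 * xi by rewrite mulr_gt0// xi_gt0.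
have M1 : 0 < 2 * (M + 1) by rewrite mulr_gt0// addr_gt0.
have var1 u : enorm u <= 2 -> M * enorm u ^+ 2 <= (2 * (M + 1)) ^+ 2.
  move=> u2; have : enorm u ^+ 2 <= 2 ^+ 2 by rewrite lerXn2r ?nnegrE ?enorm_ge0.
  have := M_gt0; have := enorm_ge0 u; nra.
case: j => [[[[a b] k] l1] l2] /=; case: a; case: b.
- apply: guard => u2; under eq_set do rewrite dotv_score_process.
  apply: (bernstein_mean (measurable_score_fun _ _) B2 _ M1 _ x0).
    by move=> s; rewrite (le_trans (score_fun_le _ _ _))// ler_wpM2r// xi_ge0.
  by apply: (le_trans (ex_score_sqr_le _ _)); exact: var1.
- apply: guard => u2.
  pose g (s : RX * MR) := - dotv (gu k) (ztr s.1).
  have mg : measurable_fun setT (g : RX * MR -> MR).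
    by apply: measurable_funN; exact: measurable_dot_fst.
  have E w : dotv (gu k) (mean_regressor - emp_regressor w) =
      emp_mean g w - Ex (fun w => g (X D w, Y D w)).
    have -> : Ex (fun w => g (X D w, Y D w)) = - dotv (gu k) mean_regressor.
      by rewrite dotv_mean_regressor -exN//; exact: bmf_dotzX.
    by rewrite dotvBr dotv_emp_regressor /g /emp_mean sumrN mulrN opprK addrC.
  under eq_set do rewrite E.
  apply: (bernstein_mean mg B2 _ M1 _ x0).
    by move=> s; rewrite normrN (le_trans (dotv_ztr_le _ _))// ler_wpM2r// xi_ge0.
  under eq_Rintegral do rewrite /g sqrrN.
  by apply: (le_trans (ex_sqr_le _)); exact: var1.
- apply: (guard _ _ _) => u2; apply: (guard _ _ _) => bt.
  pose g (s : RX * MR) := score_fun (gu k) (gb l1) s - score_fun (gu k) (gb l2) s.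
  have mg : measurable_fun setT (g : RX * MR -> MR).
    by apply: measurable_funB; exact: measurable_score_fun.
  have gE s : g s = dotv (gu k) (ztr s.1) *
      ((s.2 <= dotv (gb l1) (ztr s.1))%R%:R - (s.2 <= dotv (gb l2) (ztr s.1))%R%:R).
    by rewrite /g /score_fun -mulrBl mulrC.
  have E w : dotv (gu k) (score_process (gb l1) w - score_process (gb l2) w) =
      emp_mean g w - Ex (fun w => g (X D w, Y D w)).
    rewrite dotvBr !dotv_score_process /g exB; [|exact: bmf_score|exact: bmf_score].
    by rewrite /emp_mean sumrB mulrBr; ring.
  under eq_set do rewrite E.
  apply: (bernstein_mean mg B2 _ _ _ x0).
  - move=> s; rewrite gE normrM (le_trans (_ : _ <= `|dotv (gu k) (ztr s.1)| * 1))//.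
      by rewrite ler_wpM2l// bool_diff_le1.
    by rewrite mulr1 (le_trans (dotv_ztr_le _ _))// ler_wpM2r// xi_ge0.
  - by rewrite sqrtr_gt0.
  - under eq_Rintegral do rewrite gE/=.
    apply: (le_trans (ex_score_var _ _ _)); rewrite [leRHS]sqr_sqrtr ?(ltW var2_gt0)//.
    have h1 : enorm (gu k) ^+ 2 <= 2 ^+ 2 by rewrite lerXn2r ?nnegrE ?enorm_ge0.
    have h2 : 0 <= K * xi * M by rewrite !mulr_ge0 ?K_ge0 ?xi_ge0// ltW.
    apply: (@le_trans _ _ (K * xi * M * (2 * t) * 2 ^+ 2)).
      apply: ler_pM => //; [|exact: sqr_ge0|exact: ler_wpM2l].
      by rewrite (mulr_ge0 h2)// enorm_ge0.
    have h3 : 0 <= xi * M * t by rewrite !mulr_ge0 ?xi_ge0// ltW.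
    lra.
- apply: (bernstein_mean _ _ _ eps_gt0 _ x0) => //.
  + by have [] // := bmf_bool (R := R) (measurable_band (gb l1) h).
  + by move=> s; case: in_band; rewrite ?normr1 ?normr0.
  + rewrite expr2 eps2; apply: le_trans band_thin.
    apply: le_trans (ex_in_band (gb l1) (ltW h_gt0)).
    rewrite le_eqVlt; apply/orP; left; apply/eqP; apply: eq_Rintegral => w _.
    by case: in_band; rewrite ?expr1n ?expr0n.
Qed.

(** A union bound over the four families and three grids. *)
Let good_event : exists B : set (Omega D), [/\ measurable B,
  ((1 - (4 * (((2 * N).+1 ^ m) ^ 3))%:R * expR (- x))%:E <= P B)%E &
  forall w, B w -> forall j, ~~ bad j w].
Proof.
have mE := measurable_bool_set (measurable_exists measurable_bad).
exists (~` [set w | [exists j, bad j w]]); split; first exact: measurableC.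
  rewrite probability_setC// EFinB leeB//.
  have := pr_exists_le measurable_bad pr_bad.
  set q := #|_|; have -> // : q = (4 * ((2 * N).+1 ^ m) ^ 3)%N.
  by rewrite /q !card_prod card_bool card_grid !expnS expn0 muln1 !mulnA.
by move=> w /= /negP; rewrite negb_exists => /forallP.
Qed.

Section on_good_event.
Variable w : Omega D.
Hypothesis good : forall j, ~~ bad j w.

Let k0 : G := [ffun=> ord0].

Let dev1 k l : enorm (gu k) <= 2 -> dotv (gu k) (score_process (gb l) w) <= s1.
Proof. by move=> u2; have := good (true, true, k, l, k0); rewrite /= u2 -leNgt. Qed.

Let dev1z k : enorm (gu k) <= 2 -> dotv (gu k) (mean_regressor - emp_regressor w) <= s1.
Proof. by move=> u2; have := good (true, false, k, k0, k0); rewrite /= u2 -leNgt. Qed.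

Let dev2 k l1 l2 : enorm (gu k) <= 2 -> enorm (gb l1 - gb l2) <= 2 * t ->
  dotv (gu k) (score_process (gb l1) w - score_process (gb l2) w) <= s2.
Proof.
by move=> u2 bt; have := good (false, true, k, l1, l2); rewrite /= u2 bt -leNgt.
Qed.

Let dev3 l : emp_mean (fun s => (in_band (gb l) h s)%:R) w <= 10 * (x / n%:R).
Proof.
have := good (false, false, k0, l, k0); rewrite /= -leNgt /s3 -mulrA eps2.
have := le_trans (ex_in_band (gb l) (ltW h_gt0)) band_thin.
set a := Ex _; set b := emp_mean _ _; lra.
Qed.

Let net_dir u : enorm u = 1 -> exists k,
  enorm (gu k - u) <= 1 / 2 /\ enorm (gu k) <= 2.
Proof.
move=> u1; have [|k Hk] := @grid_approx R m 0 u 1 N ltr01 N_gt0.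
  by rewrite subr0 u1.
have {}Hk := le_trans Hk mesh_u; exists k; split => //.
have := enormD (gu k - u) u; rewrite subrK u1; lra.
Qed.

Let s1_ge0 : 0 <= s1.
Proof.
have M1 : 0 < M + 1 by rewrite addr_gt0.
have p3 : 0 <= 3 * (2 * (M + 1)) by rewrite mulr_ge0// mulr_ge0// ltW.
have p6 : 0 <= 6 * (2 * xi) by rewrite mulr_ge0// mulr_ge0// xi_ge0.
exact: addr_ge0 (mulr_ge0 p3 (ltW eps_gt0)) (mulr_ge0 p6 (ltW xn0)).
Qed.

Let s2_ge0 : 0 <= s2.
Proof.
have p3 : 0 <= 3 * Num.sqrt (8 * (K + 1) * M * xi * t).
  by rewrite mulr_ge0// sqrtr_ge0.
have p6 : 0 <= 6 * (2 * xi) by rewrite mulr_ge0// mulr_ge0// xi_ge0.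
exact: addr_ge0 (mulr_ge0 p3 (ltW eps_gt0)) (mulr_ge0 p6 (ltW xn0)).
Qed.

(** The score at [b] and at its nearest grid point differ only for observations in
    the band of half-width [h] about the latter. *)
Let discretise b : enorm (b - b0) <= rho -> exists l,
  enorm (gb l - b) <= eta /\
  enorm (score_process b w - score_process (gb l) w) <= 11 * xi * (x / n%:R).
Proof.
move=> bb; have [l Hl] := grid_approx rho_gt0 N_gt0 bb; exists l; split => //.
have close y : `|dotv (gb l) (ztr y) - dotv b (ztr y)| < h.
  rewrite -dotvBl (le_lt_trans (dotv_ztr_le _ _))//.
  by rewrite (le_lt_trans _ band_wide)// mulrC ler_wpM2l ?xi_ge0.
rewrite /score_process opprB [X in _ + X]addrC addrACA [X in _ + X]addrC.
rewrite (le_trans (enormD _ _))//.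
rewrite (_ : 11 * _ * _ = xi * (10 * (x / n%:R)) + xi * (x / n%:R)); last by ring.
apply: lerD.
  rewrite /emp_score -scalerBr -sumrB enormZ ger0_norm ?invr_ge0 ?(ltW nR)//.
  apply: le_trans (ler_wpM2l xi_ge0 (dev3 l)).
  rewrite mulrCA ler_wpM2l ?invr_ge0 ?(ltW nR)// mulr_sumr.
  apply: (le_trans (ler_enorm_sum _ _ _)); apply: ler_sum => i _.
  rewrite -scalerBl enormZ mulrC.
  apply: ler_pM; rewrite ?enorm_ge0 ?normr_ge0 ?enorm_ztr//.
  have := close (Xs D i w); rewrite ltr_norml => /andP[h1 h2].
  rewrite /in_band /=; set z := ztr _ in h1 h2 *.
  case: (leP (Ys D i w) (dotv b z)) => c1; case: (leP (Ys D i w) (dotv (gb l) z)) => c2;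
    rewrite ?subrr ?normr0// ?subr0 ?sub0r ?normrN normr1.
    have -> : (Ys D i w <= dotv (gb l) z + h)%R by lra.
    by have -> : (Ys D i w <= dotv (gb l) z - h)%R = false; [apply/negbTE; rewrite -ltNge; lra|].
  have -> : (Ys D i w <= dotv (gb l) z + h)%R by lra.
  by have -> : (Ys D i w <= dotv (gb l) z - h)%R = false; [apply/negbTE; rewrite -ltNge; lra|].
apply: enorm_le_dir => [|u u1]; first by rewrite mulr_ge0 ?xi_ge0// ltW.
rewrite dotvBr !dotv_mean_score.
have bFz b' := bmfM (bmf_dotzX u) (bmf_FX (measurable_dotz b')).
rewrite -exB// (le_trans (ler_norm _))// (le_trans (ler_norm_ex _ _))//; first exact: bmfB.
rewrite -[leRHS](ex_cst P); apply: ler_ex => [||v]; [|exact: bmf_cst|].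
  by apply: bmf_norm; exact: bmfB.
rewrite -mulrBr normrM; apply: ler_pM => //.
  by have := dotv_ztr_le u (X D v); rewrite u1 mul1r.
apply: (le_trans (condF_lip smooth dens_bound _ _ (X_in v))).
apply: (@le_trans _ _ (K * h)); first by rewrite ler_wpM2l ?K_ge0// ltW// close.
apply: le_trans band_thin; rewrite -mulrA ler_peMl ?mulr_ge0 ?K_ge0 ?(ltW h_gt0)//; lra.
Qed.

Lemma score_deviation b tau : enorm (b - b0) <= rho -> 0 <= tau -> tau <= 1 ->
  enorm (score_process b w - tau *: (emp_regressor w - mean_regressor)) <=
      11 * xi * (x / n%:R) + 4 * s1.
Proof.
move=> bb tau0' tau1'; have [l [_ Hl]] := discretise bb.
have nul : enorm (score_process (gb l) w) <= 2 * s1.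
  apply: enorm_le_net => // u /net_dir[k [ku k2]]; exists (gu k) => //; exact: dev1.
have nuz : enorm (mean_regressor - emp_regressor w) <= 2 * s1.
  apply: enorm_le_net => // u /net_dir[k [ku k2]]; exists (gu k) => //; exact: dev1z.
rewrite -scalerN (opprB (emp_regressor w)).
have -> : score_process b w + tau *: (mean_regressor - emp_regressor w) =
    (score_process b w - score_process (gb l) w) +
    (score_process (gb l) w + tau *: (mean_regressor - emp_regressor w)).
  by rewrite addrA subrK.
rewrite (le_trans (enormD _ _))// lerD// (le_trans (enormD _ _))// enormZ ger0_norm//.
have : tau * enorm (mean_regressor - emp_regressor w) <=
    enorm (mean_regressor - emp_regressor w) by rewrite ler_piMl// enorm_ge0.
lra.
Qed.

Lemma increment_deviation b1 b2 : enorm (b1 - b0) <= rho -> enorm (b2 - b0) <= rho ->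
  enorm (b1 - b2) <= t ->
  enorm (score_process b1 w - score_process b2 w) <= 22 * xi * (x / n%:R) + 2 * s2.
Proof.
move=> bb1 bb2 b12; have [l1 [G1 H1]] := discretise bb1.
have [l2 [G2 H2]] := discretise bb2.
have close : enorm (gb l1 - gb l2) <= 2 * t.
  move: G2; rewrite enorm_subC => G2.
  apply: (le_trans (enorm_sub3_le G1 b12 G2)); move: mesh_t.
  by rewrite addrAC [2 * t]mulr_natl mulr2n lerD2r [2 * eta]mulr_natl mulr2n.
have net : enorm (score_process (gb l1) w - score_process (gb l2) w) <= 2 * s2.
  by apply: enorm_le_net => // u /net_dir[k [ku k2]]; exists (gu k) => //; exact: dev2.
move: H2; rewrite enorm_subC => H2.
apply: (le_trans (enorm_sub3_le H1 net H2)).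
rewrite addrAC -!mulrA -mulrDl lerD2r.
by rewrite ler_wpM2r ?(mulr_ge0 xi_ge0 (ltW xn0))// -natrD ler_nat.
Qed.

End on_good_event.

Lemma uniform_deviation : exists B : set (Omega D), [/\ measurable B,
  ((1 - (4 * (((2 * N).+1 ^ m) ^ 3))%:R * expR (- x))%:E <= P B)%E,
  forall w b tau, B w -> enorm (b - b0) <= rho -> 0 <= tau -> tau <= 1 ->
    enorm (score_process b w - tau *: (emp_regressor w - mean_regressor)) <=
      11 * xi * (x / n%:R) + 4 * s1 &
  forall w b1 b2, B w -> enorm (b1 - b0) <= rho -> enorm (b2 - b0) <= rho ->
    enorm (b1 - b2) <= t ->
    enorm (score_process b1 w - score_process b2 w) <= 22 * xi * (x / n%:R) + 2 * s2].
Proof.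
have [B [mB PB goodB]] := good_event; exists B; split => //.
  by move=> w b tau /goodB Bw; exact: score_deviation.
by move=> w b1 b2 /goodB Bw; exact: increment_deviation.
Qed.

End uniform_deviation.

(** ** The Bahadur expansion on one row *)

(** Before [invmx J] is applied the five terms add up to [J *m d]. *)
Lemma solve_expansion (J J' : 'M[R]_m) p1 p2 a d : J \in unitmx ->
  d = - (invmx J *m p2) + invmx J *m p1 - invmx J *m (a - J' *m d)
      - invmx J *m (p1 - p2 - a) + invmx J *m ((J - J') *m d) :> 'cV[R]_m.
Proof.
move=> Ju; rewrite -!(mulmxN (invmx J)) -!mulmxDr -[LHS](mulKmx Ju); congr (_ *m _).
rewrite mulmxBl; move: (J *m d) (J' *m d) => x y.
by apply/matrixP => i j; rewrite !mxE; ring.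
Qed.

Lemma score_split (a' a e e' z z0 v : 'cV[R]_m) tau : a' - tau *: z =
  (a' - e' - (a - e)) + (a - e - tau *: (z - z0)) + (e - tau *: z0) + (e' - e - v) + v.
Proof. by apply/matrixP => i j; rewrite !mxE; ring. Qed.

Lemma increment_split (a' a e e' z : 'cV[R]_m) :
  a' - z - (a - z) - (e' - e) = (a' - e') - (a - e).
Proof. by apply/matrixP => i j; rewrite !mxE; ring. Qed.

Section expansion.
Variables (gam : R -> 'cV[R]_m) (c g : R) (ghat : Omega D -> R -> 'cV[R]_m).
Local Notation T := `[tl, tu]%classic.
Hypothesis c_bound : forall tau, T tau -> forall x, calX D x ->
  `|Q x tau - dotv (Z D x) (gam tau)| <= c.
Hypothesis g_bound : forall tau, T tau -> enorm (mean_score (gam tau) - tau *: mean_regressor) <= g.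
Hypothesis ghat_min : forall w tau, T tau -> is_qr_estimator w tau (ghat w tau).

Lemma c_ge0 : 0 <= c.
Proof.
have [w _] := ae_exists ztr_ae.
have Tl : T tl by rewrite /= in_itv/= lexx tltu.
exact: le_trans (normr_ge0 _) (c_bound Tl (X_in w)).
Qed.

(** [dotv (gam tau - gam tl) Z] is bounded by the error [c] of the two linear
    approximations and the increment of the quantile; its second moment controls
    the norm. *)
Lemma gam_spread tau : T tau ->
  enorm (gam tau - gam tl) ^+ 2 <= M * (2 * c + (tu - tl) / fmin) ^+ 2.
Proof.
move=> Tt; have [t1 t2 t3 t4] := tau_in Tt.
have Tl : T tl by rewrite /= in_itv/= lexx tltu.
set L := 2 * c + _; have L0 : 0 <= L.
  rewrite addr_ge0 ?(mulr_ge0 (ler0n _ 2) c_ge0)//.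
  by apply: divr_ge0; rewrite ?subr_ge0// ltW.
rewrite mulrC -ler_pdivrMr//; apply: (le_trans (ex_sqr_ge _)).
rewrite -[leRHS](ex_cst P).
apply: ler_ex => [||w]; [exact: bmf_sqr_dotz|exact: bmf_cst|].
apply: sqr_le_norm; rewrite dotvBl /ztr; case: ifP => _; last first.
  by rewrite !dotv0r subrr normr0.
have := c_bound Tt (X_in w); have := c_bound Tl (X_in w).
have /andP[] := condQ_lip smooth dens_bound tl0 tu1 fmin0 dens_min (X_in w) (lexx tl) t1 t2.
rewrite /L (dotvC (gam tau)) (dotvC (gam tl)) !ler_norml.
move: (dotv _ _) (dotv _ _) => d1 d2.
have : (tau - tl) / fmin <= (tu - tl) / fmin.
  by rewrite ler_pM2r ?invr_gt0// lerD2r.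
move=> e1 e2 e3 /andP[e4 e5] /andP[e6 e7]; apply/andP; split; lra.
Qed.

(** Almost surely this is [emp_score b w - tau *: emp_regressor w], where the
    regressors are truncated. *)
Definition emp_psi (b : 'cV[R]_m) (tau : R) (w : Omega D) : 'cV[R]_m :=
  n%:R^-1 *: \sum_i psi (Ys D i w) (Zs i w) b tau.

Definition rem1 w tau := invmx (Jm D tau) *m emp_psi (ghat w tau) tau w.

Definition rem2 w tau := - (invmx (Jm D tau) *m
  (mean_score (ghat w tau) - mean_score (gam tau) -
    density_gram (gam tau) *m (ghat w tau - gam tau))).

Definition rem3 w tau := - (invmx (Jm D tau) *m
  (emp_psi (ghat w tau) tau w - emp_psi (gam tau) tau w -
    (mean_score (ghat w tau) - mean_score (gam tau)))).

Definition rem4 w tau := invmx (Jm D tau) *m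
  ((Jm D tau - density_gram (gam tau)) *m (ghat w tau - gam tau)).

Lemma Jm_inv tau : T tau -> Jm D tau \in unitmx /\
  forall v, enorm (invmx (Jm D tau) *m v) <= M / fmin * enorm v.
Proof.
move=> Tt; have fM : 0 < fmin / M by rewrite divr_gt0.
by have := posdef_invmx fM (fun v => Jm_quad_ge v Tt); rewrite invf_div.
Qed.

Lemma bahadur_expansion w tau : T tau -> ghat w tau - gam tau =
  - (n%:R^-1 *: (invmx (Jm D tau) *m \sum_i psi (Ys D i w) (Zs i w) (gam tau) tau))
  + rem1 w tau + rem2 w tau + rem3 w tau + rem4 w tau.
Proof.
move=> Tt; have [Ju _] := Jm_inv Tt.
rewrite scalemxAr -[n%:R^-1 *: _]/(emp_psi (gam tau) tau w) /rem1 /rem2 /rem3 /rem4.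
exact: solve_expansion.
Qed.

Lemma ae_score_small : {ae P, forall w, forall tau, T tau ->
  enorm (emp_psi (ghat w tau) tau w) <= m%:R * xi / n%:R}.
Proof.
apply: filterS2 ae_exact_fit (ae_forall_fin Zs_bound) => w fit bnd tau Tt.
rewrite /emp_psi enormZ ger0_norm ?invr_ge0// mulrC ler_wpM2r ?invr_ge0//.
have := score_at_minimiser (ghat_min w Tt); rewrite /psi => H.
under eq_bigr do rewrite dotvC.
apply: (le_trans H).
apply: (@le_trans _ _ (\sum_(i < n | Ys D i w == dotv (ghat w tau) (Zs i w)) xi)).
  by apply: ler_sum => i _; exact: bnd.
by rewrite sumr_const [leRHS]mulr_natl; apply: (ler_wpMn2l xi_ge0); exact: fit.
Qed.

Lemma unorm_le (r : R -> 'cV[R]_m) a :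
  (forall tau, T tau -> enorm (r tau) <= a) -> (unorm T r <= a%:E)%E.
Proof. by move=> H; apply: ge_ereal_sup => _ [tau Tt <-]; rewrite lee_fin H. Qed.

Lemma rem1_bound : {ae P, forall w, (unorm T (rem1 w) <=
  ((inf [set lambda_min (Jm D tau) | tau in T])^-1 * (m%:R * xi / n%:R))%:E)%E}.
Proof.
set I := inf _.
have lbI : lbound [set lambda_min (Jm D tau) | tau in T] (fmin / M).
  by move=> _ [tau Tt <-]; exact: lambda_min_Jm_ge.
have I0 : 0 < I.
  apply: (@lt_le_trans _ _ (fmin / M)); first by rewrite divr_gt0.
  apply: lb_le_inf lbI; exists (lambda_min (Jm D tl)), tl => //.
  by rewrite /= in_itv/= lexx.
apply: filterS ae_score_small => w H; apply: unorm_le => tau Tt.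
have Ile : I <= lambda_min (Jm D tau).
  by apply: ge_inf; [exists (fmin / M)|exists tau].
have [|_ Jinv] := @posdef_invmx _ _ (Jm D tau) _ I0.
  move=> v; apply: le_trans (lambda_min_quad v dimZ_gt0 (Jm_sym tau)).
  by rewrite ler_wpM2r ?sqr_ge0.
rewrite /rem1 (le_trans (Jinv _))// ler_wpM2l ?invr_ge0 ?(ltW I0)//; exact: H.
Qed.

Section rate.
Variables (w : Omega D) (t rho D1 D2 : R).
Hypotheses (t_gt0 : 0 < t) (t_le1 : t <= 1).
Hypothesis Zs_w : forall i, enorm (Zs i w) <= xi.
Hypothesis score_w : forall tau, T tau -> enorm (emp_psi (ghat w tau) tau w) <= m%:R * xi / n%:R.
Hypothesis near_gam : forall tau, T tau -> enorm (gam tau - gam tl) + 1 <= rho.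
Hypothesis dev_score : forall b tau, enorm (b - gam tl) <= rho -> 0 <= tau -> tau <= 1 ->
  enorm (score_process b w - tau *: (emp_regressor w - mean_regressor)) <= D1.
Hypothesis dev_incr : forall b1 b2, enorm (b1 - gam tl) <= rho ->
  enorm (b2 - gam tl) <= rho -> enorm (b1 - b2) <= t ->
  enorm (score_process b1 w - score_process b2 w) <= D2.
Hypothesis c_small : K * c * M <= fmin / M / 2.
Hypothesis t_large : D1 + g + D2 + K * xi * M * t ^+ 2 + m%:R * xi / n%:R <
  t * (fmin / M / 2).

Let emp_psiE b tau : emp_psi b tau w = emp_score b w - tau *: emp_regressor w.
Proof.
rewrite /emp_score /emp_regressor /emp_psi scalerA mulrC -scalerA -scalerBr.
rewrite [tau *: _]scaler_sumr -sumrB.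
congr (_ *: _); apply: eq_bigr => i _.
have -> : ztr (Xs D i w) = Zs i w by rewrite /ztr; have := Zs_w i; rewrite /Zs => ->.
by rewrite /psi scalerBl dotvC.
Qed.

Let ball_gam tau v : T tau -> enorm v <= 1 -> enorm (gam tau + v - gam tl) <= rho.
Proof.
move=> Tt v1; apply: le_trans (near_gam Tt); rewrite addrAC.
by rewrite (le_trans (enormD _ _))// lerD2l.
Qed.

(** To first order the mean score grows by at least [t * fmin / M / 2] over the
    distance [t], which exceeds all other terms together. *)
Let score_ray tau u : T tau -> enorm u = 1 ->
  m%:R * xi / n%:R < dotv u (emp_psi (gam tau + t *: u) tau w).
Proof.
move=> Tt u1; have [_ _ /ltW t3 /ltW t4] := tau_in Tt.
set b := gam tau; set b' := b + t *: u.
have tu1' : enorm (t *: u) = t by rewrite enormZ u1 mulr1 gtr0_norm.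
have b'b : b' - b = t *: u by rewrite /b' addrC addKr.
have inb : enorm (b - gam tl) <= rho.
  by have := ball_gam Tt; move/(_ 0); rewrite enorm0 addr0; apply.
have inb' : enorm (b' - gam tl) <= rho by apply: ball_gam; rewrite ?tu1'.
have low v e : enorm v <= e -> - e <= dotv u v.
  move=> ve; have := normr_dotv_le u v; rewrite u1 mul1r ler_norml => /andP[h _].
  by apply: le_trans h; rewrite lerN2.
have h1 := low _ _ (dev_score inb t3 t4).
have h2 := low _ _ (g_bound Tt).
have h3 : - D2 <= dotv u (score_process b' w - score_process b w).
  by apply/low/dev_incr; rewrite ?b'b ?tu1'.
have := mean_score_taylor u b b'; rewrite b'b tu1' u1 mulr1 ler_norml => /andP[h4 _].
have := Jm_density_gram_close Tt (c_bound Tt) u u; rewrite u1 !mulr1 ler_norml => /andP[_ h5].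
have := Jm_quad_ge u Tt; rewrite u1 expr1n mulr1 => h6.
have h7 : t * (fmin / M / 2) <= t * dotv u (density_gram (gam tau) *m u).
  by apply: ler_wpM2l; [exact: ltW|exact: half_gap h5 h6 c_small].
rewrite -dotvZr scalemxAr in h7.
by have := ray_gap t_large h3 h1 h2 h4 h7; rewrite -!dotvDr -score_split -emp_psiE.
Qed.

(** Otherwise, by monotonicity along the ray, the score at the minimiser would
    exceed its bound in the direction of the minimiser. *)
Lemma minimiser_close tau : T tau -> enorm (ghat w tau - gam tau) <= t.
Proof.
move=> Tt; set d := _ - _; rewrite leNgt; apply/negP => dt.
have d0 : 0 < enorm d by exact: lt_trans dt.
pose u := (enorm d)^-1 *: d.
have u1 : enorm u = 1 by apply: normalize_unit; apply: contraTneq d0 => ->; rewrite enorm0 ltxx.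
have := score_ray Tt u1; apply/negP; rewrite -leNgt.
have ghatE : ghat w tau = gam tau + enorm d *: u.
  by rewrite scalerA divff ?gt_eqF// scale1r addrC subrK.
apply: (@le_trans _ _ (dotv u (emp_psi (ghat w tau) tau w))); last first.
  have := dotv_le u (emp_psi (ghat w tau) tau w); rewrite u1 mul1r.
  by move=> /le_trans; apply; exact: score_w.
rewrite !emp_psiE !dotvBr lerD2r /emp_score !dotvZr ler_wpM2l ?invr_ge0// ghatE.
exact/score_mono/ltW.
Qed.

Let Mf0 : 0 <= M / fmin. Proof. exact: divr_ge0 (ltW M_gt0) (ltW fmin0). Qed.

Lemma rem2_le tau : T tau -> enorm (rem2 w tau) <= M / fmin * (K * xi * M * t ^+ 2).
Proof.
move=> Tt; have [_ Jinv] := Jm_inv Tt; have close := minimiser_close Tt.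
have p : 0 <= K * xi * M by rewrite mulr_ge0 ?(ltW M_gt0)// mulr_ge0 ?K_ge0 ?xi_ge0.
rewrite /rem2 enormN (le_trans (Jinv _))// (ler_wpM2l Mf0)//.
apply: enorm_le_dir => [|u u1]; first by rewrite mulr_ge0 ?sqr_ge0.
apply: (le_trans (ler_norm _)); apply: (le_trans (mean_score_taylor _ _ _)).
rewrite u1 mulr1 (ler_wpM2l p)//; apply: sqr_le_norm.
by rewrite ger0_norm ?enorm_ge0.
Qed.

Lemma rem3_le tau : T tau -> enorm (rem3 w tau) <= M / fmin * D2.
Proof.
move=> Tt; have [_ Jinv] := Jm_inv Tt; have close := minimiser_close Tt.
rewrite /rem3 enormN (le_trans (Jinv _))// (ler_wpM2l Mf0)//.
rewrite !emp_psiE increment_split.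
apply: dev_incr => //.
  have := @ball_gam tau (ghat w tau - gam tau) Tt; rewrite [_ + (_ - _)]addrC subrK; apply.
  exact: le_trans close t_le1.
by have := @ball_gam tau 0 Tt; rewrite addr0 enorm0; apply.
Qed.

Lemma rem4_le tau : T tau -> enorm (rem4 w tau) <= M / fmin * (K * c * M * t).
Proof.
move=> Tt; have [_ Jinv] := Jm_inv Tt; have close := minimiser_close Tt.
have p : 0 <= K * c * M by rewrite mulr_ge0 ?(ltW M_gt0)// mulr_ge0 ?K_ge0 ?c_ge0.
rewrite /rem4 (le_trans (Jinv _))// (ler_wpM2l Mf0)//.
apply: enorm_le_dir => [|u u1]; first exact: mulr_ge0 p (ltW t_gt0).
rewrite mulmxBl dotvBr (le_trans (ler_norm _))//.
apply: (le_trans (Jm_density_gram_close Tt (c_bound Tt) _ _)).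
by rewrite u1 mul1r (ler_wpM2l p).
Qed.

End rate.

Section remainder_event.
Variables (x t rho h : R) (N : nat).
Local Notation eps := (Num.sqrt (x / n%:R)).
Local Notation D1 := (11 * xi * (x / n%:R) +
  4 * (3 * (2 * (M + 1)) * eps + 6 * (2 * xi) * (x / n%:R))).
Local Notation D2 := (22 * xi * (x / n%:R) +
  2 * (3 * Num.sqrt (8 * (K + 1) * M * xi * t) * eps + 6 * (2 * xi) * (x / n%:R))).
Hypotheses (x_gt0 : 0 < x) (t_gt0 : 0 < t) (t_le1 : t <= 1) (rho_gt0 : 0 < rho).
Hypothesis N_gt0 : (0 < N)%N.
Hypothesis mesh_u : m%:R * (1 / N%:R) <= 1 / 2 :> R.
Hypothesis mesh_t : 2 * (m%:R * (rho / N%:R)) <= t.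
Hypothesis band_wide : xi * (m%:R * (rho / N%:R)) < h.
Hypothesis band_thin : 2 * K * h <= x / n%:R.
Hypothesis near_gam : forall tau, T tau -> enorm (gam tau - gam tl) + 1 <= rho.
Hypothesis c_small : K * c * M <= fmin / M / 2.
Hypothesis t_large : D1 + g + D2 + K * xi * M * t ^+ 2 + m%:R * xi / n%:R <
  t * (fmin / M / 2).

Lemma remainder_event : exists E : set (Omega D), [/\ measurable E,
  ((1 - (4 * (((2 * N).+1 ^ m) ^ 3))%:R * expR (- x))%:E <= P E)%E &
  forall w tau, E w -> T tau ->
    [/\ enorm (rem2 w tau) <= M / fmin * (K * xi * M * t ^+ 2),
        enorm (rem3 w tau) <= M / fmin * D2 &
        enorm (rem4 w tau) <= M / fmin * (K * c * M * t)]].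
Proof.
have [B [mB PB dev1 dev2]] := uniform_deviation (gam tl) x_gt0 t_gt0 rho_gt0 N_gt0
  mesh_u mesh_t band_wide band_thin.
have [A [mA A0 subA]] : P.-negligible (~` [set w | (forall i, enorm (Zs i w) <= xi) /\
    forall tau, T tau -> enorm (emp_psi (ghat w tau) tau w) <= m%:R * xi / n%:R]).
  by apply: filterS2 (ae_forall_fin Zs_bound) ae_score_small.
exists (B `\` A); split; first exact: measurableD.
  apply: (le_trans PB); apply: (@le_trans _ _ (P ((B `\` A) `|` A))).
    apply: le_measure; rewrite ?inE//; first by apply: measurableU => //; exact: measurableD.
    by move=> w Bw; have [|] := pselect (A w); [right|left].
  apply: (le_trans (measureU2 _ _ mA)); first exact: measurableD.
  by rewrite [X in (_ + X <= _)%E](_ : _ = 0%E) ?adde0; last exact: A0.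
move=> w tau [Bw nAw] Tt.
have [Zw sw] : (forall i, enorm (Zs i w) <= xi) /\
    forall tau, T tau -> enorm (emp_psi (ghat w tau) tau w) <= m%:R * xi / n%:R.
  by apply: contrapT => H; exact/nAw/subA.
have dev1w b tau' := dev1 w b tau' Bw.
have dev2w b1 b2 := dev2 w b1 b2 Bw.
split.
- exact: (rem2_le t_gt0 t_le1 Zw sw near_gam dev1w dev2w c_small t_large).
- exact: (rem3_le t_gt0 t_le1 Zw sw near_gam dev1w dev2w c_small t_large).
- exact: (rem4_le t_gt0 t_le1 Zw sw near_gam dev1w dev2w c_small t_large).
Qed.

End remainder_event.

Section chosen_parameters.
Variables (rho speed theta kappa : R).
Local Notation delta :=
  (Num.sqrt (m%:R / n%:R * ln n%:R) + Num.sqrt (kappa / n%:R) + g).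
Local Notation C := (bahadur_constant M K fmin speed).
Hypothesis rho_large : Num.sqrt M * (2 + (tu - tl) / fmin) + 1 <= rho.
Hypotheses (speed_gt0 : 0 < speed) (theta_gt0 : 0 < theta).
Hypothesis speedE : speed * (fmin / M / 2) = 132 + 96 * (M + 1).
Hypothesis theta16 : 16 * theta <= 1.
Hypothesis theta_var : 8 * (K + 1) * M * speed * theta <= 1.
Hypothesis theta_quad : K * M * speed ^+ 2 * theta <= 1.
Hypothesis theta_speed : speed * (M + 1) * theta <= 1.
Hypotheses (kappa_gt0 : 0 < kappa) (g_ge0 : 0 <= g) (c_le1 : c <= 1).
Hypothesis c_small : K * c * M <= fmin / M / 2.
Hypothesis delta_small : xi * delta <= theta.
Hypothesis dim_small : m%:R * xi ^+ 2 * ln n%:R <= n%:R.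
Hypotheses (n_large1 : 2 * M <= n%:R) (n_large2 : 2 * M * rho <= speed * n%:R).
Hypothesis n_large3 : (M + 1) * (K + 1) * rho < n%:R.
Hypotheses (n_ge3 : (3 <= n)%N) (ln_ge1 : 1 <= ln n%:R :> R).

Let sp_ge0 : 0 <= (tu - tl) / fmin.
Proof. by apply: divr_ge0; rewrite ?subr_ge0// ltW. Qed.

Let rho_gt0 : 0 < rho.
Proof.
apply: lt_le_trans rho_large; rewrite ltr_wpDl// mulr_ge0 ?sqrtr_ge0//.
exact: addr_ge0.
Qed.

Let near_gam tau : T tau -> enorm (gam tau - gam tl) + 1 <= rho.
Proof.
move=> Tt; apply: le_trans rho_large; rewrite lerD2r.
have L0 := addr_ge0 (ler0n R 2) sp_ge0; have R0 := mulr_ge0 (sqrtr_ge0 M) L0.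
rewrite -(@ler_pXn2r _ 2) ?nnegrE ?enorm_ge0//.
apply: (le_trans (gam_spread Tt)).
rewrite exprMn sqr_sqrtr ?(ltW M_gt0)//; apply: (ler_wpM2l (ltW M_gt0)).
have c0 := c_ge0; apply: sqr_le_norm; rewrite ger0_norm.
  by rewrite lerD2r ler_piMr.
by rewrite addr_ge0// mulr_ge0.
Qed.

Lemma remainder_rates : exists E : set (Omega D), [/\ measurable E,
  ((1 - 2 * expR (- kappa))%:E <= P E)%E &
  forall w, E w -> [/\ (unorm T (rem2 w) <= (C * rate2 n m xi g kappa)%:E)%E,
    (unorm T (rem3 w) <= (C * rate3 n m xi g kappa)%:E)%E &
    (unorm T (rem4 w) <= (C * rate4 n m g c kappa)%:E)%E]].
Proof.
have K0 := K_ge0; have x0 := xi_gt0; have m0 := dimZ_gt0; have xl := xi_sqr_ge.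
have N0 : (0 < n ^ 3)%N by rewrite expn_gt0 n_gt0.
have level := level_gt0 m0 ln_ge1 kappa_gt0.
have radius := radius_gt0 speed_gt0 m g_ge0 kappa_gt0 n_gt0.
have radius1 := radius_le1 M_gt0 speed_gt0 theta_gt0 theta_speed x0 g_ge0 kappa_gt0
  n_gt0 xl delta_small.
have fine_u := mesh_of_directions M_gt0 m0 ln_ge1 n_gt0 xl dim_small n_large1.
have fine_b := mesh_of_coefficients M_gt0 rho_gt0 speed_gt0 kappa m0 ln_ge1 g_ge0 n_gt0
  xl dim_small n_large2.
have wide := band_covers_mesh M_gt0 K0 rho_gt0 m0 ln_ge1 x0 n_gt0 xl dim_small n_large3.
have thin := band_is_thin K0 m0 ln_ge1 kappa_gt0 n_gt0.
have large := radius_dominates M_gt0 K0 speed_gt0 speedE theta16 theta_var theta_quad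
  m0 ln_ge1 x0 g_ge0 kappa_gt0 n_gt0 delta_small.
have [E [mE PE HE]] := remainder_event level radius radius1 rho_gt0 N0 fine_u fine_b
  wide thin near_gam c_small large.
exists E; split => //.
  apply: le_trans PE; rewrite lee_fin lerD2l lerN2.
  exact: failure_probability.
move=> w Ew; split; apply: unorm_le => tau Tt; have [r2 r3 r4] := HE w tau Ew Tt.
- exact: (le_trans r2 (rem2_rate M_gt0 K0 fmin0 speed_gt0 n m g kappa x0)).
- exact: (le_trans r3 (rem3_rate M_gt0 K0 fmin0 speed_gt0 theta_gt0 theta16 m0 ln_ge1 x0
    g_ge0 kappa_gt0 n_gt0 delta_small)).
- exact: (le_trans r4 (rem4_rate M_gt0 K0 fmin0 speed_gt0 m g_ge0 kappa_gt0 n_gt0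
    c_ge0 c_le1)).
Qed.

End chosen_parameters.

End expansion.

End population.

(** * The expansion along the triangular array *)

Lemma inner_pr_ge (R : realType) d (T : measurableType d) (P : probability T R)
    (p : \bar R) (E A : set T) :
  measurable E -> (p <= P E)%E -> E `<=` A -> (p <= inner_pr P A)%E.
Proof. by move=> mE pE EA; apply: (le_trans pE); apply: ereal_sup_ubound; exists E. Qed.

Lemma ereal_cvg0_small (R : realType) (u : nat -> \bar R) (e : R) : 0 < e ->
  u n @[n --> \oo] --> 0%E ->
  \forall n \near \oo, u n \is a fin_num /\ `|fine (u n)| <= e.
Proof.
move=> e0 /fine_cvgP[ufin /cvgrPdist_le/(_ _ e0) uc].
near=> n; split; first by near: n.
by rewrite -normrN -sub0r; near: n.
Unshelve. all: by end_near. Qed.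

(** [g_err] could be infinite; its product with [xi] is eventually finite. *)
Lemma fin_num_factor (R : realType) (g : \bar R) (x : R) : 0 < x -> (0 <= g)%E ->
  (g * x%:E)%E \is a fin_num -> g \is a fin_num /\ fine (g * x%:E)%E = fine g * x.
Proof.
by move=> x0; case: g => [g| |]//= _; rewrite gt0_mulye ?lte_fin.
Qed.

Lemma xi_sqrt_le (R : realType) (x y e : R) : 0 <= x -> 0 <= e ->
  y * x ^+ 2 <= e ^+ 2 -> x * Num.sqrt y <= e.
Proof.
move=> x0 e0 h; rewrite -[leRHS](ger0_norm e0) -sqrtr_sqr -{1}(ger0_norm x0) -sqrtr_sqr.
by rewrite -sqrtrM ?sqr_ge0// ler_wsqrtr// mulrC.
Qed.

Theorem theorem5p1 (R : realType) (tl tu : R)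
    (D : forall n, qr_row R n) (xi : nat -> R)
    (gammahat : forall n, Omega (D n) -> R -> 'cV[R]_(dimZ (D n)))
    (gamma : forall n, R -> 'cV[R]_(dimZ (D n))) :
  let T := `[tl, tu]%classic in
  let g n := g_err T (gamma n) in
  let c n := c_err T (gamma n) in
  let m n := dimZ (D n) in
  let Re2 k n := rate2 n (m n) (xi n) (fine (g n)) (k n) in
  let Re3 k n := rate3 n (m n) (xi n) (fine (g n)) (k n) in
  let Re4 k n := rate4 n (m n) (fine (g n)) (fine (c n)) (k n) in
  0 < tl -> tl <= tu -> tu < 1 ->
  A1 D xi -> A2 D -> A3 D T ->
  (fun n => (m n)%:R * xi n ^+ 2 * ln n%:R) =o_\oo (fun n => n%:R : R) ->
  (forall n w tau, (0 < n)%N -> T tau ->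
     is_qr_estimator w tau (gammahat n w tau)) ->
  (g n * (xi n)%:E)%E @[n --> \oo] --> 0%E ->
  c n @[n --> \oo] --> 0%E ->
  exists r1 r2 r3 r4 : forall n, Omega (D n) -> R -> 'cV[R]_(dimZ (D n)),
  [/\ forall n w tau, (0 < n)%N -> T tau ->
        gammahat n w tau - gamma n tau =
          - (n%:R^-1 *: (invmx (Jm (D n) tau) *m
               \sum_(i < n) psi (Ys (D n) i w) (Zs i w) (gamma n tau) tau))
          + r1 n w tau + r2 n w tau + r3 n w tau + r4 n w tau,
      forall n, (0 < n)%N -> {ae Pr (D n), forall w,
        (unorm T (r1 n w) <=
         ((inf [set lambda_min (Jm (D n) tau) | tau in T])^-1 *
            ((m n)%:R * xi n / n%:R))%:E)%E} &
      exists2 C : R, 0 < C &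
        forall kappa : nat -> R, (forall n, 0 < kappa n) ->
        kappa n * xi n ^+ 2 / n%:R @[n --> \oo] --> 0 ->
        \forall n \near \oo,
          let p : \bar R := (1 - 2 * expR (- kappa n))%:E in
          let within r Re := [set w | (unorm T (r n w) <= (C * Re kappa n)%:E)%E] in
          [/\ (p <= inner_pr (Pr (D n)) (within r2 Re2))%E,
              (p <= inner_pr (Pr (D n)) (within r3 Re3))%E &
              (p <= inner_pr (Pr (D n)) (within r4 Re4))%E]].
Proof.
move=> T g c m Re2 Re3 Re4 tl0 tltu tu1 [Zs_b _ [M M0 gramM]] [smooth [K0 dens0]]
  [fmin fmin0 dens_min] dim_o ghat_min g_small c_small.
have [K K_ge0 dens] : exists2 K, 0 <= K & forall n x, (0 < n)%N -> calX (D n) x ->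
    forall y, `|condf x y| <= K /\ `|derive1 (condf x) y| <= K.
  exists `|K0| => // n x n0 Xx y; have [h1 h2] := dens0 n x n0 Xx y.
  by split; [exact: le_trans h1 (ler_norm _)|exact: le_trans h2 (ler_norm _)].
have smoothn n (n0 : (0 < n)%N) x Xx := smooth n x n0 Xx.
have densn n (n0 : (0 < n)%N) x Xx := dens n x n0 Xx.
have fM : 0 < fmin / M / 2 by rewrite !divr_gt0.
have [rho rho_large] : exists r, Num.sqrt M * (2 + (tu - tl) / fmin) + 1 <= r.
  by exists (Num.sqrt M * (2 + (tu - tl) / fmin) + 1).
have [speed speed_gt0 speedE] : exists2 s, 0 < s & s * (fmin / M / 2) = 132 + 96 * (M + 1).
  exists ((132 + 96 * (M + 1)) / (fmin / M / 2)); last by rewrite divfK ?gt_eqF.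
  by rewrite divr_gt0// addr_gt0// mulr_gt0// addr_gt0.
have [theta [theta_gt0 th1 th2 th3 th4]] := small_threshold M0 K_ge0 speed_gt0.
exists (fun n => rem1 (gammahat n)), (fun n => rem2 (xi n) (gamma n) (gammahat n)),
  (fun n => rem3 (xi n) (gamma n) (gammahat n)), (fun n => rem4 (xi n) (gamma n) (gammahat n)).
split.
- move=> n w tau n0 Tt; have [gm _] := gramM n n0.
  exact: (bahadur_expansion n0 (Zs_b n) M0 gm (smoothn n n0) (densn n n0) tl0 tu1 fmin0
    (dens_min n n0) _ _ w Tt).
- move=> n n0; have [gm _] := gramM n n0.
  exact: (rem1_bound n0 (Zs_b n) M0 gm (smoothn n n0) (densn n n0) tl0 tltu tu1 fmin0
    (dens_min n n0) (fun w tau => @ghat_min n w tau n0)).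
exists (bahadur_constant M K fmin speed); first exact: bahadur_constant_gt0.
move=> kappa kappa_gt0 kappa_small.
pose c0 := Num.min 1 (fmin / M / 2 / (K * M + 1)).
have c0_gt0 : 0 < c0.
  by rewrite lt_min ltr01/= divr_gt0// ltr_wpDl// mulr_ge0// ltW.
(* a quarter of [theta] for each stochastic rate leaves half of it for [g] *)
pose e := theta / 4; have e_gt0 : 0 < e by rewrite divr_gt0.
have e2_gt0 : 0 < e ^+ 2 by rewrite exprn_gt0.
have gs := ereal_cvg0_small (divr_gt0 theta_gt0 (ltr0Sn R 1)) g_small.
have cs := ereal_cvg0_small c0_gt0 c_small.
move/cvgrPdist_le/(_ _ e2_gt0): kappa_small => ks.
move/eqoP/(_ _ e2_gt0): dim_o => ds.
near=> n.
have n_ge3 : (3 <= n)%N by near: n; exact: nbhs_infty_ge.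
have n_exp : expR 1 <= n%:R :> R by near: n; exact: nbhs_infty_ger.
have n_large1 : 2 * M <= n%:R by near: n; exact: nbhs_infty_ger.
have n_large2 : 2 * M * rho / speed <= n%:R by near: n; exact: nbhs_infty_ger.
have n_large3 : (M + 1) * (K + 1) * rho + 1 <= n%:R by near: n; exact: nbhs_infty_ger.
have [gfin gle] : (g n * (xi n)%:E)%E \is a fin_num /\
  `|fine (g n * (xi n)%:E)%E| <= theta / 2 by near: n; exact: gs.
have [cfin cle] : c n \is a fin_num /\ `|fine (c n)| <= c0 by near: n; exact: cs.
have kn : `|0 - kappa n * xi n ^+ 2 / n%:R| <= e ^+ 2 by near: n; exact: ks.
have dn : `|(m n)%:R * xi n ^+ 2 * ln n%:R| <= e ^+ 2 * `|n%:R : R| by near: n; exact: ds.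
have n0 : (0 < n)%N by exact: leq_trans n_ge3.
have nR : 0 < n%:R :> R by rewrite ltr0n.
have ln_ge1 : 1 <= ln n%:R :> R by rewrite -[leLHS]expRK ler_ln ?posrE ?expR_gt0.
have [gm gM] := gramM n n0.
have x0 := xi_gt0 n0 (Zs_b n) M0 gm.
have Tl : T tl by rewrite /T/= in_itv/= lexx.
have g_ge0 : (0 <= g n)%E.
  apply: le_trans (ereal_sup_ubound _); [|exists tl; [|reflexivity]] => //.
  by rewrite lee_fin enorm_ge0.
have [gfin' gE] := fin_num_factor x0 g_ge0 gfin.
have fg_ge0 : 0 <= fine (g n) by rewrite fine_ge0.
have c_bound tau x : T tau -> calX (D n) x ->
    `|condQ x tau - dotv (Z (D n) x) (gamma n tau)| <= fine (c n).
  move=> Tt Xx; rewrite -lee_fin fineK//.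
  by apply: ereal_sup_ubound; exists x => //; exists tau.
have g_bound tau : T tau -> enorm (mean_score (xi n) (gamma n tau) -
    tau *: mean_regressor (D n) (xi n)) <= fine (g n).
  move=> Tt; rewrite -lee_fin fineK// -(expect_score n0 (Zs_b n)).
  by apply: ereal_sup_ubound; exists tau.
have fc_le : fine (c n) <= c0 := le_trans (ler_norm _) cle.
have fc_le1 : fine (c n) <= 1 by apply: le_trans fc_le _; rewrite ge_min lexx.
have KM0 : 0 < K * M + 1 by rewrite ltr_wpDl// mulr_ge0// ltW.
have fc_ge0 : 0 <= fine (c n).
  by have [w _] := ae_exists (ztr_ae n0 (Zs_b n)); exact: le_trans (c_bound tl _ Tl (X_in w)).
have Kc : K * fine (c n) * M <= fmin / M / 2.
  have : fine (c n) * (K * M + 1) <= fmin / M / 2.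
    by rewrite -ler_pdivlMr//; apply: (le_trans fc_le); rewrite ge_min lexx orbT.
  by apply: le_trans; rewrite mulrDr mulr1 mulrA [_ * K]mulrC lerDl.
have dim_e : (m n)%:R * xi n ^+ 2 * ln n%:R <= e ^+ 2 * n%:R.
  by move: dn; rewrite (ger0_norm (ltW nR)); apply: le_trans; exact: ler_norm.
have theta_le1 : theta <= 1 by move: th1 theta_gt0; clear => *; lra.
have dim_small : (m n)%:R * xi n ^+ 2 * ln n%:R <= n%:R.
  apply: (le_trans dim_e); rewrite ler_piMl ?(ltW nR)//.
  by rewrite exprn_ile1 ?(ltW e_gt0)// /e; move: theta_le1; clear => *; lra.
have delta_small : xi n * (Num.sqrt ((m n)%:R / n%:R * ln n%:R) +
    Num.sqrt (kappa n / n%:R) + fine (g n)) <= theta.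
  have h1 : xi n * Num.sqrt ((m n)%:R / n%:R * ln n%:R) <= e.
    apply: xi_sqrt_le; rewrite ?(ltW x0) ?(ltW e_gt0)//.
    have -> : (m n)%:R / n%:R * ln n%:R * xi n ^+ 2 =
      (m n)%:R * xi n ^+ 2 * ln n%:R / n%:R by ring.
    by rewrite ler_pdivrMr.
  have h2 : xi n * Num.sqrt (kappa n / n%:R) <= e.
    apply: xi_sqrt_le; rewrite ?(ltW x0) ?(ltW e_gt0)//.
    by rewrite mulrAC; move: kn; rewrite sub0r normrN; exact/le_trans/ler_norm.
  have h3 : xi n * fine (g n) <= theta / 2.
    by rewrite mulrC -gE; exact: le_trans (ler_norm _) gle.
  by rewrite !mulrDr; move: h1 h2 h3; rewrite /e; clear => *; lra.
have n_large2' : 2 * M * rho <= speed * n%:R by rewrite [leRHS]mulrC -ler_pdivrMr.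
have n_large3' : (M + 1) * (K + 1) * rho < n%:R by move: n_large3; clear => *; lra.
have [E [mE PE HE]] := remainder_rates n0 (Zs_b n) M0 gm gM (smoothn n n0) (densn n n0)
  tl0 tltu tu1 fmin0 (dens_min n n0) (fun tau Tt x Xx => c_bound tau x Tt Xx) g_bound
  (fun w tau => @ghat_min n w tau n0) rho_large speed_gt0 theta_gt0 speedE th1 th2 th3 th4
  (kappa_gt0 n) fg_ge0 fc_le1 Kc delta_small dim_small n_large1 n_large2' n_large3'
  n_ge3 ln_ge1.
by split; apply: inner_pr_ge mE PE _ => w /HE[].
Unshelve. all: by end_near. Qed.
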